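(* Let $D\subset\mathbb{C}^n$ be a domain and let $F=\sqrt{r\,\phi(t,s)}$ be a unitary invariant complex Randers metric on $D$, where $r:=|v|^2$, $t:=|z|^2$, $s:=\frac{|\langle z,v\rangle|^2}{r}$ for $z\in D$, $v\in T_zD$. Then $F$ is weakly Kähler if and only if there is a positive smooth function $f(t)$ such that either $$\phi(t,s)=\Big(\sqrt{f(t)+\frac{t f'(t)-f(t)}{2t}\,s}+\sqrt{\frac{t f'(t)+f(t)}{2t}\,s}\Big)^2$$ or $$\phi(t,s)=f(t)+f'(t)\,s .$$
   Context: Identify the holomorphic tangent bundle $T^{1,0}D$ of $D\subset\mathbb{C}^n$ with $D\times\mathbb{C}^n$, with points $(z,v)$, $v=v^\alpha\frac{\partial}{\partial z^\alpha}$, and $\langle z,v\rangle=\sum_\alpha z^\alpha\overline{v^\alpha}$. A complex Finsler metric on a complex manifold $M$ is a continuous function $F:T^{1,0}M\to[0,+\infty)$ such that, with $G=F^2$, $G(z,v)=0$ iff $v=0$, and $G(z,\lambda v)=|\lambda|^2G(z,v)$ for all $\lambda\in\mathbb{C}$. It is unitary invariant on a domain $D\subset\mathbb{C}^n$ ($D$ being understood to be invariant under $U(n)$) if $F(Az,Av)=F(z,v)$ for all $(z,v)\in T^{1,0}D$ and all unitary matrices $A\in U(n)$. A complex Finsler metric is a complex Randers metric if $F=\alpha+|\beta|$ with $\alpha=\sqrt{a_{i\bar j}(z)v^i\bar v^j}$ a (positive definite) Hermitian metric and $\beta=b_i(z)v^i$ a $(1,0)$-form ($\beta=0$ allowed).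 A unitary invariant metric $F=\sqrt{r\phi(t,s)}$ is a complex Randers metric iff $\phi=\big(\sqrt{f(t)+g(t)s}+\sqrt{h(t)s}\big)^2$ with $f,g,h$ smooth functions, $f>0$, $h\ge 0$. Such an $F$ need not be smooth in directions with $\beta(v)=0$; differential conditions on $F$ are understood at points where $G$ is smooth. Weakly Kähler: subscripts $\alpha,\bar\beta$ on $G$ denote $\partial/\partial v^\alpha,\ \partial/\partial\bar v^\beta$, and subscripts after a semicolon denote derivatives in $z$ (or $\bar z$); e.g. $G_\alpha=\partial G/\partial v^\alpha$, $G_{\alpha\bar\beta}=\partial^2G/\partial v^\alpha\partial\bar v^\beta$, $G_{\bar\gamma;\beta}=\partial^2G/\partial\bar v^\gamma\partial z^\beta$; $(G^{\alpha\bar\beta})$ is the inverse of $(G_{\alpha\bar\beta})$. Put $N^\alpha_\beta=G^{\alpha\bar\gamma}G_{\bar\gamma;\beta}$, $\frac{\delta}{\delta z^\alpha}=\frac{\partial}{\partial z^\alpha}-N^\beta_\alpha\frac{\partial}{\partial v^\beta}$, and $\Gamma^\alpha_{\beta;\gamma}=G^{\alpha\bar\eta}\frac{\delta G_{\beta\bar\eta}}{\delta z^\gamma}$ (horizontal coefficients of the Chern–Finsler connection). $F$ is weakly Kähler if $G_\alpha\Gamma^\alpha_{\beta;\gamma}v^\gamma=G_\alpha\Gamma^\alpha_{\gamma;\beta}v^\gamma$ for all $\beta$.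
   Formalization: The dimension is assumed to satisfy n ≥ 2; for n = 1 one has s = t, every such F is weakly Kähler, and F = (1+||z|²−1|)|v| on |z| > 1/2 is a counterexample. *)

(* Defs.v *)
From HB Require Import structures.
From mathcomp Require Import all_boot all_order all_algebra.
From mathcomp Require Import complex spectral.
From mathcomp Require Import all_classical all_reals all_analysis.

Set Implicit Arguments.
Unset Strict Implicit.
Unset Printing Implicit Defensive.

Import Order.TTheory GRing.Theory Num.Theory numFieldNormedType.Exports.

Local Open Scope classical_set_scope.
Local Open Scope ring_scope.
Local Open Scope complex_scope.

(* R[i] with the topology and norm given by its modulus: those of the library
   for an abstract numClosedFieldType. *)
#[non_forgetful_inheritance]
HB.instance Definition _ (R : realType) :=
  PseudoPointedMetric.copy R[i] (R[i] : numClosedFieldType).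
#[non_forgetful_inheritance]
HB.instance Definition _ (R : realType) :=
  NormedModule.copy R[i] (R[i] : numClosedFieldType).

(* The total space of T^{1,0} C^n, with points (z, v).  A function on T^{1,0} D
   is a total function on this type of which only the values over D matter. *)
Notation T10 R n := ('cV[R[i]]_n * 'cV[R[i]]_n)%type.

Section RealSmoothness.
Variables (R : realType) (V : normedModType R[i]).
Implicit Types (f : V -> R) (U : set V) (p w : V).

(* Differentiation in the real sense: the increment h ranges over R.  (The
   library's [derive] on V would take h in R[i].) *)
Definition real_line f p w : R -> R := fun h => f (p + h%:C *: w).

Definition dir_derive f p w : R := derive1 (real_line f p w) 0.

Definition iter_dir_derive f (ws : seq V) : V -> R :=
  foldr (fun w g p => dir_derive g p w) f ws.

(* For U open: all iterated directional derivatives of f exist and are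
   continuous on U. *)
Definition smooth_on U f : Prop :=
  forall (ws : seq V) p, U p ->
    {for p, continuous (iter_dir_derive f ws)} /\
    (forall w, derivable (real_line (iter_dir_derive f ws) p w) 0 1).

Definition smooth_at f p : Prop := exists2 U, open_nbhs p U & smooth_on U f.

Definition Csmooth_on U (f : V -> R[i]) : Prop :=
  smooth_on U (fun p => complex.Re (f p)) /\
  smooth_on U (fun p => complex.Im (f p)).

Definition Cdir_derive (f : V -> R[i]) p w : R[i] :=
  dir_derive (fun q => complex.Re (f q)) p w +i*
  dir_derive (fun q => complex.Im (f q)) p w.

(* Wirtinger derivatives along the complex direction e:
   d/de = (D_e - i D_{ie}) / 2 and d/d(conj e) = (D_e + i D_{ie}) / 2. *)
Definition wirtinger (e : V) (f : V -> R[i]) : V -> R[i] :=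
  fun p => (Cdir_derive f p e - 'i * Cdir_derive f p ('i *: e)) / 2.

Definition wirtinger_bar (e : V) (f : V -> R[i]) : V -> R[i] :=
  fun p => (Cdir_derive f p e + 'i * Cdir_derive f p ('i *: e)) / 2.

End RealSmoothness.

Section SmoothWithin.
Variable R : realType.

(* Derivative at x relative to I: one-sided when x is an endpoint of the
   interval I, the usual derivative when x is interior to I. *)
Definition quotient_at (f : R -> R) (x : R) : R -> R :=
  fun y => (f y - f x) / (y - x).

Definition derive_within (I : set R) (f : R -> R) (x : R) : R :=
  lim (quotient_at f x y @[y --> within I x^']).

Definition smooth_within (I : set R) (f : R -> R) : Prop :=
  forall (k : nat) x, I x ->
    cvg (quotient_at (iter k (derive_within I) f) x y @[y --> within I x^']).

End SmoothWithin.

Section ComplexFinsler.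
Variables (R : realType) (n : nat).
Implicit Types (z v : 'cV[R[i]]_n) (D : set 'cV[R[i]]_n) (F : T10 R n -> R).

Definition hdot z v : R[i] := \sum_(a < n) z a 0 * (v a 0)^*.

Definition sqnorm v : R := complex.Re (hdot v v).

Definition svar z v : R := Normc.normc (hdot z v) ^+ 2 / sqnorm v.

Definition domain D : Prop := [/\ open D, connected D & D !=set0].

Definition is_complex_finsler D F : Prop :=
  [/\ {within D `*` setT, continuous F},
      forall z v, D z -> 0 <= F (z, v),
      forall z v, D z -> (F (z, v) ^+ 2 = 0 <-> v = 0) &
      forall z v (c : R[i]), D z ->
        F (z, c *: v) ^+ 2 = Normc.normc c ^+ 2 * F (z, v) ^+ 2].

Definition unitary_invariant D F : Prop :=
  forall (A : 'M[R[i]]_n) z v, A \is unitarymx -> D z ->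
    D (A *m z) /\ F (A *m z, A *m v) = F (z, v).

Definition herm_form (a : 'M[R[i]]_n) v : R[i] :=
  \sum_(i < n) \sum_(j < n) a i j * v i 0 * (v j 0)^*.

(* 0 < c in R[i] means that c is real and positive. *)
Definition is_hermitian_metric D (a : 'cV[R[i]]_n -> 'M[R[i]]_n) : Prop :=
  [/\ forall i j, Csmooth_on D (fun z => a z i j),
      forall z i j, D z -> a z j i = (a z i j)^* &
      forall z v, D z -> v != 0 -> 0 < herm_form (a z) v].

Definition is_form10 D (b : 'cV[R[i]]_n -> 'rV[R[i]]_n) : Prop :=
  forall i, Csmooth_on D (fun z => b z 0 i).

Definition is_complex_randers D F : Prop :=
  is_complex_finsler D F /\
  exists a b, [/\ is_hermitian_metric D a, is_form10 D b &
    forall z v, D z ->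
      F (z, v) = Num.sqrt (complex.Re (herm_form (a z) v)) +
                 Normc.normc (\sum_(i < n) b z 0 i * v i 0)].

Section ChernFinsler.
Variable F : T10 R n -> R.

Definition dir_z (a : 'I_n) : T10 R n := (delta_mx a 0, 0).
Definition dir_v (a : 'I_n) : T10 R n := (0, delta_mx a 0).

Definition Gfun (p : T10 R n) : R[i] := (F p ^+ 2)%:C.

(* G_a, G_{abar}, G_{a bbar} and G_{cbar;b}. *)
Definition G_v a := wirtinger (dir_v a) Gfun.
Definition G_vbar a := wirtinger_bar (dir_v a) Gfun.
Definition G_vvbar a b := wirtinger (dir_v a) (G_vbar b).
Definition G_vbar_z c b := wirtinger (dir_z b) (G_vbar c).

Definition levi_mx (p : T10 R n) : 'M[R[i]]_n := \matrix_(a, b) G_vvbar a b p.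

(* G^{a bbar}, normalized by \sum_b G^{a bbar} G_{c bbar} = (a == c); hence the
   transposition of indices. *)
Definition G_inv (a b : 'I_n) (p : T10 R n) : R[i] := invmx (levi_mx p) b a.

Definition Ncoef (a b : 'I_n) (p : T10 R n) : R[i] :=
  \sum_(c < n) G_inv a c p * G_vbar_z c b p.

Definition delta_z (a : 'I_n) (f : T10 R n -> R[i]) (p : T10 R n) : R[i] :=
  wirtinger (dir_z a) f p - \sum_(b < n) Ncoef b a p * wirtinger (dir_v b) f p.

(* Gamma^a_{b;c} *)
Definition Gamma (a b c : 'I_n) (p : T10 R n) : R[i] :=
  \sum_(e < n) G_inv a e p * delta_z c (G_vvbar b e) p.

End ChernFinsler.

(* The condition is imposed at the points of T^{1,0}D minus the zero section
   where G = F^2 is smooth. *)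
Definition weakly_kahler D F : Prop :=
  forall z v, D z -> v != 0 -> smooth_at (fun p => F p ^+ 2) (z, v) ->
  forall b : 'I_n,
    \sum_(a < n) \sum_(c < n) G_v F a (z, v) * Gamma F a b c (z, v) * v c 0 =
    \sum_(a < n) \sum_(c < n) G_v F a (z, v) * Gamma F a c b (z, v) * v c 0.

(* The set of values of t = |z|^2: an interval, with left endpoint 0 when D
   contains the origin. *)
Definition trange D : set R := [set sqnorm z | z in D].

End ComplexFinsler.

(* Main.v *)
Require Import Defs.
From HB Require Import structures.
From mathcomp Require Import all_boot all_order all_algebra.
From mathcomp Require Import complex spectral.
From mathcomp Require Import all_classical all_reals all_analysis.
From mathcomp Require Import ring lra.

(** Why the theorem holds.  Write t = |z|^2, r = |v|^2, q = |<z, v>|^2 = r s and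
    G = F^2, which depends on t, r and q only; subscripts t, r, q denote its partial
    derivatives.

    The condition as one equation.  By homogeneity in v the inverse Levi matrix and
    the vertical derivatives cancel from the weak Kaehler condition, which becomes
    v^c G_(b;c) - S^a G_(ab) = G_(;b) with S the complex spray
    ([weakly_kahler_spray]).  For a function of t, r and q the Levi matrix is a
    multiple of the identity up to the span of v and z, so S is found by eliminating
    in a 2x2 system.  The two sides then differ by a multiple of conj u, where u is
    the component of z orthogonal to v and |u|^2 = t - s.  Hence the condition is a
    single equation between numbers, void when s = t ([weakly_kahler_scalar]).

    Randers metrics whose 1-form is a multiple of <v, z>.  Here F = a + b with
    a^2 = f r + g q and b^2 = h q.  Up to a nonvanishing factor the equation reads

      (g + h - f') (f + t g) + (b / a) C(s) / (s h) = 0,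

    with C a quadratic polynomial in s whose coefficients depend on t
    ([typeI_defect]).  As b / a is of order sqrt s, letting s tend to 0 gives C(0) = 0
    and g + h = f', which amount to g = (t f' - f) / (2 t) and
    h = (t f' + f) / (2 t) ([typeI_limit]); conversely C then vanishes identically
    ([typeI_solution]).  If h = 0, the metric is Hermitian and the equation is g = f'
    ([weakly_kahler_hermitian]).

    Reduction to these metrics.  At z = x e choose a unit vector u orthogonal to e.
    F (z, c e + d u) does not depend on the phase of d.  By strict concavity of the
    square root ([phase_constant]) e and u are then orthogonal for the Hermitian
    part, and the 1-form kills e or u.  If it did not kill u, then b^2 = h (t r - q)
    near z, and the equation would fail at second order as s tends to 0
    ([typeII_absurd]).  So the 1-form is a multiple of <v, z>.

    From points to the domain.  Where h > 0 the formulas give f + t g = t h, so the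
    continuous function t h / (f + t g) takes the values 0 and 1 only; as the range
    of t is an interval, h is everywhere positive or everywhere 0 off t = 0
    ([coef_h_dichotomy]).  The function f is phi (t, 0), and f (x^2) is a value of
    the Hermitian form at x e, a smooth even function of x; dividing by x as in
    Hadamard's lemma makes f smooth in t, also at t = 0 ([square_iter]).

    Sufficiency.  The Hermitian case is immediate.  In the Randers case the domain
    cannot contain 0, since F^2 would have two limits there ([form_one_zero]); at the
    vectors with s = 0, F^2 has a corner and there is nothing to check
    ([form_one_cusp]); everywhere else [typeI_solution] applies. *)

Set Implicit Arguments.
Unset Strict Implicit.
Unset Printing Implicit Defensive.

Import Order.TTheory GRing.Theory Num.Theory numFieldNormedType.Exports.

Local Open Scope classical_set_scope.
Local Open Scope ring_scope.
Local Open Scope complex_scope.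

(** * Smooth functions and directional derivatives *)

Section Line.
Variables (R : realType) (V : normedModType R[i]).
Implicit Types (f g : V -> R) (U : set V) (p w : V).

Lemma near_line U p w : nbhs p U ->
  \forall h \near (0 : R), U (p + h%:C *: w).
Proof.
case/nbhs_ballP => e e0 He.
have [e1 w1] : complex.Im e = 0 /\ complex.Im `|w| = 0.
  by split; apply/ger0_Im => //; exact: ltW.
have {}e0 : 0 < complex.Re e by move: e0; rewrite /= ltcE => /andP[].
have w0 : 0 <= complex.Re `|w| by have := normr_ge0 w; rewrite lecE => /andP[].
apply/nbhs_ballP; exists (complex.Re e / (complex.Re `|w| + 1)) => /=.
  by rewrite divr_gt0// ltr_wpDl.
move=> h /=; rewrite -ball_normE /= sub0r normrN ltr_pdivlMr ?ltr_wpDl// => he.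
apply: He; rewrite -ball_normE /= opprD addNKr normrN normrZ normc_def /=.
rewrite expr0n addr0 sqrtr_sqr ltcE /= e1; case: (`|w|) w0 w1 he => a b /= a0 ->.
rewrite !mul0r !mulr0 subr0 addr0 eqxx /= => he.
by apply: le_lt_trans he; rewrite ler_wpM2l// lerDl.
Qed.

Lemma real_line0 f p w : real_line f p w 0 = f p.
Proof. by rewrite /real_line scale0r addr0. Qed.

Lemma near_real_line f g p w : (\forall q \near p, f q = g q) ->
  \forall h \near (0 : R), real_line f p w h = real_line g p w h.
Proof. exact: near_line. Qed.

Lemma is_derive_line_near f g p w (d : R) :
  is_derive (0 : R) 1 (real_line f p w) d -> (\forall q \near p, f q = g q) ->
  is_derive (0 : R) 1 (real_line g p w) d.
Proof. by move=> df /near_real_line fg; apply: near_eq_is_derive df; exact: fg. Qed.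

Lemma is_derive_dir f p w (d : R) :
  is_derive (0 : R) 1 (real_line f p w) d -> dir_derive f p w = d.
Proof. by move=> H; rewrite /dir_derive derive1E derive_val. Qed.

Lemma derivable_dir f p w : derivable (real_line f p w) 0 1 ->
  is_derive (0 : R) 1 (real_line f p w) (dir_derive f p w).
Proof. by move=> H; rewrite /dir_derive derive1E; exact/derivableP. Qed.

(** The functions obtained from smooth ones by algebraic operations form a
    class stable under directional differentiation, so their smoothness
    follows from their continuity and derivability alone. *)
Inductive smooth_alg U : (V -> R) -> Prop :=
| smooth_alg_gen f : smooth_on U f -> smooth_alg U f
| smooth_alg_cst c : smooth_alg U (fun=> c)
| smooth_alg_add f g : smooth_alg U f -> smooth_alg U g ->
    smooth_alg U (fun p => f p + g p)
| smooth_alg_mul f g : smooth_alg U f -> smooth_alg U g ->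
    smooth_alg U (fun p => f p * g p)
| smooth_alg_inv f : smooth_alg U f -> (forall p, U p -> f p != 0) ->
    smooth_alg U (fun p => (f p)^-1)
| smooth_alg_sqrt f : smooth_alg U f -> (forall p, U p -> 0 < f p) ->
    smooth_alg U (fun p => Num.sqrt (f p)).

Lemma smooth_on_dir U f w : smooth_on U f -> smooth_on U (fun p => dir_derive f p w).
Proof.
move=> sf ws p Up; move: (sf (rcons ws w) p Up).
by rewrite /iter_dir_derive foldr_rcons.
Qed.

Lemma smooth_alg_cont U f p : smooth_alg U f -> U p -> {for p, continuous f}.
Proof.
move=> sf Up; elim: sf => {f} [f|c|f g _ ? _ ?|f g _ ? _ ?|f _ ? f0|f _ cf f0].
- by move=> /(_ [::] p Up)[].
- exact: cvg_cst.
- exact: cvgD.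
- exact: cvgM.
- by apply: cvgV => //; exact: f0.
- apply: (continuous_comp cf); exact: sqrt_continuous.
Qed.

Lemma smooth_alg_deriv U f w : smooth_alg U f -> exists2 g, smooth_alg U g &
  forall p, U p -> is_derive (0 : R) 1 (real_line f p w) (g p).
Proof.
elim=> {f} [f sf|c|f g sf [f' sf' df] sg [g' sg' dg]|
  f g sf [f' sf' df] sg [g' sg' dg]|f sf [f' sf' df] f0|f sf [f' sf' df] f0].
- exists (fun p => dir_derive f p w).
    exact/smooth_alg_gen/smooth_on_dir.
  by move=> p Up; apply: derivable_dir; have [] := sf [::] p Up.
- exists (fun=> 0); first exact: smooth_alg_cst.
  by move=> p Up; exact: is_derive_cst.
- exists (fun p => f' p + g' p); first exact: smooth_alg_add.
  by move=> p Up; exact: is_deriveD (df p Up) (dg p Up).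
- exists (fun p => f p * g' p + g p * f' p).
    by apply: smooth_alg_add; exact: smooth_alg_mul.
  move=> p Up; have := is_deriveM (df p Up) (dg p Up).
  by rewrite !real_line0.
- exists (fun p => -1 * ((f p)^-1 * (f p)^-1) * f' p).
    apply: smooth_alg_mul => //; apply: smooth_alg_mul => //.
      exact: smooth_alg_cst.
    by apply: smooth_alg_mul; exact: smooth_alg_inv.
  move=> p Up; have := @is_deriveV _ (real_line f p w) _ _ _ _ (df p Up).
  rewrite !real_line0 => /(_ (f0 p Up)) H.
  by apply: is_derive_eq; rewrite expr2 invfM mulN1r.
- exists (fun p => (2 * Num.sqrt (f p))^-1 * f' p).
    apply: smooth_alg_mul => //; apply: smooth_alg_inv.
      apply: smooth_alg_mul; first exact: smooth_alg_cst.
      exact: smooth_alg_sqrt.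
    by move=> p /f0 fp; rewrite mulf_neq0// sqrtr_eq0 -ltNge.
  move=> p Up.
  have dsq : is_derive (real_line f p w 0) 1 Num.sqrt (2 * Num.sqrt (f p))^-1.
    by rewrite real_line0; exact: is_derive1_sqrt (f0 p Up).
  exact: (is_derive1_comp dsq (df p Up)).
Qed.

Lemma smooth_alg_smooth U f : open U -> smooth_alg U f -> smooth_on U f.
Proof.
move=> oU sf ws p Up.
have [g sg fg] : exists2 g, smooth_alg U g &
    forall q, U q -> iter_dir_derive f ws q = g q.
  elim: ws => [|w ws [g sg fg]]; first by exists f.
  have [g' sg' dg] := smooth_alg_deriv w sg; exists g' => // q Uq.
  apply: is_derive_dir; apply: (is_derive_line_near (dg q Uq)).
  by near=> q'; apply/esym/fg; near: q'; exact: open_nbhs_nbhs.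
have nfg : \forall q \near p, g q = iter_dir_derive f ws q.
  by near=> q; rewrite fg//; near: q; exact: open_nbhs_nbhs.
split.
  have := smooth_alg_cont sg Up.
  rewrite /prop_for /continuous_at -(fg p Up); apply: cvg_trans.
  exact: near_eq_cvg nfg.
move=> w; have [g' sg' dg] := smooth_alg_deriv w sg.
by have [] := is_derive_line_near (dg p Up) nfg.
Unshelve. all: by end_near. Qed.

Lemma smooth_on_eq U f g : open U -> smooth_on U f ->
  (forall p, U p -> f p = g p) -> smooth_on U g.
Proof.
move=> oU sf fg ws p Up.
have H q : U q -> iter_dir_derive f ws q = iter_dir_derive g ws q.
  elim: ws q => [|w ws IH] q Uq /=; first exact: fg.
  rewrite /dir_derive !derive1E; apply: near_eq_derive.
  apply: near_real_line; near=> q'; apply: IH; near: q'.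
  exact: open_nbhs_nbhs.
have nfg : \forall q \near p, iter_dir_derive f ws q = iter_dir_derive g ws q.
  by near=> q; rewrite H//; near: q; exact: open_nbhs_nbhs.
have [cf df] := sf ws p Up; split.
  move: cf; rewrite /prop_for /continuous_at (H p Up); apply: cvg_trans.
  exact: near_eq_cvg nfg.
move=> w; apply: near_eq_derivable (df w); exact: near_real_line.
Unshelve. all: by end_near. Qed.

End Line.

(** * Wirtinger derivatives *)

Section ComplexParts.
Variable R : realType.
Implicit Types x y : R[i].

Lemma cReD x y : complex.Re (x + y) = complex.Re x + complex.Re y.
Proof. exact: raddfD. Qed.

Lemma cImD x y : complex.Im (x + y) = complex.Im x + complex.Im y.
Proof. exact: raddfD. Qed.

Lemma cReM x y :
  complex.Re (x * y) = complex.Re x * complex.Re y - complex.Im x * complex.Im y.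
Proof. by case: x y => [? ?] [? ?]. Qed.

Lemma cImM x y :
  complex.Im (x * y) = complex.Re x * complex.Im y + complex.Im x * complex.Re y.
Proof. by case: x y => [? ?] [? ?]. Qed.

Lemma cImJ x : complex.Im x^* = - complex.Im x.
Proof. by case: x. Qed.

End ComplexParts.

Section Wirtinger.
Variables (R : realType) (V : normedModType R[i]).
Implicit Types (f g : V -> R[i]) (U : set V) (p w e : V) (d : R[i]).

Definition cline f p w d :=
  is_derive (0 : R) 1 (real_line (fun q => complex.Re (f q)) p w) (complex.Re d) /\
  is_derive (0 : R) 1 (real_line (fun q => complex.Im (f q)) p w) (complex.Im d).

Lemma cline_val f p w d : cline f p w d -> Cdir_derive f p w = d.
Proof.
case=> fr fi; rewrite /Cdir_derive (is_derive_dir fr) (is_derive_dir fi).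
by case: (d).
Qed.

Lemma cline_eq f p w d d' : cline f p w d -> d = d' -> cline f p w d'.
Proof. by move=> ? <-. Qed.

Lemma cline_near f g p w d : cline f p w d -> (\forall q \near p, f q = g q) ->
  cline g p w d.
Proof.
move=> [fr fi] fg; split.
  by apply: is_derive_line_near fr _; apply: filterS fg => q ->.
by apply: is_derive_line_near fi _; apply: filterS fg => q ->.
Qed.

Lemma cline_cst c p w : cline (fun=> c) p w 0.
Proof. by split; exact: is_derive_cst. Qed.

Lemma cline_real (u : V -> R) p w (l : R) :
  is_derive (0 : R) 1 (real_line u p w) l -> cline (fun q => (u q)%:C) p w l%:C.
Proof. by split => //; exact: is_derive_cst. Qed.

Lemma cline_add f g p w d d' : cline f p w d -> cline g p w d' ->
  cline (fun q => f q + g q) p w (d + d').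
Proof.
move=> [fr fi] [gr gi]; split.
  have H := is_deriveD fr gr.
  have -> : real_line (fun q => complex.Re (f q + g q)) p w =
    real_line (fun q => complex.Re (f q)) p w + real_line (fun q => complex.Re (g q)) p w.
    by apply/funext => h; rewrite /real_line raddfD.
  by apply: is_derive_eq; rewrite raddfD.
have H := is_deriveD fi gi.
have -> : real_line (fun q => complex.Im (f q + g q)) p w =
    real_line (fun q => complex.Im (f q)) p w + real_line (fun q => complex.Im (g q)) p w.
  by apply/funext => h; rewrite /real_line raddfD.
by apply: is_derive_eq; rewrite raddfD.
Qed.

Lemma cline_mul f g p w d d' : cline f p w d -> cline g p w d' ->
  cline (fun q => f q * g q) p w (f p * d' + g p * d).
Proof.
move=> [fr fi] [gr gi].
split.
  have H := is_deriveB (is_deriveM fr gr) (is_deriveM fi gi).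
  have -> : real_line (fun q => complex.Re (f q * g q)) p w =
    real_line (fun q => complex.Re (f q)) p w * real_line (fun q => complex.Re (g q)) p w
    - real_line (fun q => complex.Im (f q)) p w * real_line (fun q => complex.Im (g q)) p w.
    by apply/funext => h; exact: cReM.
  apply: is_derive_eq; rewrite !real_line0 cReD !cReM /GRing.scale /=; ring.
have H := is_deriveD (is_deriveM fr gi) (is_deriveM fi gr).
have -> : real_line (fun q => complex.Im (f q * g q)) p w =
    real_line (fun q => complex.Re (f q)) p w * real_line (fun q => complex.Im (g q)) p w
    + real_line (fun q => complex.Im (f q)) p w * real_line (fun q => complex.Re (g q)) p w.
  by apply/funext => h; exact: cImM.
apply: is_derive_eq; rewrite !real_line0 cImD !cImM /GRing.scale /=; ring.
Qed.

Lemma cline_sum p w n (f : 'I_n -> V -> R[i]) (d : 'I_n -> R[i]) :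
  (forall i, cline (f i) p w (d i)) ->
  cline (fun q => \sum_(i < n) f i q) p w (\sum_(i < n) d i).
Proof.
elim: n f d => [|m IH] f d h.
  rewrite !big_ord0; apply: cline_near (cline_cst 0 _ _) _.
  by near=> q; rewrite big_ord0.
rewrite !big_ord_recl.
apply: cline_near (cline_add (h ord0) (IH _ _ (fun i => h (lift ord0 i)))) _.
by near=> q; rewrite big_ord_recl.
Unshelve. all: by end_near. Qed.

Lemma cline_conj f p w d : cline f p w d -> cline (fun q => (f q)^*) p w d^*.
Proof.
move=> [fr fi]; split.
  have -> : (fun q => complex.Re (f q)^*) = (fun q => complex.Re (f q)).
    by apply/funext => q; case: (f q).
  by case: d fr fi.
have -> : real_line (fun q => complex.Im (f q)^*) p w =
    - real_line (fun q => complex.Im (f q)) p w.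
  by apply/funext => h; exact: cImJ.
rewrite cImJ.
exact: is_deriveN fi.
Qed.

(** Both Wirtinger derivatives at once, along the complex direction [e]:
    [d1] is the holomorphic one and [d2] the antiholomorphic one. *)
Definition wirt e f p d1 d2 :=
  cline f p e (d1 + d2) /\ cline f p ('i *: e) ('i * (d1 - d2)).

Lemma mulii : 'i * 'i = -1 :> R[i].
Proof. by rewrite -expr2 sqr_i. Qed.

Lemma wirt_val e f p d1 d2 : wirt e f p d1 d2 -> wirtinger e f p = d1.
Proof.
move=> [/cline_val h1 /cline_val h2]; rewrite /wirtinger h1 h2 mulrA mulii.
by field.
Qed.

Lemma wirt_bar_val e f p d1 d2 : wirt e f p d1 d2 -> wirtinger_bar e f p = d2.
Proof.
move=> [/cline_val h1 /cline_val h2]; rewrite /wirtinger_bar h1 h2 mulrA mulii.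
by field.
Qed.

Lemma wirtP e f p : cline f p e (Cdir_derive f p e) ->
  cline f p ('i *: e) (Cdir_derive f p ('i *: e)) ->
  wirt e f p (wirtinger e f p) (wirtinger_bar e f p).
Proof.
move=> h1 h2; have two0 : 2 != 0 :> R[i] by rewrite pnatr_eq0.
split; [apply: cline_eq h1 _|apply: cline_eq h2 _];
  rewrite /wirtinger /wirtinger_bar.
- by field.
- transitivity (- ('i * 'i) * Cdir_derive f p ('i *: e)); first by rewrite mulii opprK mul1r.
  by field.
Qed.

Lemma wirt_eq e f p d1 d2 d1' d2' : wirt e f p d1 d2 -> d1 = d1' -> d2 = d2' ->
  wirt e f p d1' d2'.
Proof. by move=> ? <- <-. Qed.

Lemma wirt_near e f g p d1 d2 : wirt e f p d1 d2 ->
  (\forall q \near p, f q = g q) -> wirt e g p d1 d2.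
Proof. by move=> [h1 h2] fg; split; [exact: cline_near h1 fg|exact: cline_near h2 fg]. Qed.

Lemma wirt_add e f g p d1 d2 d1' d2' : wirt e f p d1 d2 -> wirt e g p d1' d2' ->
  wirt e (fun q => f q + g q) p (d1 + d1') (d2 + d2').
Proof.
move=> [f1 f2] [g1 g2]; split.
  by apply: cline_eq (cline_add f1 g1) _; ring.
by apply: cline_eq (cline_add f2 g2) _; ring.
Qed.

Lemma wirt_mul e f g p d1 d2 d1' d2' : wirt e f p d1 d2 -> wirt e g p d1' d2' ->
  wirt e (fun q => f q * g q) p (f p * d1' + g p * d1) (f p * d2' + g p * d2).
Proof.
move=> [f1 f2] [g1 g2]; split.
  by apply: cline_eq (cline_mul f1 g1) _; ring.
by apply: cline_eq (cline_mul f2 g2) _; ring.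
Qed.

Lemma wirt_conj e f p d1 d2 : wirt e f p d1 d2 ->
  wirt e (fun q => (f q)^*) p d2^* d1^*.
Proof.
move=> [f1 f2]; split.
  by apply: cline_eq (cline_conj f1) _; rewrite rmorphD addrC.
apply: cline_eq (cline_conj f2) _; case: d1 d2 {f1 f2} => [a b] [c d].
by apply/eqP; rewrite eq_complex /=; apply/andP; split; apply/eqP; ring.
Qed.

Lemma wirt_real e (u : V -> R) p d :
  is_derive (0 : R) 1 (real_line u p e) (2 * complex.Re d) ->
  is_derive (0 : R) 1 (real_line u p ('i *: e)) (- 2 * complex.Im d) ->
  wirt e (fun q => (u q)%:C) p d d^*.
Proof.
move=> h1 h2; split; [apply: cline_eq (cline_real h1) _|apply: cline_eq (cline_real h2) _];
  case: d {h1 h2} => a b; apply/eqP; rewrite eq_complex /=; apply/andP; split; apply/eqP; ring.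
Qed.

Lemma wirt_sum e n (f : 'I_n -> V -> R[i]) p (d1 d2 : 'I_n -> R[i]) :
  (forall i, wirt e (f i) p (d1 i) (d2 i)) ->
  wirt e (fun q => \sum_(i < n) f i q) p (\sum_(i < n) d1 i) (\sum_(i < n) d2 i).
Proof.
move=> h; split.
  by apply: cline_eq (cline_sum (fun i => (h i).1)) _; rewrite big_split.
apply: cline_eq (cline_sum (fun i => (h i).2)) _.
by rewrite -sumrB mulr_sumr.
Qed.

Lemma Csmooth_cline U f p w : U p -> Csmooth_on U f ->
  cline f p w (Cdir_derive f p w).
Proof.
move=> Up [fr fi]; split; apply: derivable_dir.
  by have [] := fr [::] p Up.
by have [] := fi [::] p Up.
Qed.

Lemma Csmooth_wirt U f p e : U p -> Csmooth_on U f ->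
  wirt e f p (wirtinger e f p) (wirtinger_bar e f p).
Proof. by move=> Up sf; apply: wirtP; exact: Csmooth_cline sf. Qed.

Lemma Csmooth_wirtinger U f e : open U -> Csmooth_on U f ->
  Csmooth_on U (wirtinger e f) /\ Csmooth_on U (wirtinger_bar e f).
Proof.
move=> oU [fr fi].
have D w := smooth_alg_gen (smooth_on_dir w fr).
have E w := smooth_alg_gen (smooth_on_dir w fi).
have half (a b : V -> R) c : smooth_alg U a -> smooth_alg U b ->
    smooth_on U (fun p => (a p + c * b p) * 2^-1).
  move=> sa sb; apply: smooth_alg_smooth => //.
  apply: smooth_alg_mul; last exact: smooth_alg_cst.
  by apply: smooth_alg_add => //; apply: smooth_alg_mul => //; exact: smooth_alg_cst.
have two2 : (2 : R[i])^-1 = (2^-1)%:C by rewrite fmorphV /= rmorph_nat.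
split; split.
- apply: smooth_on_eq (half _ _ 1 (D e) (E ('i *: e))) _ => // p Up.
  by rewrite /wirtinger /Cdir_derive two2 /=; ring.
- apply: smooth_on_eq (half _ _ (-1) (E e) (D ('i *: e))) _ => // p Up.
  by rewrite /wirtinger /Cdir_derive two2 /=; ring.
- apply: smooth_on_eq (half _ _ (-1) (D e) (E ('i *: e))) _ => // p Up.
  by rewrite /wirtinger_bar /Cdir_derive two2 /=; ring.
- apply: smooth_on_eq (half _ _ 1 (E e) (D ('i *: e))) _ => // p Up.
  by rewrite /wirtinger_bar /Cdir_derive two2 /=; ring.
Qed.

End Wirtinger.

(** * Coordinates of the tangent bundle *)

Section Coordinates.
Variables (R : realType) (n : nat).
Implicit Types (p w : T10 R n) (i j : 'I_n).

Lemma cline_coord_v p w i : cline (fun q : T10 R n => q.2 i 0) p w (w.2 i 0).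
Proof.
split.
  have -> : real_line (fun q : T10 R n => complex.Re (q.2 i 0)) p w =
      cst (complex.Re (p.2 i 0)) + complex.Re (w.2 i 0) \*: id.
    apply/funext => h; rewrite /real_line /= !mxE cReD cReM /=.
    by rewrite mul0r subr0 mulrC.
  by apply: is_derive_eq; rewrite add0r; exact: mulr1.
have -> : real_line (fun q : T10 R n => complex.Im (q.2 i 0)) p w =
    cst (complex.Im (p.2 i 0)) + complex.Im (w.2 i 0) \*: id.
  apply/funext => h; rewrite /real_line /= !mxE cImD cImM /=.
  by rewrite mul0r addr0 mulrC.
by apply: is_derive_eq; rewrite add0r; exact: mulr1.
Qed.

Lemma cline_coord_z p w i : cline (fun q : T10 R n => q.1 i 0) p w (w.1 i 0).
Proof.
split.
  have -> : real_line (fun q : T10 R n => complex.Re (q.1 i 0)) p w =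
      cst (complex.Re (p.1 i 0)) + complex.Re (w.1 i 0) \*: id.
    apply/funext => h; rewrite /real_line /= !mxE cReD cReM /=.
    by rewrite mul0r subr0 mulrC.
  by apply: is_derive_eq; rewrite add0r; exact: mulr1.
have -> : real_line (fun q : T10 R n => complex.Im (q.1 i 0)) p w =
    cst (complex.Im (p.1 i 0)) + complex.Im (w.1 i 0) \*: id.
  apply/funext => h; rewrite /real_line /= !mxE cImD cImM /=.
  by rewrite mul0r addr0 mulrC.
by apply: is_derive_eq; rewrite add0r; exact: mulr1.
Qed.

Lemma wirt_v_v p i j : wirt (dir_v R i) (fun q : T10 R n => q.2 j 0) p (i == j)%:R 0.
Proof.
split; apply: cline_eq (cline_coord_v _ _ _) _; rewrite /= ?mxE eqxx andbT eq_sym.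
  by rewrite addr0.
by rewrite subr0.
Qed.

Lemma wirt_z_z p i j : wirt (dir_z R i) (fun q : T10 R n => q.1 j 0) p (i == j)%:R 0.
Proof.
split; apply: cline_eq (cline_coord_z _ _ _) _; rewrite /= ?mxE eqxx andbT eq_sym.
  by rewrite addr0.
by rewrite subr0.
Qed.

Lemma wirt_z_v p i j : wirt (dir_z R i) (fun q : T10 R n => q.2 j 0) p 0 0.
Proof.
by split; apply: cline_eq (cline_coord_v _ _ _) _; rewrite /= ?mxE ?subrr ?addr0 ?mulr0.
Qed.

Lemma wirt_v_z p i j : wirt (dir_v R i) (fun q : T10 R n => q.1 j 0) p 0 0.
Proof.
by split; apply: cline_eq (cline_coord_z _ _ _) _; rewrite /= ?mxE ?subrr ?addr0 ?mulr0.
Qed.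

Lemma wirt_v_vbar p i j :
  wirt (dir_v R i) (fun q : T10 R n => (q.2 j 0)^*) p 0 (i == j)%:R.
Proof.
by apply: wirt_eq (wirt_conj (wirt_v_v p i j)) _ _; rewrite ?conjc0 ?conjc_nat.
Qed.

Lemma wirt_z_vbar p i j : wirt (dir_z R i) (fun q : T10 R n => (q.2 j 0)^*) p 0 0.
Proof. by apply: wirt_eq (wirt_conj (wirt_z_v p i j)) _ _; rewrite conjc0. Qed.

Lemma wirt_v_zbar p i j : wirt (dir_v R i) (fun q : T10 R n => (q.1 j 0)^*) p 0 0.
Proof. by apply: wirt_eq (wirt_conj (wirt_v_z p i j)) _ _; rewrite conjc0. Qed.

Lemma wirt_z_zbar p i j :
  wirt (dir_z R i) (fun q : T10 R n => (q.1 j 0)^*) p 0 (i == j)%:R.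
Proof.
by apply: wirt_eq (wirt_conj (wirt_z_z p i j)) _ _; rewrite ?conjc0 ?conjc_nat.
Qed.

End Coordinates.

(** * The weak Kaehler condition in terms of the spray *)

Lemma sum_kronecker (K : nzRingType) n (g : 'I_n -> K) a :
  \sum_(c < n) g c * (a == c)%:R = g a.
Proof.
rewrite (bigD1 a)//= eqxx mulr1 big1 ?addr0// => c /negPf ca.
by rewrite eq_sym ca mulr0.
Qed.

Lemma sum_contract (K : comNzRingType) n (g : 'I_n -> K) (A : 'I_n -> 'I_n -> K)
    (w : 'cV[K]_n) :
  \sum_a \sum_c g a * A a c * w c 0 = \sum_c w c 0 * \sum_a g a * A a c.
Proof.
rewrite exchange_big; apply: eq_bigr => c _; rewrite mulr_sumr.
by apply: eq_bigr => a _; rewrite mulrC.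
Qed.

Lemma sum_contract_sub (K : comNzRingType) n (w : 'cV[K]_n) (x : 'I_n -> K)
    (N y : 'I_n -> 'I_n -> K) :
  \sum_c w c 0 * (x c - \sum_s N s c * y c s) =
  \sum_c w c 0 * x c - \sum_s \sum_c w c 0 * (N s c * y c s).
Proof.
rewrite exchange_big -sumrB; apply: eq_bigr => c _.
by rewrite mulrBr mulr_sumr.
Qed.

Section ChernFinslerReduction.
Variables (R : realType) (n : nat) (F : T10 R n -> R).
Variables (z v : 'cV[R[i]]_n).
Let p : T10 R n := (z, v).
Hypothesis smoothF : smooth_at (fun q => F q ^+ 2) p.
Hypothesis euler_v : \forall q \near p, \sum_(a < n) G_v F a q * q.2 a 0 = Gfun F q.
Hypothesis euler_vbar :
  \forall q \near p, \sum_(a < n) G_vbar F a q * (q.2 a 0)^*%C = Gfun F q.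
Hypothesis levi_unit : levi_mx F p \in unitmx.

Lemma Gfun_smooth : exists2 U, open_nbhs p U & Csmooth_on U (Gfun F).
Proof.
case: smoothF => U oU sU; exists U => //; split; first exact: sU.
apply: smooth_alg_smooth; first by case: oU.
exact: smooth_alg_cst.
Qed.

(** Euler's relation for G, differentiated in v. *)
Lemma levi_vbar a :
  \forall q \near p, \sum_(b < n) G_vvbar F a b q * (q.2 b 0)^*%C = G_v F a q.
Proof.
have [U [oU Up] sU] := Gfun_smooth.
have sb b := (Csmooth_wirtinger (dir_v R b) oU sU).2.
have eU : \forall q \near p, \forall q' \near q,
    \sum_(a < n) G_vbar F a q' * (q'.2 a 0)^*%C = Gfun F q'.
  exact/(near_join euler_vbar).
near=> q.
have Uq : U q by near: q; apply: open_nbhs_nbhs.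
have eq : \forall q' \near q,
    \sum_(a < n) G_vbar F a q' * (q'.2 a 0)^*%C = Gfun F q' by near: q.
have W b : wirt (dir_v R a) (fun q => G_vbar F b q * (q.2 b 0)^*%C) q _ _ :=
  wirt_mul (Csmooth_wirt (dir_v R a) Uq (sb b)) (wirt_v_vbar q a b).
have := wirt_val (wirt_near (wirt_sum W) eq).
rewrite -/(G_v F a) => ->; apply: eq_bigr => b _.
by rewrite mulr0 add0r mulrC.
Unshelve. all: by end_near. Qed.

(** The operators delta_z do not act on conj v, so they can be taken through the
    contraction of the Levi matrix with conj v, which is G_b by homogeneity. *)
Lemma delta_levi b c : \sum_(e < n) (v e 0)^*%C * delta_z F c (G_vvbar F b e) p =
  delta_z F c (G_v F b) p.
Proof.
have [U [oU Up] sU] := Gfun_smooth.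
have sb e := (Csmooth_wirtinger (dir_v R b) oU
  (Csmooth_wirtinger (dir_v R e) oU sU).2).1.
have Wz e : wirt (dir_z R c) (fun q => G_vvbar F b e q * (q.2 e 0)^*%C) p _ _ :=
  wirt_mul (Csmooth_wirt (dir_z R c) Up (sb e)) (wirt_z_vbar p c e).
have Wv a e : wirt (dir_v R a) (fun q => G_vvbar F b e q * (q.2 e 0)^*%C) p _ _ :=
  wirt_mul (Csmooth_wirt (dir_v R a) Up (sb e)) (wirt_v_vbar p a e).
rewrite /delta_z (wirt_val (wirt_near (wirt_sum Wz) (levi_vbar b))).
under [X in _ = _ - X]eq_bigr do
  rewrite (wirt_val (wirt_near (wirt_sum (Wv _)) (levi_vbar b))).
under [LHS]eq_bigr do rewrite mulrBr mulr_sumr.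
rewrite sumrB exchange_big; congr (_ - _).
  by apply: eq_bigr => e _; rewrite mulr0 add0r.
apply: eq_bigr => a _; rewrite mulr_sumr; apply: eq_bigr => e _.
by rewrite mulr0 add0r mulrCA.
Qed.

(** G_a is the Levi matrix applied to conj v, so the inverse matrix in Gamma
    cancels. *)
Lemma G_Gamma b c : \sum_(a < n) G_v F a p * Gamma F a b c p =
  delta_z F c (G_v F b) p.
Proof.
rewrite -delta_levi /Gamma.
under eq_bigr do rewrite mulr_sumr.
rewrite exchange_big; apply: eq_bigr => e _ /=.
under eq_bigr do rewrite mulrA.
rewrite -mulr_suml; congr (_ * _).
have : levi_mx F p *m (\col_e (v e 0)^*%C) = \col_a G_v F a p.
  apply/colP => a; rewrite !mxE -(nbhs_singleton (levi_vbar a)).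
  by apply: eq_bigr => b' _; rewrite !mxE.
move/(congr1 (mulmx (invmx (levi_mx F p)))); rewrite mulKmx//.
move/colP/(_ e); rewrite !mxE => ->; apply: eq_bigr => a _.
by rewrite mxE mulrC.
Qed.

(** The complex spray of F. *)
Definition spray (s : 'I_n) : R[i] := \sum_(c < n) v c 0 * Ncoef F s c p.

(** The spray is characterized by a linear system, in which no inverse occurs. *)
Lemma spray_levi e : \sum_(s < n) spray s * levi_mx F p s e =
  \sum_(c < n) v c 0 * G_vbar_z F e c p.
Proof.
have -> : \sum_(s < n) spray s * levi_mx F p s e =
  ((\row_e (\sum_(c < n) v c 0 * G_vbar_z F e c p)) *m invmx (levi_mx F p) *m
     levi_mx F p) 0 e.
  rewrite [in RHS]mxE; apply: eq_bigr => s _; congr (_ * _).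
  rewrite mxE /spray /Ncoef; under eq_bigr do rewrite mulr_sumr.
  rewrite exchange_big; apply: eq_bigr => d _ /=; rewrite mxE mulr_suml.
  by apply: eq_bigr => c _; rewrite /G_inv [_ * G_vbar_z _ _ _ _]mulrC mulrA.
by rewrite mulmxKV// mxE.
Qed.

(** On the right-hand side the vertical part of delta_z drops out by
    homogeneity; on the left-hand side it becomes differentiation along the
    spray. *)
Lemma weakly_kahler_spray b :
  \sum_(a < n) \sum_(c < n) G_v F a p * Gamma F a b c p * v c 0 =
  \sum_(a < n) \sum_(c < n) G_v F a p * Gamma F a c b p * v c 0 <->
  \sum_(c < n) v c 0 * wirtinger (dir_z R c) (G_v F b) p -
  \sum_(s < n) spray s * wirtinger (dir_v R s) (G_v F b) p =
  wirtinger (dir_z R b) (Gfun F) p.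
Proof.
have [U [oU Up] sU] := Gfun_smooth.
have sG c := (Csmooth_wirtinger (dir_v R c) oU sU).1.
have Wz c : wirt (dir_z R b) (fun q => G_v F c q * q.2 c 0) p _ _ :=
  wirt_mul (Csmooth_wirt (dir_z R b) Up (sG c)) (wirt_z_v p b c).
have Wv a c : wirt (dir_v R a) (fun q => G_v F c q * q.2 c 0) p _ _ :=
  wirt_mul (Csmooth_wirt (dir_v R a) Up (sG c)) (wirt_v_v p a c).
have vert a : \sum_(c < n) v c 0 * wirtinger (dir_v R a) (G_v F c) p = 0.
  have H := wirt_val (wirt_near (wirt_sum (Wv a)) euler_v).
  have diag := sum_kronecker (fun c => G_v F c p) a.
  apply: (addrI (G_v F a p)); rewrite addr0 -[X in X + _]diag -big_split.
  exact: esym H.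
have base : \sum_(c < n) v c 0 * wirtinger (dir_z R b) (G_v F c) p =
    wirtinger (dir_z R b) (Gfun F) p.
  rewrite (wirt_val (wirt_near (wirt_sum Wz) euler_v)).
  by apply: eq_bigr => c _; rewrite mulr0 add0r.
have E1 : \sum_(a < n) \sum_(c < n) G_v F a p * Gamma F a b c p * v c 0 =
    \sum_(c < n) v c 0 * delta_z F c (G_v F b) p.
  transitivity (\sum_(c < n) v c 0 * \sum_(a < n) G_v F a p * Gamma F a b c p).
    exact: (sum_contract (fun a => G_v F a p) (fun a c => Gamma F a b c p) v).
  by apply: eq_bigr => c _; rewrite G_Gamma.
have E2 : \sum_(a < n) \sum_(c < n) G_v F a p * Gamma F a c b p * v c 0 =
    \sum_(c < n) v c 0 * delta_z F b (G_v F c) p.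
  transitivity (\sum_(c < n) v c 0 * \sum_(a < n) G_v F a p * Gamma F a c b p).
    exact: (sum_contract (fun a => G_v F a p) (fun a c => Gamma F a c b p) v).
  by apply: eq_bigr => c _; rewrite G_Gamma.
have E3 : \sum_(c < n) v c 0 * delta_z F c (G_v F b) p =
    \sum_(c < n) v c 0 * wirtinger (dir_z R c) (G_v F b) p -
    \sum_s \sum_c v c 0 * (Ncoef F s c p * wirtinger (dir_v R s) (G_v F b) p).
  exact: (sum_contract_sub v (fun c => wirtinger (dir_z R c) (G_v F b) p)
    (fun s c => Ncoef F s c p) (fun c s => wirtinger (dir_v R s) (G_v F b) p)).
have E4 : \sum_(c < n) v c 0 * delta_z F b (G_v F c) p =
    \sum_(c < n) v c 0 * wirtinger (dir_z R b) (G_v F c) p -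
    \sum_s \sum_c v c 0 * (Ncoef F s b p * wirtinger (dir_v R s) (G_v F c) p).
  exact: (sum_contract_sub v (fun c => wirtinger (dir_z R b) (G_v F c) p)
    (fun s c => Ncoef F s b p) (fun c s => wirtinger (dir_v R s) (G_v F c) p)).
have E5 : \sum_s \sum_c v c 0 * (Ncoef F s b p * wirtinger (dir_v R s) (G_v F c) p) = 0.
  apply: big1 => s _; under eq_bigr do rewrite mulrCA.
  by rewrite -mulr_sumr vert mulr0.
have E6 : \sum_s \sum_c v c 0 * (Ncoef F s c p * wirtinger (dir_v R s) (G_v F b) p) =
    \sum_(s < n) spray s * wirtinger (dir_v R s) (G_v F b) p.
  by apply: eq_bigr => s _; rewrite /spray mulr_suml; apply: eq_bigr => c _; rewrite mulrA.
have X1 := etrans (etrans E1 E3) (congr1 (fun x => _ - x) E6).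
have X2 := etrans (etrans (etrans E2 E4) (congr2 (fun x y => x - y) base E5))
  (subr0 _).
split=> H; first exact: (etrans (esym X1) (etrans H X2)).
exact: (etrans X1 (etrans H (esym X2))).
Qed.

End ChernFinslerReduction.

(** * Functions of t, r and q *)

Section RealToComplex.
Variable R : realType.
Implicit Types x y : R.

Lemma rcD x y : (x + y)%:C = x%:C + y%:C :> R[i].
Proof. exact: rmorphD. Qed.

Lemma rcB x y : (x - y)%:C = x%:C - y%:C :> R[i].
Proof. exact: rmorphB. Qed.

Lemma rcM x y : (x * y)%:C = x%:C * y%:C :> R[i].
Proof. exact: rmorphM. Qed.

Lemma rcV x : (x^-1)%:C = (x%:C)^-1 :> R[i].
Proof. exact: fmorphV. Qed.

End RealToComplex.

Section SpaceFunctions.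
Variables (R : realType) (n : nat).
Implicit Types (p w : T10 R n) (x y : 'cV[R[i]]_n).

Lemma cJD (a b : R[i]) : (a + b)^*%C = a^*%C + b^*%C.
Proof. exact: rmorphD. Qed.

Lemma cJM (a b : R[i]) : (a * b)^*%C = a^*%C * b^*%C.
Proof. exact: rmorphM. Qed.

Lemma hdotE x y : hdot x y = \sum_(a < n) x a 0 * (y a 0)^*%C.
Proof. by []. Qed.

Lemma hdotC x y : hdot y x = (hdot x y)^*.
Proof.
rewrite !hdotE rmorph_sum; apply: eq_bigr => a _ /=.
by rewrite cJM conjcK mulrC.
Qed.

Lemma hdotDl x x' y : hdot (x + x') y = hdot x y + hdot x' y.
Proof. by rewrite !hdotE -big_split; apply: eq_bigr => a _; rewrite !mxE mulrDl. Qed.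

Lemma hdotZl c x y : hdot (c *: x) y = c * hdot x y.
Proof. by rewrite !hdotE mulr_sumr; apply: eq_bigr => a _; rewrite !mxE mulrA. Qed.

Lemma hdotDr x y y' : hdot x (y + y') = hdot x y + hdot x y'.
Proof. by rewrite hdotC hdotDl cJD -!hdotC. Qed.

Lemma hdotZr c x y : hdot x (c *: y) = c^*%C * hdot x y.
Proof. by rewrite hdotC hdotZl cJM -hdotC. Qed.

Lemma hdot0l x : hdot 0 x = 0.
Proof. by rewrite -(scale0r x) hdotZl mul0r. Qed.

Lemma hdot0r x : hdot x 0 = 0.
Proof. by rewrite hdotC hdot0l conjc0. Qed.

Lemma hdot_delta a x : hdot (delta_mx a 0) x = (x a 0)^*.
Proof.
rewrite hdotE (bigD1 a)//= big1 ?addr0 => [|b /negPf ba].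
  by rewrite mxE !eqxx mul1r.
by rewrite mxE ba mul0r.
Qed.

Lemma hdot_sqnorm x : hdot x x = (sqnorm x)%:C.
Proof.
rewrite /sqnorm; case E : (hdot x x) => [a b] /=; congr (_ +i* _).
have /(congr1 (@complex.Im _)) := hdotC x x; rewrite cImJ E /= => H.
lra.
Qed.

Lemma sqnorm_ge0 x : 0 <= sqnorm x.
Proof.
have : 0 <= hdot x x by rewrite hdotE; apply: sumr_ge0 => a _; exact: mulcJ_ge0.
by rewrite hdot_sqnorm ler0c.
Qed.

Lemma sqnorm_eq0 x : (sqnorm x == 0) = (x == 0).
Proof.
apply/idP/idP => [/eqP x0|/eqP ->]; last first.
  by rewrite /sqnorm hdot0l.
have /eqP : hdot x x = 0 by rewrite hdot_sqnorm x0.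
rewrite hdotE psumr_eq0 => [/allP H|a _]; last exact: mulcJ_ge0.
apply/eqP/colP => a; rewrite mxE; apply/eqP.
have := H a (mem_index_enum a); rewrite /= mulf_eq0 => /orP[]// /eqP.
by move=> /(congr1 (@conjc R)); rewrite conjcK conjc0 => ->.
Qed.

Lemma sqnorm_gt0 x : (0 < sqnorm x) = (x != 0).
Proof. by rewrite lt_def sqnorm_ge0 andbT sqnorm_eq0. Qed.

Lemma sqnorm0 : sqnorm (0 : 'cV[R[i]]_n) = 0.
Proof. by apply/eqP; rewrite sqnorm_eq0. Qed.

Lemma mulJ_normc (c : R[i]) : c * c^*%C = (Normc.normc c ^+ 2)%:C.
Proof.
case: c => a b; rewrite /= sqr_sqrtr ?addr_ge0 ?sqr_ge0//.
by apply/eqP; rewrite eq_complex /=; apply/andP; split; apply/eqP; ring.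
Qed.

Lemma normcJ (c : R[i]) : Normc.normc c^*%C = Normc.normc c.
Proof. by case: c => a b /=; rewrite sqrrN. Qed.

Lemma sqnormZ c x : sqnorm (c *: x) = Normc.normc c ^+ 2 * sqnorm x.
Proof.
by apply: complexI; rewrite rmorphM /= -!hdot_sqnorm hdotZl hdotZr mulrA mulJ_normc.
Qed.

Definition qfun p : R := Normc.normc (hdot p.1 p.2) ^+ 2.

Lemma qfunE p : (qfun p)%:C = hdot p.2 p.1 * (hdot p.2 p.1)^*%C.
Proof. by rewrite mulJ_normc hdotC /qfun normcJ. Qed.

Lemma qfun_ge0 p : 0 <= qfun p.
Proof. exact: sqr_ge0. Qed.

(** The vector on the left is the component of x orthogonal to y. *)
Lemma sqnorm_reject x y : y != 0 ->
  sqnorm (x - ((hdot y x)^*%C / (sqnorm y)%:C) *: y) = sqnorm x - qfun (x, y) / sqnorm y.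
Proof.
move=> y0; have r0 : (sqnorm y)%:C != 0 :> R[i].
  by rewrite (inj_eq (@complexI R)) sqnorm_eq0.
apply: complexI; rewrite -(hdot_sqnorm (x - _)).
have -> : (sqnorm x - qfun (x, y) / sqnorm y)%:C =
    (sqnorm x)%:C - (qfun (x, y))%:C / (sqnorm y)%:C :> R[i].
  by rewrite -rcV -rcM -rcB.
rewrite qfunE -(hdot_sqnorm x) -[- (_ *: y)]scaleNr !(hdotDl, hdotDr, hdotZl, hdotZr).
have -> : (- ((hdot y x)^*%C / (sqnorm y)%:C))^*%C = - (hdot y x / (sqnorm y)%:C).
  by rewrite -[LHS]/(conjc _) rmorphN /= cJM conjcK -rcV conjc_real.
by rewrite [hdot x y]hdotC !hdot_sqnorm; field.
Qed.

Lemma qfun_le p : qfun p <= sqnorm p.1 * sqnorm p.2.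
Proof.
have [v0|v0] := eqVneq p.2 0.
  have -> : qfun p = 0 by apply: complexI; rewrite qfunE v0 hdot0l mul0r.
  by rewrite v0 sqnorm0 mulr0.
have := sqnorm_ge0 (p.1 - ((hdot p.2 p.1)^*%C / (sqnorm p.2)%:C) *: p.2).
by rewrite sqnorm_reject// subr_ge0 ler_pdivrMr ?sqnorm_gt0//; case: (p).
Qed.

Lemma svar0 x : svar 0 x = 0.
Proof. by rewrite /svar hdot0l /= expr0n addr0 sqrtr0 expr0n mul0r. Qed.

Definition dt p w : R := 2 * complex.Re (hdot w.1 p.1).
Definition dr p w : R := 2 * complex.Re (hdot w.2 p.2).
Definition dq p w : R :=
  2 * complex.Re ((hdot p.2 p.1)^*%C * (hdot w.2 p.1 + hdot p.2 w.1)).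

(** The differential of [u] at [p] is ut dt + ur dr + uq dq, where t = |z|^2,
    r = |v|^2 and q = |<z, v>|^2. *)
Definition trq (u : T10 R n -> R) p ut ur uq : Prop :=
  forall w, is_derive (0 : R) 1 (real_line u p w)
    (ut * dt p w + ur * dr p w + uq * dq p w).

Lemma cline_hdot (f g : T10 R n -> 'cV[R[i]]_n) p w x y :
  (forall i, cline (fun q => f q i 0) p w (x i 0)) ->
  (forall i, cline (fun q => g q i 0) p w (y i 0)) ->
  cline (fun q => hdot (f q) (g q)) p w (hdot (f p) y + hdot x (g p)).
Proof.
move=> hf hg; apply: cline_eq (cline_sum (fun i => cline_mul (hf i) (cline_conj (hg i)))) _.
rewrite big_split !hdotE; congr (_ + _); apply: eq_bigr => a _.
by rewrite mulrC.
Qed.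

Lemma cReJ (c : R[i]) : complex.Re c^*%C = complex.Re c.
Proof. by case: c. Qed.

Lemma trq_t p : trq (fun q => sqnorm q.1) p 1 0 0.
Proof.
move=> w.
have [+ _] := cline_hdot (cline_coord_z p w) (cline_coord_z p w).
by congr is_derive; rewrite !mul0r mul1r !addr0 cReD hdotC cReJ /dt mulr_natl.
Qed.

Lemma trq_r p : trq (fun q => sqnorm q.2) p 0 1 0.
Proof.
move=> w.
have [+ _] := cline_hdot (cline_coord_v p w) (cline_coord_v p w).
by congr is_derive; rewrite !mul0r mul1r addr0 add0r cReD hdotC cReJ /dr mulr_natl.
Qed.

Lemma trq_q p : trq qfun p 0 0 1.
Proof.
move=> w.
have cw := cline_hdot (cline_coord_v p w) (cline_coord_z p w).
have [+ _] := cline_mul cw (cline_conj cw).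
have -> : (fun q : T10 R n => complex.Re (hdot q.2 q.1 * (hdot q.2 q.1)^*)) = qfun.
  by apply/funext => q; rewrite -qfunE.
congr is_derive; rewrite !mul0r mul1r !add0r cReD /dq mulr_natl mulr2n.
congr (_ + _); last by rewrite [hdot p.2 w.1 + _]addrC.
by rewrite -cReJ cJM conjcK [hdot p.2 w.1 + _]addrC.
Qed.

Lemma trq_cst c p : trq (fun=> c) p 0 0 0.
Proof. by move=> w; rewrite !mul0r !addr0; exact: is_derive_cst. Qed.

Lemma trq_eq u p ut ur uq ut' ur' uq' : trq u p ut ur uq ->
  ut = ut' -> ur = ur' -> uq = uq' -> trq u p ut' ur' uq'.
Proof. by move=> ? <- <- <-. Qed.

Lemma trq_near u u' p ut ur uq : trq u p ut ur uq ->
  (\forall q \near p, u q = u' q) -> trq u' p ut ur uq.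
Proof. by move=> h uu' w; exact: is_derive_line_near (h w) uu'. Qed.

Lemma trq_add u u' p ut ur uq ut' ur' uq' :
  trq u p ut ur uq -> trq u' p ut' ur' uq' ->
  trq (fun q => u q + u' q) p (ut + ut') (ur + ur') (uq + uq').
Proof.
move=> h h' w; have H := is_deriveD (h w) (h' w).
rewrite (_ : _ + _ + _ = (ut * dt p w + ur * dr p w + uq * dq p w) +
  (ut' * dt p w + ur' * dr p w + uq' * dq p w)); first exact: H.
by ring.
Qed.

Lemma trq_mul u u' p ut ur uq ut' ur' uq' :
  trq u p ut ur uq -> trq u' p ut' ur' uq' ->
  trq (fun q => u q * u' q) p (u p * ut' + u' p * ut) (u p * ur' + u' p * ur)
    (u p * uq' + u' p * uq).
Proof.
move=> h h' w; have := is_deriveM (h w) (h' w); rewrite !real_line0.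
by congr is_derive; rewrite /GRing.scale /=; ring.
Qed.

Lemma trq_wirt_v u p ut ur uq a : trq u p ut ur uq ->
  wirt (dir_v R a) (fun q => (u q)%:C) p
    (ur%:C * (p.2 a 0)^*%C + uq%:C * ((hdot p.2 p.1)^*%C * (p.1 a 0)^*%C))
    (ur%:C * p.2 a 0 + uq%:C * (hdot p.2 p.1 * p.1 a 0)).
Proof.
move=> h; have imul (c : R[i]) : complex.Re ('i * c) = - complex.Im c.
  by case: c => x y; rewrite cReM /=; ring.
apply: wirt_eq (wirt_real (d := ur%:C * (p.2 a 0)^*%C +
    uq%:C * ((hdot p.2 p.1)^*%C * (p.1 a 0)^*%C)) _ _) _ _ => //.
- have := h (dir_v R a); congr is_derive.
  rewrite /dt /dr /dq /= hdot0l hdot0r addr0 !hdot_delta.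
  by rewrite cReD ![complex.Re (_%:C * _)]cReM /=; ring.
- have := h ('i *: dir_v R a); congr is_derive.
  rewrite /dt /dr /dq /= scaler0 hdot0l hdot0r addr0 !hdotZl !hdot_delta.
  rewrite [_^*%C * ('i * _)]mulrCA !imul.
  by rewrite cImD ![complex.Im (_%:C * _)]cImM /=; ring.
- by rewrite !cJD !cJM !conjcK !conjc_real.
Qed.

Lemma trq_wirt_z u p ut ur uq a : trq u p ut ur uq ->
  wirt (dir_z R a) (fun q => (u q)%:C) p
    (ut%:C * (p.1 a 0)^*%C + uq%:C * (hdot p.2 p.1 * (p.2 a 0)^*%C))
    (ut%:C * p.1 a 0 + uq%:C * ((hdot p.2 p.1)^*%C * p.2 a 0)).
Proof.
move=> h; have imul (c : R[i]) : complex.Re ('i * c) = - complex.Im c.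
  by case: c => x y; rewrite cReM /=; ring.
have dqE w : dq p w = 2 * complex.Re ((hdot p.2 p.1)^*%C * hdot w.2 p.1 +
    hdot p.2 p.1 * hdot w.1 p.2).
  rewrite /dq mulrDr !cReD -[complex.Re (_ * hdot p.2 w.1)]cReJ cJM conjcK.
  by rewrite -(hdotC p.2 w.1).
apply: wirt_eq (wirt_real (d := ut%:C * (p.1 a 0)^*%C +
    uq%:C * (hdot p.2 p.1 * (p.2 a 0)^*%C)) _ _) _ _ => //.
- have := h (dir_z R a); congr is_derive.
  rewrite dqE /dt /dr /= !hdot0l ?(mulr0, add0r) !hdot_delta.
  by rewrite cReD ![complex.Re (_%:C * _)]cReM /=; ring.
- have := h ('i *: dir_z R a); congr is_derive.
  rewrite dqE /dt /dr /= scaler0 !hdot0l ?(mulr0, add0r) !hdotZl !hdot_delta.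
  rewrite [hdot _ _ * ('i * _)]mulrCA !imul.
  by rewrite cImD ![complex.Im (_%:C * _)]cImM /=; ring.
- by rewrite !cJD !cJM !conjcK !conjc_real.
Qed.

End SpaceFunctions.

(** * The weak Kaehler condition as a scalar equation *)

Section RotationInvariant.
Variables (R : realType) (n : nat).
Implicit Types (p : T10 R n) (a b : 'I_n).

Lemma wirt_w_v p a :
  wirt (dir_v R a) (fun q : T10 R n => hdot q.2 q.1) p (p.1 a 0)^*%C 0.
Proof.
apply: wirt_eq (wirt_sum (fun b => wirt_mul (wirt_v_v p a b) (wirt_v_zbar p a b))) _ _.
  rewrite -[RHS](sum_kronecker (fun b => (p.1 b 0)^*%C) a).
  by apply: eq_bigr => b _; rewrite mulr0 add0r.
by apply: big1 => b _; rewrite !mulr0 addr0.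
Qed.

Lemma wirt_w_z p a :
  wirt (dir_z R a) (fun q : T10 R n => hdot q.2 q.1) p 0 (p.2 a 0).
Proof.
apply: wirt_eq (wirt_sum (fun b => wirt_mul (wirt_z_v p a b) (wirt_z_zbar p a b))) _ _.
  by apply: big1 => b _; rewrite !mulr0 addr0.
rewrite -[RHS](sum_kronecker (fun b => p.2 b 0) a).
by apply: eq_bigr => b _; rewrite mulr0 addr0.
Qed.

Variables Kr Kq : T10 R n -> R.

(** The v-gradient of a function of t, r, q whose derivatives in r and q are
    [Kr] and [Kq]. *)
Definition vgrad a p : R[i] :=
  (Kr p)%:C * (p.2 a 0)^*%C + (Kq p)%:C * ((hdot p.2 p.1)^*%C * (p.1 a 0)^*%C).

Variables (p : T10 R n) (krt krr krq kqt kqr kqq : R).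
Hypotheses (dKr : trq Kr p krt krr krq) (dKq : trq Kq p kqt kqr kqq).
Local Notation W := (hdot p.2 p.1).

Lemma wirt_vgrad_v a b : wirt (dir_v R a) (vgrad b) p
  ((krr%:C * (p.2 a 0)^*%C + krq%:C * (W^*%C * (p.1 a 0)^*%C)) * (p.2 b 0)^*%C +
   (kqr%:C * (p.2 a 0)^*%C + kqq%:C * (W^*%C * (p.1 a 0)^*%C)) * (W^*%C * (p.1 b 0)^*%C))
  ((Kr p)%:C * (a == b)%:R +
   (krr%:C * p.2 a 0 + krq%:C * (W * p.1 a 0)) * (p.2 b 0)^*%C +
   (kqr%:C * p.2 a 0 + kqq%:C * (W * p.1 a 0)) * (W^*%C * (p.1 b 0)^*%C) +
   (Kq p)%:C * (p.1 a 0 * (p.1 b 0)^*%C)).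
Proof.
apply: wirt_eq (wirt_add (wirt_mul (trq_wirt_v a dKr) (wirt_v_vbar p a b))
 (wirt_mul (trq_wirt_v a dKq)
   (wirt_mul (wirt_conj (wirt_w_v p a)) (wirt_v_zbar p a b)))) _ _.
  by rewrite ?(conjc0, conjcK); ring.
by rewrite ?(conjc0, conjcK); ring.
Qed.

Lemma wirt_vgrad_z a b : wirt (dir_z R a) (vgrad b) p
  ((krt%:C * (p.1 a 0)^*%C + krq%:C * (W * (p.2 a 0)^*%C)) * (p.2 b 0)^*%C +
   (kqt%:C * (p.1 a 0)^*%C + kqq%:C * (W * (p.2 a 0)^*%C)) * (W^*%C * (p.1 b 0)^*%C) +
   (Kq p)%:C * ((p.2 a 0)^*%C * (p.1 b 0)^*%C))
  ((krt%:C * p.1 a 0 + krq%:C * (W^*%C * p.2 a 0)) * (p.2 b 0)^*%C +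
   (kqt%:C * p.1 a 0 + kqq%:C * (W^*%C * p.2 a 0)) * (W^*%C * (p.1 b 0)^*%C) +
   (Kq p)%:C * (W^*%C * (a == b)%:R)).
Proof.
apply: wirt_eq (wirt_add (wirt_mul (trq_wirt_z a dKr) (wirt_z_vbar p a b))
 (wirt_mul (trq_wirt_z a dKq)
   (wirt_mul (wirt_conj (wirt_w_z p a)) (wirt_z_zbar p a b)))) _ _.
  by rewrite ?(conjc0, conjcK); ring.
by rewrite ?(conjc0, conjcK); ring.
Qed.

End RotationInvariant.

(** Elimination in the 2x2 system obtained by pairing the equation of the spray
    with v and z.  Here [s1], [s2] are the products of the unknown with v and z,
    and the conclusion concerns its component along u = z - (w/r) v. *)
Lemma spray_elimination (C : fieldType)
    (K Kr Kq krr krq kqq t r q w wb s1 s2 y1 y2 : C) :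
  r != 0 -> q = w * wb -> K = r * Kr + q * Kq ->
  r * krr + q * krq = 0 -> r * krq + q * kqq = 0 ->
  Kr * s1 + (krr * s1 + krq * (wb * s2)) * r + (krq * s1 + kqq * (wb * s2)) * (w * wb)
    + Kq * s2 * wb = y1 ->
  Kr * s2 + (krr * s1 + krq * (wb * s2)) * w + (krq * s1 + kqq * (wb * s2)) * (w * t)
    + Kq * s2 * t = y2 ->
  (s2 - w / r * s1) * (K * Kr + (t - q / r) * (r * Kr * Kq + K * q * kqq)) =
  K * (y2 - w / r * y1) - Kq * (t - q / r) * (w * y1)
  /\ K * s2 = r * Kr * (s2 - w / r * s1) + w * y1.
Proof.
move=> r0 qE KE h1 h2 <- <-.
have krqE : krq = - (q * kqq) / r.
  by apply: (mulfI r0); rewrite mulrCA mulfV// mulr1; apply/eqP; rewrite -addr_eq0 h2.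
have krrE : krr = - (q * krq) / r.
  by apply: (mulfI r0); rewrite mulrCA mulfV// mulr1; apply/eqP; rewrite -addr_eq0 h1.
by split; rewrite krrE krqE KE qE; field.
Qed.

Lemma spray_defect (C : fieldType)
    (Kt Kq krt krr krq kqt kqq r q w wb s1 s2 vb zb : C) :
  r != 0 -> q = w * wb ->
  r * krr + q * krq = 0 -> r * krq + q * kqq = 0 -> r * krt + q * kqt = Kt ->
  (krt * w + krq * w * r) * vb + (kqt * w + kqq * w * r) * (wb * zb) + Kq * r * zb
  - ((krr * s1 + krq * (wb * s2)) * vb + (krq * s1 + kqq * (wb * s2)) * (wb * zb))
  - (Kt * zb + Kq * (w * vb)) =
  ((kqt + kqq * r) * q + Kq * r - Kt - kqq * wb ^+ 2 * (s2 - w / r * s1)) *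
  (zb - w / r * vb).
Proof.
move=> r0 qE h1 h2 <-.
have krqE : krq = - (q * kqq) / r.
  by apply: (mulfI r0); rewrite mulrCA mulfV// mulr1; apply/eqP; rewrite -addr_eq0 h2.
have krrE : krr = - (q * krq) / r.
  by apply: (mulfI r0); rewrite mulrCA mulfV// mulr1; apply/eqP; rewrite -addr_eq0 h1.
by rewrite krrE krqE qE; field.
Qed.

Section ScalarCondition.
Variables (R : realType) (n : nat) (F : T10 R n -> R).
Variables (z v : 'cV[R[i]]_n).
Let p : T10 R n := (z, v).
Hypothesis smoothF : smooth_at (fun q => F q ^+ 2) p.
Variables (Kt Kr Kq : T10 R n -> R) (krt krr krq kqt kqq : R).
Hypothesis dF : \forall q \near p, trq (fun q => F q ^+ 2) q (Kt q) (Kr q) (Kq q).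
Hypothesis euler : \forall q \near p, sqnorm q.2 * Kr q + qfun q * Kq q = F q ^+ 2.
Hypotheses (dKr : trq Kr p krt krr krq) (dKq : trq Kq p kqt krq kqq).
Local Notation t := (sqnorm z).
Local Notation r := (sqnorm v).
Local Notation q := (qfun p).
Local Notation K := (F p ^+ 2).
Hypotheses (hr : r * krr + q * krq = 0) (hq : r * krq + q * kqq = 0)
  (ht : r * krt + q * kqt = Kt p).
Hypotheses (v0 : v != 0) (K0 : K != 0) (Kr0 : Kr p != 0).
(** The coefficient of the component along u in [spray_elimination]. *)
Definition levi_det : R :=
  K * Kr p + (t - q / r) * (r * Kr p * Kq p + K * q * kqq).
Hypothesis det0 : levi_det != 0.

Lemma G_v_near a : \forall q \near p, G_v F a q = vgrad Kr Kq a q.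
Proof. by apply: filterS dF => q' /(trq_wirt_v a) /wirt_val. Qed.

Lemma G_vbar_near a : \forall q \near p, G_vbar F a q = (vgrad Kr Kq a q)^*.
Proof.
apply: filterS dF => q' /(trq_wirt_v a) /wirt_bar_val.
by rewrite /vgrad !cJD !cJM !conjcK !conjc_real.
Qed.

Lemma euler_v_near : \forall q \near p, \sum_(a < n) G_v F a q * q.2 a 0 = Gfun F q.
Proof.
have near_grad : \forall q \near p, forall a, G_v F a q = vgrad Kr Kq a q.
  exact: (@filter_forall _ _ (fun a q => G_v F a q = vgrad Kr Kq a q)
    (nbhs p) (nbhs_filter p) G_v_near).
apply: filterS2 near_grad euler => q' gradE eulerE.
transitivity (\sum_(a < n) vgrad Kr Kq a q' * q'.2 a 0).
  by apply: eq_bigr => a _; congr (_ * _); exact: gradE.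
transitivity ((Kr q')%:C * hdot q'.2 q'.2 +
    (Kq q')%:C * (hdot q'.2 q'.1)^*%C * hdot q'.2 q'.1).
  rewrite [hdot _ _ in X in X + _]hdotE [hdot _ _ in X in _ + _ * X]hdotE.
  rewrite !mulr_sumr -big_split; by apply: eq_bigr => a _; rewrite /vgrad /=; ring.
rewrite /Gfun -eulerE -mulrA [_^*%C * _]mulrC -qfunE hdot_sqnorm.
by rewrite rmorphD !rmorphM /=; ring.
Qed.

Lemma euler_vbar_near :
  \forall q \near p, \sum_(a < n) G_vbar F a q * (q.2 a 0)^*%C = Gfun F q.
Proof.
have near_grad : \forall q \near p, forall a, G_v F a q = vgrad Kr Kq a q.
  exact: (@filter_forall _ _ (fun a q => G_v F a q = vgrad Kr Kq a q)
    (nbhs p) (nbhs_filter p) G_v_near).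
have near_gradb : \forall q \near p, forall a, G_vbar F a q = (vgrad Kr Kq a q)^*.
  exact: (@filter_forall _ _ (fun a q => G_vbar F a q = (vgrad Kr Kq a q)^*)
    (nbhs p) (nbhs_filter p) G_vbar_near).
apply: filterS3 near_grad near_gradb euler_v_near => q' gE gbE eE.
transitivity ((Gfun F q')^*%C); last exact: conjc_real.
rewrite -eE rmorph_sum; apply: eq_bigr => a _ /=.
by rewrite cJM; congr (_ * _); rewrite gbE -gE.
Qed.

Local Notation W := (hdot v z).

Lemma levi_mxE a b : levi_mx F p a b = (Kr p)%:C * (a == b)%:R +
   (krr%:C * (v a 0)^*%C + krq%:C * (W^*%C * (z a 0)^*%C)) * v b 0 +
   (krq%:C * (v a 0)^*%C + kqq%:C * (W^*%C * (z a 0)^*%C)) * (W * z b 0) +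
   (Kq p)%:C * ((z a 0)^*%C * z b 0).
Proof.
rewrite mxE; have gb : \forall q \near p, (vgrad Kr Kq b q)^* = G_vbar F b q.
  by apply: filterS (G_vbar_near b) => q' ->.
apply: (etrans (wirt_val (wirt_near (wirt_conj (wirt_vgrad_v dKr dKq a b)) gb))).
by rewrite !cJD !cJM conjc_nat !cJD !cJM !conjcK !conjc_real.
Qed.

Lemma G_vbar_zE c b : G_vbar_z F c b p =
   (krt%:C * (z b 0)^*%C + krq%:C * (W * (v b 0)^*%C)) * v c 0 +
   (kqt%:C * (z b 0)^*%C + kqq%:C * (W * (v b 0)^*%C)) * (W * z c 0) +
   (Kq p)%:C * (W * (b == c)%:R).
Proof.
have gb : \forall q \near p, (vgrad Kr Kq c q)^* = G_vbar F c q.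
  by apply: filterS (G_vbar_near c) => q' ->.
apply: (etrans (wirt_val (wirt_near (wirt_conj (wirt_vgrad_z dKr dKq b c)) gb))).
by rewrite !cJD !cJM conjc_nat !cJD !cJM !conjcK !conjc_real.
Qed.

Section Pairing.
Variable S : 'I_n -> R[i].
Let s1 := \sum_a S a * (v a 0)^*%C.
Let s2 := \sum_a S a * (z a 0)^*%C.
Let A := krr%:C * s1 + krq%:C * (W^*%C * s2).
Let B := krq%:C * s1 + kqq%:C * (W^*%C * s2).

Lemma levi_row e : \sum_a S a * levi_mx F p a e =
  (Kr p)%:C * S e + A * v e 0 + (B * W + (Kq p)%:C * s2) * z e 0.
Proof.
transitivity ((Kr p)%:C * \sum_a S a * (e == a)%:R +
   (krr%:C * v e 0 + krq%:C * (W * z e 0)) * s1 +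
   (krq%:C * W^*%C * v e 0 + kqq%:C * W^*%C * (W * z e 0) + (Kq p)%:C * z e 0) * s2).
  have lin (c1 c2 c3 : R[i]) (f : 'I_n -> R[i]) : c1 * (\sum_a S a * f a) +
      c2 * (\sum_a S a * (v a 0)^*%C) + c3 * (\sum_a S a * (z a 0)^*%C) =
      \sum_a S a * (c1 * f a + c2 * (v a 0)^*%C + c3 * (z a 0)^*%C).
    by rewrite !mulr_sumr -!big_split; apply: eq_bigr => a _ /=; ring.
  rewrite lin; apply: eq_bigr => a _; congr (_ * _).
  by rewrite levi_mxE [e == a]eq_sym; ring.
by rewrite sum_kronecker /A /B; ring.
Qed.

(** Pairing the rows of the Levi matrix with v and z closes into a 2x2 system
    for s1 and s2, because the matrix is Kr times the identity up to the span of
    v and z. *)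
Lemma levi_pairing (y : 'I_n -> R[i]) : (forall e, \sum_a S a * levi_mx F p a e = y e) ->
  (s2 - W / r%:C * s1) * levi_det%:C =
    K%:C * (\sum_e y e * (z e 0)^*%C - W / r%:C * \sum_e y e * (v e 0)^*%C)
    - (Kq p)%:C * (t - q / r)%:C * (W * \sum_e y e * (v e 0)^*%C)
  /\ K%:C * s2 = r%:C * (Kr p)%:C * (s2 - W / r%:C * s1) + W * \sum_e y e * (v e 0)^*%C.
Proof.
move=> Sy.
have qC : q%:C = W * W^*%C by rewrite qfunE.
have r0 : r%:C != 0 :> R[i] by rewrite (inj_eq (@complexI R)) sqnorm_eq0.
have KC : K%:C = r%:C * (Kr p)%:C + q%:C * (Kq p)%:C.
  by rewrite -(nbhs_singleton euler) rmorphD !rmorphM.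
have hrC : r%:C * krr%:C + q%:C * krq%:C = 0 by rewrite -!rmorphM -rmorphD hr.
have hqC : r%:C * krq%:C + q%:C * kqq%:C = 0 by rewrite -!rmorphM -rmorphD hq.
have lin (c1 c2 c3 : R[i]) (x : 'cV[R[i]]_n) :
    c1 * (\sum_e S e * (x e 0)^*%C) + c2 * (\sum_e v e 0 * (x e 0)^*%C) +
    c3 * (\sum_e z e 0 * (x e 0)^*%C) =
    \sum_e (c1 * S e + c2 * v e 0 + c3 * z e 0) * (x e 0)^*%C.
  by rewrite !mulr_sumr -!big_split; apply: eq_bigr => e _ /=; ring.
have E1 : (Kr p)%:C * s1 + (krr%:C * s1 + krq%:C * (W^*%C * s2)) * r%:C +
    (krq%:C * s1 + kqq%:C * (W^*%C * s2)) * (W * W^*%C) + (Kq p)%:C * s2 * W^*%C =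
    \sum_e y e * (v e 0)^*%C.
  transitivity ((Kr p)%:C * s1 + A * hdot v v + (B * W + (Kq p)%:C * s2) * hdot z v).
    by rewrite hdot_sqnorm [hdot z v]hdotC /A /B; ring.
  rewrite [hdot v v]hdotE [hdot z v]hdotE lin.
  by apply: eq_bigr => e _; rewrite -Sy levi_row.
have E2 : (Kr p)%:C * s2 + (krr%:C * s1 + krq%:C * (W^*%C * s2)) * W +
    (krq%:C * s1 + kqq%:C * (W^*%C * s2)) * (W * t%:C) + (Kq p)%:C * s2 * t%:C =
    \sum_e y e * (z e 0)^*%C.
  transitivity ((Kr p)%:C * s2 + A * (\sum_e v e 0 * (z e 0)^*%C) +
      (B * W + (Kq p)%:C * s2) * (\sum_e z e 0 * (z e 0)^*%C)).
    by rewrite -!hdotE hdot_sqnorm /A /B; ring.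
  by rewrite lin; apply: eq_bigr => e _; rewrite -Sy levi_row.
have [H1 H2] := spray_elimination r0 qC KC hrC hqC E1 E2.
split; last exact: H2.
have -> : levi_det%:C = K%:C * (Kr p)%:C + (t%:C - q%:C / r%:C) *
    (r%:C * (Kr p)%:C * (Kq p)%:C + K%:C * q%:C * kqq%:C).
  have cast (k kr kq kqq' t' r' q' : R) :
      (k * kr + (t' - q' / r') * (r' * kr * kq + k * q' * kqq'))%:C =
      k%:C * kr%:C + (t'%:C - q'%:C / r'%:C) *
        (r'%:C * kr%:C * kq%:C + k%:C * q'%:C * kqq'%:C) :> R[i].
    by rewrite !(rcB, rcD, rcM, rcV).
  exact: cast.
rewrite H1; have -> // : (t - q / r)%:C = t%:C - q%:C / r%:C :> R[i].
by rewrite -rcV -rcM -rcB.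
Qed.

End Pairing.

(** By [levi_pairing] a vector in the kernel has vanishing products with v and
    z; the Levi matrix then multiplies it by Kr. *)
Lemma levi_unit : levi_mx F p \in unitmx.
Proof.
rewrite -row_free_unit; apply: inj_row_free => x xL.
have S0 e : \sum_a x 0 a * levi_mx F p a e = 0.
  by move/rowP/(_ e): xL; rewrite !mxE.
have [] := levi_pairing S0; set s2 := \sum_a x 0 a * _; set s1 := \sum_a x 0 a * _.
have -> (f : 'I_n -> R[i]) : \sum_e 0 * f e = 0 by apply: big1 => e _; rewrite mul0r.
have -> (f : 'I_n -> R[i]) : \sum_e 0 * f e = 0 by apply: big1 => e _; rewrite mul0r.
rewrite !(mulr0, subr0, addr0) => /eqP.
rewrite mulf_eq0 (inj_eq (@complexI R)) (negPf det0) orbF => /eqP ->.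
rewrite mulr0 => /eqP; rewrite mulf_eq0 (inj_eq (@complexI R)) (negPf K0) /= => /eqP s20.
have KrC : (Kr p)%:C != 0 :> R[i] by rewrite (inj_eq (@complexI R)).
have row e : (Kr p)%:C * x 0 e + (krr%:C * s1 + krq%:C * (W^*%C * s2)) * v e 0 +
    ((krq%:C * s1 + kqq%:C * (W^*%C * s2)) * W + (Kq p)%:C * s2) * z e 0 = 0.
  exact: etrans (esym (levi_row (fun a => x 0 a) e)) (S0 e).
rewrite {}s20 !(mulr0, addr0) in row *.
have s10 : s1 = 0.
  have : \sum_e ((Kr p)%:C * x 0 e + (krr%:C * s1) * v e 0 +
      (krq%:C * s1 * hdot v z) * z e 0) * (v e 0)^*%C = 0.
    apply: big1 => e _; rewrite -[RHS](mul0r ((v e 0)^*%C)) -[in RHS](row e).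
    by congr (_ * _); ring.
  have lin (c1 c2 c3 : R[i]) : \sum_e (c1 * x 0 e + c2 * v e 0 + c3 * z e 0) * (v e 0)^*%C =
      c1 * s1 + c2 * hdot v v + c3 * hdot z v.
    by rewrite !hdotE !mulr_sumr -!big_split; apply: eq_bigr => e _ /=; ring.
  rewrite lin hdot_sqnorm [hdot z v]hdotC => H.
  apply: (mulfI KrC); rewrite mulr0 -[RHS]H.
  transitivity ((Kr p)%:C * s1 + (r%:C * krr%:C + q%:C * krq%:C) * s1).
    by rewrite -!rcM -rcD hr mul0r addr0.
  by rewrite qfunE /=; ring.
apply/rowP => e; rewrite mxE; apply: (mulfI KrC); rewrite mulr0 -[RHS](row e).
by rewrite s10; ring.
Qed.

(** In [spray_defect], the part of the coefficient of the last factor that is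
    free of the spray; [spray_num] is the numerator of the component of the
    spray along u. *)
Definition geodesic_defect : R := (kqt + kqq * r) * q + Kq p * r - Kt p.

Definition spray_num : R := K * (kqt + kqq * r) - Kq p * (Kt p + Kq p * r).

Let S := spray F z v.
Let s1 := \sum_a S a * (v a 0)^*%C.
Let s2 := \sum_a S a * (z a 0)^*%C.

Let r0 : r%:C != 0 :> R[i].
Proof. by rewrite (inj_eq (@complexI R)) sqnorm_eq0. Qed.

Let htC : r%:C * krt%:C + q%:C * kqt%:C = (Kt p)%:C.
Proof. by rewrite -!rcM -rcD ht. Qed.

Let qC : q%:C = W * W^*%C.
Proof. exact: qfunE. Qed.

Let hrC : r%:C * krr%:C + q%:C * krq%:C = 0.
Proof. by rewrite -!rcM -rcD hr. Qed.

Let hqC : r%:C * krq%:C + q%:C * kqq%:C = 0.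
Proof. by rewrite -!rcM -rcD hq. Qed.

Let v_contract (c1 c2 c3 : R[i]) e (g : 'I_n -> R[i]) :
  (forall c, g c = c1 * (z c 0)^*%C + c2 * (v c 0)^*%C + c3 * (e == c)%:R) ->
  \sum_c v c 0 * g c = c1 * W + c2 * r%:C + c3 * v e 0.
Proof.
move=> gE; rewrite -hdot_sqnorm -[v e 0](sum_kronecker (fun c => v c 0) e) !hdotE.
rewrite !mulr_sumr -!big_split.
by apply: eq_bigr => c _ /=; rewrite gE; ring.
Qed.

Lemma spray_component : (s2 - W / r%:C * s1) * levi_det%:C =
  (t - q / r)%:C * W ^+ 2 * spray_num%:C.
Proof.
pose A := W * (krt%:C + krq%:C * r%:C + (Kq p)%:C).
pose B := W ^+ 2 * (kqt%:C + kqq%:C * r%:C).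
have SL e : \sum_a S a * levi_mx F p a e = A * v e 0 + B * z e 0.
  apply: etrans; first exact: (spray_levi levi_unit e).
  apply: etrans; first apply: (v_contract (e := e)
    (c1 := krt%:C * v e 0 + kqt%:C * W * z e 0)
    (c2 := krq%:C * W * v e 0 + kqq%:C * W ^+ 2 * z e 0) (c3 := (Kq p)%:C * W)).
    by move=> c; rewrite G_vbar_zE [c == e]eq_sym; ring.
  by rewrite /A /B; ring.
have [-> _] := levi_pairing SL.
have pair (x : 'cV[R[i]]_n) : \sum_e (A * v e 0 + B * z e 0) * (x e 0)^*%C =
    A * hdot v x + B * hdot z x.
  by rewrite !hdotE !mulr_sumr -big_split; apply: eq_bigr => e _ /=; ring.
rewrite !pair !hdot_sqnorm [hdot z v]hdotC /spray_num.
have cast (k a b c d e : R) : (k * (a + b * c) - d * (e + d * c))%:C =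
    k%:C * (a%:C + b%:C * c%:C) - d%:C * (e%:C + d%:C * c%:C) :> R[i].
  by rewrite !(rcB, rcD, rcM, rcV).
rewrite (cast K kqt kqq r (Kq p) (Kt p)).
have -> : (t - q / r)%:C = t%:C - q%:C / r%:C :> R[i].
  by rewrite -rcV -rcM -rcB.
rewrite -htC qC /A /B.
have krqE : krq%:C = - (q%:C * kqq%:C) / r%:C.
  by apply: (mulfI r0); rewrite mulrCA mulfV// mulr1; apply/eqP; rewrite -addr_eq0 hqC.
by rewrite krqE qC; field.
Qed.

Lemma weakly_kahler_defect b :
  \sum_(a < n) \sum_(c < n) G_v F a p * Gamma F a b c p * v c 0 =
  \sum_(a < n) \sum_(c < n) G_v F a p * Gamma F a c b p * v c 0 <->
  (geodesic_defect * levi_det - kqq * q ^+ 2 * (t - q / r) * spray_num)%:C *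
    ((z b 0)^*%C - W / r%:C * (v b 0)^*%C) = 0.
Proof.
have E1 : \sum_(c < n) v c 0 * wirtinger (dir_z R c) (G_v F b) p =
    (krt%:C * W + krq%:C * W * r%:C) * (v b 0)^*%C +
    (kqt%:C * W + kqq%:C * W * r%:C) * (W^*%C * (z b 0)^*%C) +
    (Kq p)%:C * r%:C * (z b 0)^*%C.
  apply: etrans; first apply: (v_contract (e := b)
    (c1 := krt%:C * (v b 0)^*%C + kqt%:C * (W^*%C * (z b 0)^*%C))
    (c2 := krq%:C * W * (v b 0)^*%C + kqq%:C * W * (W^*%C * (z b 0)^*%C) +
       (Kq p)%:C * (z b 0)^*%C) (c3 := 0)).
    move=> c; apply: etrans (wirt_val (wirt_near (wirt_vgrad_z dKr dKq c b) _)) _.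
      by apply: filterS (G_v_near b) => q' ->.
    by rewrite /=; ring.
  by ring.
have E2 : \sum_(s < n) S s * wirtinger (dir_v R s) (G_v F b) p =
    (krr%:C * s1 + krq%:C * (W^*%C * s2)) * (v b 0)^*%C +
    (krq%:C * s1 + kqq%:C * (W^*%C * s2)) * (W^*%C * (z b 0)^*%C).
  transitivity ((krr%:C * (v b 0)^*%C + krq%:C * (W^*%C * (z b 0)^*%C)) * s1 +
    (krq%:C * W^*%C * (v b 0)^*%C + kqq%:C * W^*%C * (W^*%C * (z b 0)^*%C)) * s2); last by ring.
  rewrite /s1 /s2 !mulr_sumr -big_split; apply: eq_bigr => s _ /=.
  apply: etrans (congr1 (fun x => S s * x)
    (wirt_val (wirt_near (wirt_vgrad_v dKr dKq s b) _))) _.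
    by apply: filterS (G_v_near b) => q' ->.
  by rewrite /=; ring.
have E3 : wirtinger (dir_z R b) (Gfun F) p =
    (Kt p)%:C * (z b 0)^*%C + (Kq p)%:C * (W * (v b 0)^*%C).
  exact: wirt_val (trq_wirt_z b (nbhs_singleton dF)).
apply: iff_trans (weakly_kahler_spray smoothF euler_v_near euler_vbar_near
  levi_unit b) _.
have detC : levi_det%:C != 0 :> R[i] by rewrite (inj_eq (@complexI R)).
set lhs := (X in X = _ <-> _); set rhs := (X in _ = X <-> _).
have D : (lhs - rhs) * levi_det%:C =
  (geodesic_defect * levi_det - kqq * q ^+ 2 * (t - q / r) * spray_num)%:C *
    ((z b 0)^*%C - W / r%:C * (v b 0)^*%C).
  transitivity (((kqt%:C + kqq%:C * r%:C) * q%:C + (Kq p)%:C * r%:C - (Kt p)%:C -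
    kqq%:C * W^*%C ^+ 2 * (s2 - W / r%:C * s1)) *
    ((z b 0)^*%C - W / r%:C * (v b 0)^*%C) * levi_det%:C).
    congr (_ * _); rewrite -(spray_defect _ _ _ _ _ r0 qC hrC hqC htC).
    exact: (congr2 (fun x y => x - y) (congr2 (fun x y => x - y) E1 E2) E3).
  have cast a b' c d e f g h k l :
      (((a + b' * c) * d + e * c - f) * g - b' * h * k * l)%:C =
      (((a%:C + b'%:C * c%:C) * d%:C + e%:C * c%:C - f%:C) * g%:C -
        b'%:C * h%:C * k%:C * l%:C) :> R[i].
    by rewrite !(rcB, rcD, rcM, rcV).
  rewrite /geodesic_defect (cast kqt kqq r q (Kq p) (Kt p) levi_det (q ^+ 2)
    (t - q / r) spray_num).
  rewrite mulrAC; congr (_ * _); rewrite mulrBl -[_ * _ * levi_det%:C]mulrA spray_component.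
  by rewrite [(q ^+ 2)%:C]rmorphXn /= qC; ring.
split => [H|H].
  by rewrite -D; apply/eqP; rewrite mulf_eq0 subr_eq0; apply/orP; left; apply/eqP.
move/eqP: D; rewrite H mulf_eq0 (negPf detC) orbF subr_eq0 => /eqP; exact.
Qed.

(** In [weakly_kahler_defect] the index b occurs only in the vector u = z -
    (conj w / r) v, so the n conditions hold as soon as u = 0 or its coefficient
    vanishes, and |u|^2 = t - s. *)
Lemma weakly_kahler_scalar :
  (forall b, \sum_(a < n) \sum_(c < n) G_v F a p * Gamma F a b c p * v c 0 =
     \sum_(a < n) \sum_(c < n) G_v F a p * Gamma F a c b p * v c 0) <->
  (t = q / r \/
   geodesic_defect * levi_det = kqq * q ^+ 2 * (t - q / r) * spray_num).
Proof.
pose u := z - (W^*%C / r%:C) *: v.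
have ub b : (u b 0)^*%C = (z b 0)^*%C - W / r%:C * (v b 0)^*%C.
  have -> : W / r%:C = (W^*%C / r%:C)^*%C by rewrite cJM conjcK -rcV conjc_real.
  by rewrite !mxE; exact: etrans (rmorphB _ _ _) (congr1 (fun x => _ - x) (cJM _ _)).
have uu : sqnorm u = t - q / r by exact: sqnorm_reject.
split=> [H|].
  have [u0|/eqP u0] := eqVneq u 0; first left.
    by apply/eqP; rewrite -subr_eq0 -uu u0 sqnorm0.
  right; apply/eqP; rewrite -subr_eq0; apply/eqP; apply: contrapT => D0; apply: u0.
  apply/colP => b; have /weakly_kahler_defect/eqP := H b.
  rewrite mulf_eq0 (inj_eq (@complexI R)) => /orP[/eqP/D0 //|].
  by rewrite -ub conjc_eq0 => /eqP ->; rewrite [RHS]mxE.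
move=> H b; apply/weakly_kahler_defect.
case: H => [tq|->]; last by rewrite subrr mul0r.
have /eqP : sqnorm u = 0 by rewrite uu tq subrr.
by rewrite sqnorm_eq0 -ub => /eqP ->; rewrite mxE conjc0 mulr0.
Qed.

End ScalarCondition.

(** * Derivatives relative to a set *)

Section DerivativeWithin.
Variable R : realType.
Implicit Types (I : set R) (f g : R -> R) (x l : R).

Definition is_dw I f x l := quotient_at f x y @[y --> within I x^'] --> l.

Lemma is_dw_of_cvg I f x : cvg (quotient_at f x y @[y --> within I x^']) ->
  is_dw I f x (derive_within I f x).
Proof. by []. Qed.

Lemma is_dwP I f x l : is_dw I f x l <->
  forall e, 0 < e -> \forall y \near x, y != x -> I y -> `|l - quotient_at f x y| < e.
Proof.
have FF : Filter (within I x^') by apply: within_filter.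
split=> [/(@cvgrPdist_lt _ _ _ _ FF) H e e0|H].
  exact: (H e e0).
apply/(@cvgrPdist_lt _ _ _ _ FF) => e /H; exact.
Qed.

Lemma is_dw_near I f g x l : is_dw I f x l -> I x ->
  (\forall y \near x, I y -> f y = g y) -> is_dw I g x l.
Proof.
move=> /is_dwP H Ix fg; apply/is_dwP => e e0.
have fgx := nbhs_singleton fg Ix.
apply: filterS2 fg (H e e0) => y fgy Hy yx Iy.
by move: (Hy yx Iy); rewrite /quotient_at fgx fgy.
Qed.

Lemma is_derive_dw I f x l : is_derive x 1 f l -> is_dw I f x l.
Proof.
move=> /is_derive1_caratheodory[g [fE cg gx]]; apply/is_dwP => e e0.
have /cvgrPdist_lt /(_ e e0) := cg; rewrite gx.
apply: filterS => y gy yx _; rewrite /quotient_at fE mulfK// subr_eq0//.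
Qed.

(** A derivative relative to I suffices for the chain rule when the inner
    function has its values in I. One-sided derivatives at an endpoint of the
    range of t enter the calculus in several variables in this way. *)
Lemma dw_comp I f g x l d : is_dw I f x l -> g 0 = x ->
  (\forall h \near (0 : R), I (g h)) -> is_derive (0 : R) 1 g d ->
  is_derive (0 : R) 1 (f \o g) (l * d).
Proof.
move=> /is_dwP H g0 Ig /is_derive1_caratheodory[k [gE ck k0]].
have cg : {for 0, continuous g}.
  apply: differentiable_continuous; apply/derivable1_diffP.
  by have [] : is_derive (0 : R) 1 g d by apply/is_derive1_caratheodory; exists k.
pose q y := if y == x then l else quotient_at f x y.
apply/is_derive1_caratheodory; exists (fun h => q (g h) * k h); split.
- move=> h /=; rewrite -mulrA -gE g0 /q; case: eqP => [->|/eqP gx].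
    by rewrite !subrr mulr0.
  by rewrite /quotient_at divfK// subr_eq0.
- apply: (@cvgM _ _ _ _ (q \o g) k (q (g 0)) (k 0)) => //.
  rewrite {2}/q g0 eqxx; apply/cvgrPdist_lt => e e0.
  have := H e e0; rewrite -{1}g0 => /cg.
  apply: filterS2 Ig => h Ih; rewrite /= /q.
  case: eqP => [_ _|/eqP gx]; first by rewrite subrr normr0.
  by apply.
- by rewrite /q g0 eqxx k0.
Qed.

Lemma dw_val I f x l : ProperFilter (within I x^') -> is_dw I f x l ->
  derive_within I f x = l.
Proof. by move=> PF H; apply: cvg_lim => //; exact: norm_hausdorff. Qed.

Lemma dw_cont I f x l : is_dw I f x l -> I x ->
  forall e, 0 < e -> \forall y \near x, I y -> `|f x - f y| < e.
Proof.
move=> /is_dwP H Ix e e0; have l0 : 0 < `|l| + 1 by rewrite ltr_wpDl.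
have ballx : \forall y \near x, `|x - y| < e / (`|l| + 1).
  by apply: nbhsx_ballx; rewrite divr_gt0.
apply: filterS2 (H 1 ltr01) ballx => y Hy xy Iy.
have [->|yx] := eqVneq y x; first by rewrite subrr normr0.
have {Hy} := Hy yx Iy; rewrite /quotient_at => Hy.
have -> : f x - f y = - ((f y - f x) / (y - x)) * (y - x).
  by rewrite mulNr divfK ?opprB// subr_eq0.
rewrite normrM normrN -[e](@divfK _ (`|l| + 1)) ?gt_eqF// mulrC.
rewrite [`|y - x|]distrC; apply: ltr_pM => //.
rewrite -[X in `|X| < _](subrK l); apply: le_lt_trans (ler_normD _ _) _.
by rewrite addrC ltrD2l distrC.
Qed.

End DerivativeWithin.

Lemma trq_dw (R : realType) (n : nat) (I : set R) (k : R -> R) (l : R)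
    (u : T10 R n -> R) p ut ur uq :
  trq u p ut ur uq -> is_dw I k (u p) l -> (\forall q \near p, I (u q)) ->
  trq (fun q => k (u q)) p (l * ut) (l * ur) (l * uq).
Proof.
move=> du dk Iu w.
have := dw_comp dk (real_line0 _ _ _) (near_line w Iu) (du w).
by rewrite !mulrDr !mulrA.
Qed.

Lemma trq_inv (R : realType) (n : nat) (u : T10 R n -> R) p ut ur uq :
  trq u p ut ur uq -> u p != 0 ->
  trq (fun q => (u q)^-1) p (- (u p) ^- 2 * ut) (- (u p) ^- 2 * ur) (- (u p) ^- 2 * uq).
Proof.
move=> du u0; have d : is_derive (u p) 1 (fun x : R => x^-1) (- (u p) ^- 2 *: 1).
  exact: is_deriveV.
apply: (trq_eq (trq_dw du (is_derive_dw setT d) _)); rewrite ?[_ *: 1]mulr1 //.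
exact: filterT.
Qed.

Lemma trq_sqrt (R : realType) (n : nat) (u : T10 R n -> R) p ut ur uq :
  trq u p ut ur uq -> 0 < u p ->
  trq (fun q => Num.sqrt (u q)) p ((2 * Num.sqrt (u p))^-1 * ut)
    ((2 * Num.sqrt (u p))^-1 * ur) ((2 * Num.sqrt (u p))^-1 * uq).
Proof.
move=> du u0; apply: (trq_dw du (is_derive_dw setT (is_derive1_sqrt u0))).
exact: filterT.
Qed.

(** * Smoothness of t, r and q *)

Section CoordinateSmoothness.
Variables (R : realType) (n : nat).

Lemma Re_continuous : continuous (fun x : R[i] => complex.Re x : R).
Proof.
move=> x; apply/(@cvgrPdist_lt _ _ _ (nbhs x) (nbhs_filter x)) => e e0.
apply/nbhs_ballP; exists (e%:C : R[i]); first by rewrite /= ltcR.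
move=> y; rewrite -ball_normE /= => xy.
have -> : complex.Re x - complex.Re y = complex.Re (x - y) by case: x y {xy} => [? ?] [? ?].
by rewrite -ltcR; apply: le_lt_trans xy; exact: normc_ge_Re.
Qed.

Lemma Im_continuous : continuous (fun x : R[i] => complex.Im x : R).
Proof.
move=> x; apply/(@cvgrPdist_lt _ _ _ (nbhs x) (nbhs_filter x)) => e e0.
apply/nbhs_ballP; exists (e%:C : R[i]); first by rewrite /= ltcR.
move=> y; rewrite -ball_normE /= => xy.
have -> : complex.Im x - complex.Im y = complex.Re ('i * (y - x)).
  by case: x y {xy} => [? ?] [? ?] /=; ring.
rewrite -ltcR; apply: le_lt_trans xy; apply: le_trans (normc_ge_Re _) _.
by rewrite normrM distrC [`|'i|]normc_def /= expr0n add0r expr1n sqrtr1 mul1r.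
Qed.

(** The iterated derivatives are L itself, and then constants. *)
Lemma smooth_on_affine (V : normedModType R[i]) (U : set V) (L : V -> R) (l : V -> R) :
  continuous L -> (forall p w, is_derive (0 : R) 1 (real_line L p w) (l w)) ->
  smooth_on U L.
Proof.
move=> cL dL ws p Up.
suff : (exists c, iter_dir_derive L ws = cst c) \/ iter_dir_derive L ws = L.
  case=> [[c ->]|->].
    split; first exact: cvg_cst.
    by move=> w; exact: derivable_cst.
  by split; [exact: cL|move=> w; have [] := dL p w].
elim: ws => [|w ws [[c IH]|IH]]; first by right.
- left; exists 0; apply/funext => q; rewrite /= -/(iter_dir_derive L ws) IH.
  exact/is_derive_dir/is_derive_cst.
- left; exists (l w); apply/funext => q; rewrite /= -/(iter_dir_derive L ws) IH.
  exact: is_derive_dir.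
Qed.

Lemma Csmooth_coord_v (U : set (T10 R n)) i : Csmooth_on U (fun q : T10 R n => q.2 i 0).
Proof.
have c : continuous (fun q : T10 R n => q.2 i 0).
  move=> q; apply: (@continuous_comp _ _ _ snd (fun M : 'cV[R[i]]_n => M i 0)).
    exact: cvg_snd.
  exact: coord_continuous.
split.
  apply: (@smooth_on_affine _ U (fun q : T10 R n => complex.Re (q.2 i 0))
    (fun w : T10 R n => complex.Re (w.2 i 0))).
    by move=> q; apply: (continuous_comp (c q)); exact: Re_continuous.
  by move=> p w; have [] := cline_coord_v p w i.
apply: (@smooth_on_affine _ U (fun q : T10 R n => complex.Im (q.2 i 0))
    (fun w : T10 R n => complex.Im (w.2 i 0))).
  by move=> q; apply: (continuous_comp (c q)); exact: Im_continuous.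
by move=> p w; have [] := cline_coord_v p w i.
Qed.

Lemma Csmooth_coord_z (U : set (T10 R n)) i : Csmooth_on U (fun q : T10 R n => q.1 i 0).
Proof.
have c : continuous (fun q : T10 R n => q.1 i 0).
  move=> q; apply: (@continuous_comp _ _ _ fst (fun M : 'cV[R[i]]_n => M i 0)).
    exact: cvg_fst.
  exact: coord_continuous.
split.
  apply: (@smooth_on_affine _ U (fun q : T10 R n => complex.Re (q.1 i 0))
    (fun w : T10 R n => complex.Re (w.1 i 0))).
    by move=> q; apply: (continuous_comp (c q)); exact: Re_continuous.
  by move=> p w; have [] := cline_coord_z p w i.
apply: (@smooth_on_affine _ U (fun q : T10 R n => complex.Im (q.1 i 0))
    (fun w : T10 R n => complex.Im (w.1 i 0))).
  by move=> q; apply: (continuous_comp (c q)); exact: Im_continuous.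
by move=> p w; have [] := cline_coord_z p w i.
Qed.

Definition Calg (V : normedModType R[i]) (U : set V) (f : V -> R[i]) :=
  smooth_alg U (fun p => complex.Re (f p)) /\ smooth_alg U (fun p => complex.Im (f p)).

Section Calg.
Variables (V : normedModType R[i]) (U : set V).
Implicit Types f g : V -> R[i].

Lemma Calg_smooth f : Csmooth_on U f -> Calg U f.
Proof. by case=> fr fi; split; exact: smooth_alg_gen. Qed.

Lemma Calg_add f g : Calg U f -> Calg U g -> Calg U (fun p => f p + g p).
Proof.
move=> [fr fi] [gr gi]; split.
  rewrite (_ : (fun _ => _) = fun p => complex.Re (f p) + complex.Re (g p)).
    exact: smooth_alg_add.
  by apply/funext => p; exact: cReD.
rewrite (_ : (fun _ => _) = fun p => complex.Im (f p) + complex.Im (g p)).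
  exact: smooth_alg_add.
by apply/funext => p; exact: cImD.
Qed.

Lemma smooth_alg_opp (u : V -> R) : smooth_alg U u -> smooth_alg U (fun p => - u p).
Proof.
move=> su; rewrite (_ : (fun _ => _) = fun p => -1 * u p).
  by apply: smooth_alg_mul => //; exact: smooth_alg_cst.
by apply/funext => p; rewrite mulN1r.
Qed.

Lemma Calg_mul f g : Calg U f -> Calg U g -> Calg U (fun p => f p * g p).
Proof.
move=> [fr fi] [gr gi]; split.
  rewrite (_ : (fun _ => _) = fun p => complex.Re (f p) * complex.Re (g p) +
      - (complex.Im (f p) * complex.Im (g p))).
    by apply: smooth_alg_add; [|apply: smooth_alg_opp]; exact: smooth_alg_mul.
  by apply/funext => p; exact: cReM.
rewrite (_ : (fun _ => _) = fun p => complex.Re (f p) * complex.Im (g p) +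
    complex.Im (f p) * complex.Re (g p)).
  by apply: smooth_alg_add; exact: smooth_alg_mul.
by apply/funext => p; exact: cImM.
Qed.

Lemma Calg_conj f : Calg U f -> Calg U (fun p => (f p)^*).
Proof.
move=> [fr fi]; split.
  by rewrite (_ : (fun _ => _) = fun p => complex.Re (f p))//; apply/funext => p; exact: cReJ.
rewrite (_ : (fun _ => _) = fun p => - complex.Im (f p)); first exact: smooth_alg_opp.
by apply/funext => p; exact: cImJ.
Qed.

Lemma Calg_sum m (f : 'I_m -> V -> R[i]) :
  (forall i, Calg U (f i)) -> Calg U (fun p => \sum_(i < m) f i p).
Proof.
elim: m f => [|m IH] f sf.
  rewrite (_ : (fun _ => _) = fun=> 0); last by apply/funext => p; rewrite big_ord0.
  by split; exact: smooth_alg_cst.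
rewrite (_ : (fun _ => _) = fun p => f ord0 p + \sum_(i < m) f (lift ord0 i) p).
  by apply: Calg_add => //; exact: IH.
by apply/funext => p; rewrite big_ord_recl.
Qed.

Lemma smooth_alg_normc f : Calg U f ->
  smooth_alg U (fun p => Normc.normc (f p) ^+ 2).
Proof.
move=> sf; have [fr _] := Calg_mul sf (Calg_conj sf); move: fr.
by congr smooth_alg; apply/funext => p; rewrite mulJ_normc.
Qed.

End Calg.

Lemma sqnorm_z_alg (U : set (T10 R n)) : smooth_alg U (fun q => sqnorm q.1).
Proof.
have [] // := @Calg_sum _ U _ (fun i q => q.1 i 0 * (q.1 i 0)^*) _.
by move=> i; apply: Calg_mul; [|apply: Calg_conj]; exact/Calg_smooth/Csmooth_coord_z.
Qed.

Lemma sqnorm_v_alg (U : set (T10 R n)) : smooth_alg U (fun q => sqnorm q.2).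
Proof.
have [] // := @Calg_sum _ U _ (fun i q => q.2 i 0 * (q.2 i 0)^*) _.
by move=> i; apply: Calg_mul; [|apply: Calg_conj]; exact/Calg_smooth/Csmooth_coord_v.
Qed.

Lemma qfun_alg (U : set (T10 R n)) : smooth_alg U (@qfun R n).
Proof.
apply: smooth_alg_normc; apply: Calg_sum => i; apply: Calg_mul.
  exact/Calg_smooth/Csmooth_coord_z.
exact/Calg_conj/Calg_smooth/Csmooth_coord_v.
Qed.

Lemma sqnorm_z_cont p : {for p, continuous (fun q : T10 R n => sqnorm q.1)}.
Proof. exact: (smooth_alg_cont (sqnorm_z_alg setT)). Qed.

Lemma sqnorm_v_cont p : {for p, continuous (fun q : T10 R n => sqnorm q.2)}.
Proof. exact: (smooth_alg_cont (sqnorm_v_alg setT)). Qed.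

Lemma qfun_cont p : {for p, continuous (@qfun R n)}.
Proof. exact: (smooth_alg_cont (qfun_alg setT)). Qed.

(** A derivative along (z, v) of a function of the base point only sees z. *)
Lemma smooth_on_fst (D : set 'cV[R[i]]_n) (f : 'cV[R[i]]_n -> R) :
  smooth_on D f -> smooth_on (D `*` setT) (fun q : T10 R n => f q.1).
Proof.
move=> sf ws p [Dp _].
have -> : iter_dir_derive (fun q : T10 R n => f q.1) ws =
    (fun q => iter_dir_derive f (map fst ws) q.1).
  by elim: ws => [|w ws IH] //=; rewrite -/(iter_dir_derive _ ws) IH.
have [cf df] := sf (map fst ws) p.1 Dp; split; last by move=> w; exact: (df w.1).
apply: (@continuous_comp _ _ _ fst (iter_dir_derive f (map fst ws))) cf.
exact: cvg_fst.
Qed.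

End CoordinateSmoothness.

(** * Derivatives of a Randers metric *)

Section RandersJet.
Variables (R : realType) (n : nat) (F : T10 R n -> R) (I : set R).
Variables (z v : 'cV[R[i]]_n).
Let p : T10 R n := (z, v).
Variables (f g k l f' g' k' l' : R -> R).

(** The squares of the Hermitian part and of the 1-form part of a Randers metric
    are of this form, with coefficients depending on t. *)
Definition rform (c d : R -> R) (q : T10 R n) : R :=
  c (sqnorm q.1) * sqnorm q.2 + d (sqnorm q.1) * qfun q.

Hypothesis smoothF : smooth_at (fun q => F q ^+ 2) p.
Hypothesis v0 : v != 0.
Hypothesis Ip : \forall q \near p, I (sqnorm q.1).
Hypothesis dw_p : \forall q \near p,
  [/\ is_dw I f (sqnorm q.1) (f' (sqnorm q.1)),
      is_dw I g (sqnorm q.1) (g' (sqnorm q.1)),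
      is_dw I k (sqnorm q.1) (k' (sqnorm q.1)) &
      is_dw I l (sqnorm q.1) (l' (sqnorm q.1))].
Hypothesis F_p : \forall q \near p,
  [/\ 0 < rform f g q, 0 < rform k l q &
      F q ^+ 2 = (Num.sqrt (rform f g q) + Num.sqrt (rform k l q)) ^+ 2].

Definition ra q := Num.sqrt (rform f g q).
Definition rb q := Num.sqrt (rform k l q).
Definition rA q := 1 + rb q * (ra q)^-1.
Definition rB q := 1 + ra q * (rb q)^-1.
(** As d (a + b)^2 = (1 + b/a) d (a^2) + (1 + a/b) d (b^2), these are the
    derivatives of F^2 in r, q and t. *)
Definition jetr q := rA q * f (sqnorm q.1) + rB q * k (sqnorm q.1).
Definition jetq q := rA q * g (sqnorm q.1) + rB q * l (sqnorm q.1).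
Definition jett q := rA q * rform f' g' q + rB q * rform k' l' q.

(** The derivative of b/a when the squares of a and b have derivatives x and y. *)
Definition dratio (a b x y : R) := y / (2 * (a * b)) - b * x / (2 * a ^+ 3).

Let good q := [/\ 0 < ra q, 0 < rb q & F q ^+ 2 = (ra q + rb q) ^+ 2].

Let good_near : \forall q \near p, good q.
Proof. by apply: filterS F_p => q [P0 Q0 E]; split; rewrite ?sqrtr_gt0. Qed.

Lemma trq_rform (c d c' d' : R -> R) q :
  (\forall q' \near q, I (sqnorm q'.1)) ->
  is_dw I c (sqnorm q.1) (c' (sqnorm q.1)) ->
  is_dw I d (sqnorm q.1) (d' (sqnorm q.1)) ->
  trq (rform c d) q (rform c' d' q) (c (sqnorm q.1)) (d (sqnorm q.1)).
Proof.
move=> Iq dc dd.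
apply: trq_eq (trq_add (trq_mul (trq_dw (trq_t q) dc Iq) (trq_r q))
  (trq_mul (trq_dw (trq_t q) dd Iq) (trq_q q))) _ _ _; rewrite /rform; ring.
Qed.

Let at_q q := [/\ \forall q' \near q, I (sqnorm q'.1), \forall q' \near q, good q',
  trq ra q ((2 * ra q)^-1 * rform f' g' q) ((2 * ra q)^-1 * f (sqnorm q.1))
    ((2 * ra q)^-1 * g (sqnorm q.1)) &
  trq rb q ((2 * rb q)^-1 * rform k' l' q) ((2 * rb q)^-1 * k (sqnorm q.1))
    ((2 * rb q)^-1 * l (sqnorm q.1))].

Let at_q_near : \forall q \near p, at_q q.
Proof.
have I2 := near_join Ip; have g2 := near_join good_near.
near=> q.
have Iq : \forall q' \near q, I (sqnorm q'.1) by near: q.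
have gq : \forall q' \near q, good q' by near: q.
have [df dg dk dl] : [/\ is_dw I f (sqnorm q.1) (f' (sqnorm q.1)),
      is_dw I g (sqnorm q.1) (g' (sqnorm q.1)),
      is_dw I k (sqnorm q.1) (k' (sqnorm q.1)) &
      is_dw I l (sqnorm q.1) (l' (sqnorm q.1))] by near: q.
have [P0 Q0 _] : [/\ 0 < rform f g q, 0 < rform k l q & F q ^+ 2 =
  (Num.sqrt (rform f g q) + Num.sqrt (rform k l q)) ^+ 2] by near: q.
by split => //; apply: trq_sqrt => //; exact: trq_rform.
Unshelve. all: by end_near. Qed.

Lemma jet_F : \forall q \near p, trq (fun q => F q ^+ 2) q (jett q) (jetr q) (jetq q).
Proof.
apply: filterS at_q_near => q [Iq gq da db].
have [a0 b0 _] := nbhs_singleton gq.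
have dab := trq_add da db.
have F2 : \forall q' \near q, (ra q' + rb q') * (ra q' + rb q') = F q' ^+ 2.
  by apply: filterS gq => q' [_ _ ->].
apply: trq_eq (trq_near (trq_mul dab dab) F2) _ _ _;
  rewrite /jett /jetr /jetq /rA /rB; field; by rewrite !gt_eqF.
Qed.

Lemma jet_euler : \forall q \near p, sqnorm q.2 * jetr q + qfun q * jetq q = F q ^+ 2.
Proof.
apply: filterS good_near => q [a0 b0 ->].
have aE : ra q ^+ 2 = rform f g q by rewrite sqr_sqrtr// ltW// -sqrtr_gt0.
have bE : rb q ^+ 2 = rform k l q by rewrite sqr_sqrtr// ltW// -sqrtr_gt0.
transitivity (rA q * rform f g q + rB q * rform k l q).
  by rewrite /jetr /jetq /rform; ring.
by rewrite -aE -bE /rA /rB; field; rewrite !gt_eqF.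
Qed.

Local Notation t := (sqnorm p.1).
Local Notation r := (sqnorm p.2).
Local Notation q := (qfun p).
Let a := ra p.
Let b := rb p.

(** The part of a second derivative of F^2 that comes from differentiating the
    factors 1 + b/a and 1 + a/b. *)
Definition jet2 (c1 c2 x y : R) := c1 * dratio a b x y + c2 * dratio b a y x.

Lemma jet_ratio :
  trq rA p (dratio a b (rform f' g' p) (rform k' l' p)) (dratio a b (f t) (k t))
    (dratio a b (g t) (l t)) /\
  trq rB p (dratio b a (rform k' l' p) (rform f' g' p)) (dratio b a (k t) (f t))
    (dratio b a (l t) (g t)).
Proof.
have [Iq gq da db] := nbhs_singleton at_q_near.
have [a0 b0 _] := nbhs_singleton gq.
by split; [apply: trq_eq (trq_add (trq_cst 1 p) (trq_mul db (trq_inv da (lt0r_neq0 a0)))) _ _ _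
  |apply: trq_eq (trq_add (trq_cst 1 p) (trq_mul da (trq_inv db (lt0r_neq0 b0)))) _ _ _];
  rewrite /dratio /a /b; field; rewrite !gt_eqF.
Qed.

Lemma jet_jetr : trq jetr p
  (jet2 (f t) (k t) (rform f' g' p) (rform k' l' p) + rA p * f' t + rB p * k' t)
  (jet2 (f t) (k t) (f t) (k t)) (jet2 (f t) (k t) (g t) (l t)).
Proof.
have [dA dB] := jet_ratio; have [df _ dk _] := nbhs_singleton dw_p.
apply: trq_eq (trq_add (trq_mul dA (trq_dw (trq_t p) df Ip))
  (trq_mul dB (trq_dw (trq_t p) dk Ip))) _ _ _; rewrite /jet2; ring.
Qed.

Lemma jet_jetq : trq jetq p
  (jet2 (g t) (l t) (rform f' g' p) (rform k' l' p) + rA p * g' t + rB p * l' t)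
  (jet2 (f t) (k t) (g t) (l t)) (jet2 (g t) (l t) (g t) (l t)).
Proof.
have [dA dB] := jet_ratio; have [_ dg _ dl] := nbhs_singleton dw_p.
have [/gt_eqF/negbT a0 /gt_eqF/negbT b0 _] := nbhs_singleton good_near.
rewrite -/a in a0; rewrite -/b in b0.
apply: trq_eq (trq_add (trq_mul dA (trq_dw (trq_t p) dg Ip))
  (trq_mul dB (trq_dw (trq_t p) dl Ip))) _ _ _; rewrite /jet2 /dratio;
  by field; rewrite a0 b0.
Qed.

Definition jetqt := jet2 (g t) (l t) (rform f' g' p) (rform k' l' p) + rA p * g' t + rB p * l' t.
Definition jetqq := jet2 (g t) (l t) (g t) (l t).

Lemma randers_scalar : jetr p != 0 -> levi_det F z v jetr jetq jetqq != 0 ->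
  (forall c, \sum_(i < n) \sum_(j < n) G_v F i p * Gamma F i c j p * v j 0 =
     \sum_(i < n) \sum_(j < n) G_v F i p * Gamma F i j c p * v j 0) <->
  (t = q / r \/ geodesic_defect z v jett jetq jetqt jetqq * levi_det F z v jetr jetq jetqq =
     jetqq * q ^+ 2 * (t - q / r) * spray_num F z v jett jetq jetqt jetqq).
Proof.
move=> Kr0 det0; have [a0 b0 FE] := nbhs_singleton good_near.
have [P0 Q0 _] := nbhs_singleton F_p.
have aE : f t * r + g t * q = a ^+ 2 by rewrite /a /ra sqr_sqrtr// ltW.
have bE : k t * r + l t * q = b ^+ 2 by rewrite /b /rb sqr_sqrtr// ltW.
have ab0 : (a != 0) && (b != 0) by rewrite !gt_eqF.
have homog x y : r * jet2 (f t) (k t) x y + q * jet2 (g t) (l t) x y = 0.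
  rewrite /jet2; transitivity ((f t * r + g t * q) * dratio a b x y +
    (k t * r + l t * q) * dratio b a y x); first by ring.
  by rewrite aE bE /dratio; field; case/andP: ab0 => -> ->.
apply: (weakly_kahler_scalar smoothF jet_F jet_euler jet_jetr jet_jetq) => //.
- rewrite -[RHS](homog (f t) (k t)); congr (_ + _ * _).
  by rewrite /jet2 /dratio; field; case/andP: ab0 => -> ->.
- rewrite -[sqnorm v]/(sqnorm p.2) -[qfun (z, v)]/(qfun p) -[RHS]addr0 -(homog (rform f' g' p) (rform k' l' p)) /jett /rform; ring.
- by rewrite FE expf_neq0// gt_eqF// addr_gt0.
Qed.

End RandersJet.

(** * The algebra of the scalar equation *)

Section RandersNumbers.
Variables (R : realType) (f g k l ft gt kt lt t r q a b : R).

(** The derivatives of a Randers metric, and then the terms of the scalar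
    condition, as rational functions of the values at one point of t, r, q, of
    the coefficients of a^2 = f r + g q and b^2 = k r + l q, and of the
    t-derivatives of these coefficients. This separates the algebra from the
    geometry. *)
Definition num_r := (1 + b * a^-1) * f + (1 + a * b^-1) * k.
Definition num_q := (1 + b * a^-1) * g + (1 + a * b^-1) * l.
Definition num_t := (1 + b * a^-1) * (ft * r + gt * q) + (1 + a * b^-1) * (kt * r + lt * q).
Definition num_qt := g * dratio a b (ft * r + gt * q) (kt * r + lt * q) +
  l * dratio b a (kt * r + lt * q) (ft * r + gt * q) +
  (1 + b * a^-1) * gt + (1 + a * b^-1) * lt.
Definition num_qq := g * dratio a b g l + l * dratio b a l g.
Definition num_det := (a + b) ^+ 2 * num_r +
  (t - q / r) * (r * num_r * num_q + (a + b) ^+ 2 * q * num_qq).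
Definition num_E := (num_qt + num_qq * r) * q + num_q * r - num_t.
Definition num_spray := (a + b) ^+ 2 * (num_qt + num_qq * r) -
  num_q * (num_t + num_q * r).
Definition num_defect := num_E * num_det - num_qq * q ^+ 2 * (t - q / r) * num_spray.

End RandersNumbers.

Section TypeOne.
Variables (R : realType) (f g h ft gt ht t r q a b : R).
Hypotheses (a0 : 0 < a) (b0 : 0 < b) (r0 : 0 < r) (q0 : 0 < q).
Hypotheses (aE : a ^+ 2 = f * r + g * q) (bE : b ^+ 2 = h * q).

Let s := q / r.
Let P := f + g * s.
(** Modulo the relations for a^2 and b^2, and up to a nonvanishing factor, the
    defect is a combination of 1 and b/a; this is the coefficient of b/a,
    cleared of its denominator s h. *)
Definition typeI_poly (s : R) := let P := f + g * s in let e := ft + gt * s + g in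
  P ^+ 2 * h + g * P * s * h - ft * P * s * h - f * P * (ht * s + h) / 2 + f * s * h * e / 2 -
  (t - s) * (- g * P * h - g ^+ 2 * s * h + ft * P * h + f * (g * (ht * s + h) - h * e) / 2).

Lemma typeI_det : num_det f g 0 h t r q a b =
  r * (a + b) ^+ 2 * f / a ^+ 2 *
  (f + t * g + h * (s * (f + t * g) + t * P) * r / (2 * a * b)).
Proof.
have fE : f = (a ^+ 2 - g * q) / r by rewrite aE addrK mulfK// gt_eqF.
have hE : h = b ^+ 2 / q by rewrite bE mulfK// gt_eqF.
rewrite /num_det /num_qq /num_r /num_q /dratio /P /s fE hE; field.
by rewrite !gt_eqF.
Qed.

Lemma typeI_defect : num_defect f g 0 h ft gt 0 ht t r q a b =
  r ^+ 2 * (a + b) ^+ 3 * f / a ^+ 3 *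
  ((g + h - ft) * (f + t * g) + b / a * (typeI_poly s / (s * h))).
Proof.
have fE : f = (a ^+ 2 - g * q) / r by rewrite aE addrK mulfK// gt_eqF.
have hE : h = b ^+ 2 / q by rewrite bE mulfK// gt_eqF.
rewrite /num_defect /num_E /num_spray /num_det /num_qq /num_qt /num_t /num_r /num_q.
rewrite /dratio /typeI_poly /P /s fE hE; field.
by rewrite !gt_eqF.
Qed.

End TypeOne.

Lemma zero_at_right (R : realType) (c : R) (u : R -> R) : 0 < c ->
  u s @[s --> 0^'+] --> u 0 -> (forall s, 0 < s -> s < c -> u s = 0) -> u 0 = 0.
Proof.
move=> c0 cu u0; have cst0 : u s @[s --> 0^'+] --> (0 : R).
  apply/cvgrPdist_lt => e e0; near=> s.
  by rewrite u0 ?subrr ?normr0.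
exact: (cvg_unique _ cu cst0).
Unshelve. all: by end_near. Qed.

Lemma horner_right (R : realType) (p : {poly R}) : p.[s] @[s --> 0^'+] --> p.[0].
Proof. by apply: cvg_at_right_filter; exact: continuous_horner. Qed.

(** The ratio b/a is of order sqrt s. Squaring the equation makes both sides
    polynomial in s, and comparing the orders at s = 0 gives C(0) = 0 and g + h
    = ft, two linear equations in g and h. *)
Lemma typeI_limit (R : realType) (f g h ft gt ht t : R) :
  0 < t -> 0 < f -> 0 < h -> 0 < f + t * g ->
  (forall s, 0 < s -> s < t ->
    (g + h - ft) * (f + t * g) +
    Num.sqrt (h * s) / Num.sqrt (f + g * s) *
      (typeI_poly f g h ft gt ht t s / (s * h)) = 0) ->
  g = (t * ft - f) / (2 * t) /\ h = (t * ft + f) / (2 * t).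
Proof.
move=> t0 f0 h0 ftg H; pose C := typeI_poly f g h ft gt ht t.
pose X := (g + h - ft) * (f + t * g).
have sq s : 0 < s -> s < t -> X ^+ 2 * (f + g * s) * (s * h) = C s ^+ 2.
  move=> s0 st; have P0 : 0 < f + g * s.
    have [g0|g0] := leP 0 g; first by apply: ltr_wpDr => //; rewrite mulr_ge0 // ltW.
    by apply: lt_trans ftg _; rewrite ltrD2l mulrC ltr_nM2l.
  have hs0 : 0 < h * s by rewrite mulr_gt0.
  have XE : X = - (Num.sqrt (h * s) / Num.sqrt (f + g * s) * (C s / (s * h))).
    by apply/eqP; rewrite -addr_eq0; apply/eqP; exact: H.
  rewrite XE sqrrN !exprMn !exprVn !sqr_sqrtr ?ltW//.
  by field; rewrite !gt_eqF.
(* C is quadratic, hence given by its values at 0, 1 and -1. *)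
pose c0 := C 0; pose c1 := (C 1 - C (-1)) / 2; pose c2 := (C 1 + C (-1)) / 2 - C 0.
have CE s : C s = c0 + s * (c1 + s * c2).
  by rewrite /c0 /c1 /c2 /C /typeI_poly; field.
(* The squared equation; its value at s = 0 is C(0)^2. *)
pose p1 : {poly R} := (c0%:P + 'X * (c1%:P + 'X * c2%:P)) ^+ 2 -
  (X ^+ 2)%:P * (f%:P + g%:P * 'X) * ('X * h%:P).
have c00 : c0 = 0.
  have E : p1.[0] = 0.
    apply: (zero_at_right t0 (@horner_right _ p1)) => s s0 st.
    transitivity ((c0 + s * (c1 + s * c2)) ^+ 2 - X ^+ 2 * (f + g * s) * (s * h)).
      by rewrite /p1 !hornerE /=; ring.
    by rewrite -CE -sq// subrr.
  have : p1.[0] = c0 ^+ 2 by rewrite /p1 !hornerE /=; ring.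
  by rewrite E => /esym/eqP; rewrite sqrf_eq0 => /eqP.
(* The squared equation divided by s, once C(0) = 0. *)
pose p2 : {poly R} := 'X * (c1%:P + 'X * c2%:P) ^+ 2 -
  (X ^+ 2)%:P * (f%:P + g%:P * 'X) * h%:P.
have X0 : X = 0.
  have E : p2.[0] = 0.
    apply: (zero_at_right t0 (@horner_right _ p2)) => s s0 st.
    apply: (mulfI (lt0r_neq0 s0)); rewrite mulr0 /p2 !hornerE.
    have := sq s s0 st; rewrite CE c00 add0r => sqE.
    transitivity ((s * (c1 + s * c2)) ^+ 2 - X ^+ 2 * (f + g * s) * (s * h)).
      by rewrite /=; ring.
    by rewrite sqE subrr.
  have : p2.[0] = - (X ^+ 2 * (f * h)) by rewrite /p2 !hornerE /=; ring.
  have fh0 : f * h != 0 by rewrite gt_eqF// mulr_gt0.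
  rewrite E => /esym/eqP; rewrite oppr_eq0 mulf_eq0 (negPf fh0) orbF.
  by rewrite sqrf_eq0 => /eqP.
have e1 : g + h = ft.
  by move/eqP: X0; rewrite mulf_eq0 (gt_eqF ftg) orbF subr_eq0 => /eqP.
have e2 : f + 2 * t * g - t * ft = 0.
  have : f * h * (f + 2 * t * g - t * ft) = 0.
    transitivity (2 * c0); last by rewrite c00 mulr0.
    by rewrite /c0 /C /typeI_poly; field.
  by move/eqP; rewrite !mulf_eq0 (gt_eqF h0) (gt_eqF f0) => /eqP.
have gE : g = (t * ft - f) / (2 * t).
  by rewrite (_ : t * ft - f = g * (2 * t)) ?mulfK ?mulf_neq0 ?gt_eqF//; lra.
split=> //; have -> : h = ft - g by rewrite -e1 addrC addKr.
by rewrite {1}gE; field; rewrite gt_eqF.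
Qed.

(** Here f1 and f2 stand for f' and f'', and the two arguments before t are the
    derivatives of the formulas for g and h. *)
Lemma typeI_solution (R : realType) (f f1 f2 t s : R) : 0 < t ->
  typeI_poly f ((t * f1 - f) / (2 * t)) ((t * f1 + f) / (2 * t)) f1
    ((f2 - f1 / t + f / t ^+ 2) / 2) ((f2 + f1 / t - f / t ^+ 2) / 2) t s = 0.
Proof. by move=> t0; rewrite /typeI_poly; field; rewrite gt_eqF. Qed.

Section TypeTwo.
Variables (R : realType) (f g h ft gt ht t : R).
Hypotheses (t0 : 0 < t) (f0 : 0 < f) (h0 : 0 < h) (ftg : 0 < f + t * g).

Let k := h * t.
Let kt := ht * t + h.

(** The difference quotient at s = 0 of num_E along b^2 = h (t - s), written so
    as to make sense at s = 0; a0 and b0 are the values of a and b there. *)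
Definition typeII_slope (s a b a0 b0 : R) :=
  g * dratio a b (ft + gt * s + g) (ht * (t - s)) -
  h * dratio b a (ht * (t - s)) (ft + gt * s + g) +
  (g - ft) * ((- h * a0 / (b + b0) - b0 * g / (a + a0)) / (a * a0)) -
  (2 * h + ht * t) * ((g * b0 / (a + a0) + h * a0 / (b + b0)) / (b * b0)).

Lemma typeII_E s a b a0 b0 : 0 < a -> 0 < b -> 0 < a0 -> 0 < b0 ->
  a ^+ 2 = f + g * s -> b ^+ 2 = h * (t - s) -> a0 ^+ 2 = f -> b0 ^+ 2 = h * t ->
  num_E g (- h) ft gt kt (- ht) 1 s a b =
  num_E g (- h) ft gt kt (- ht) 1 0 a0 b0 + s * typeII_slope s a b a0 b0.
Proof.
move=> ap bp a0p b0p aE bE a0E b0E.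
have ratio1 : b / a = b0 / a0 + s * ((- h * a0 / (b + b0) - b0 * g / (a + a0)) / (a * a0)).
  have hs : h * s = b0 ^+ 2 - b ^+ 2 by rewrite bE b0E; ring.
  have gs : g * s = a ^+ 2 - a0 ^+ 2 by rewrite aE a0E; ring.
  transitivity (b0 / a0 + ((- (h * s) * a0 / (b + b0) - b0 * (g * s) / (a + a0)) / (a * a0))).
    by rewrite hs gs; field; rewrite !gt_eqF ?addr_gt0.
  by field; rewrite !gt_eqF ?addr_gt0.
have ratio2 : a / b = a0 / b0 + s * ((g * b0 / (a + a0) + h * a0 / (b + b0)) / (b * b0)).
  have hs : h * s = b0 ^+ 2 - b ^+ 2 by rewrite bE b0E; ring.
  have gs : g * s = a ^+ 2 - a0 ^+ 2 by rewrite aE a0E; ring.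
  transitivity (a0 / b0 + ((g * s) * b0 / (a + a0) + (h * s) * a0 / (b + b0)) / (b * b0)).
    by rewrite hs gs; field; rewrite !gt_eqF ?addr_gt0.
  by field; rewrite !gt_eqF ?addr_gt0.
rewrite /num_E /num_qt /num_qq /num_q /num_t /typeII_slope.
transitivity (s * (g * dratio a b (ft + gt * s + g) (ht * (t - s)) -
    h * dratio b a (ht * (t - s)) (ft + gt * s + g)) +
    (1 + b / a) * (g - ft) - (1 + a / b) * (2 * h + ht * t)).
  by rewrite /dratio /k /kt; field; rewrite !gt_eqF.
by rewrite ratio1 ratio2 /kt; ring.
Qed.

Lemma typeII_det0 a b : 0 < a -> 0 < b -> a ^+ 2 = f -> b ^+ 2 = h * t ->
  0 < num_det f g k (- h) t 1 0 a b.
Proof.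
move=> ap bp aE bE.
have -> : num_det f g k (- h) t 1 0 a b =
    ((1 + b / a) * f + (1 + a / b) * k) * (f + t * g) * (1 + b / a).
  have hE : h = b ^+ 2 / t by rewrite bE mulfK// gt_eqF.
  rewrite /num_det /num_r /num_q /k -aE hE; field; by rewrite !gt_eqF.
have k0 : 0 < k by rewrite mulr_gt0.
have c1 : 0 < 1 + b / a by rewrite addr_gt0// divr_gt0.
have c2 : 0 < 1 + a / b by rewrite addr_gt0// divr_gt0.
by rewrite !mulr_gt0// addr_gt0// mulr_gt0.
Qed.

(** The value is a negative multiple of the square of h (f + t g). *)
Lemma typeII_slope0 a b : 0 < a -> 0 < b -> a ^+ 2 = f -> b ^+ 2 = h * t ->
  typeII_slope 0 a b a b != 0.
Proof.
move=> ap bp aE bE.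
have -> : typeII_slope 0 a b a b = - (h * (f + t * g)) ^+ 2 / (a * b) ^+ 3.
  have hE : h = b ^+ 2 / t by rewrite bE mulfK// gt_eqF.
  rewrite /typeII_slope /dratio -aE hE; field.
  by rewrite !gt_eqF ?addr_gt0.
by rewrite mulNr oppr_eq0 mulf_neq0 ?invr_eq0 ?expf_neq0 ?mulf_neq0 ?gt_eqF.
Qed.

End TypeTwo.

Section RightLimits.
Variable R : realType.
Implicit Types (u w : R -> R) (c d : R).

Definition rlim u c := u s @[s --> 0^'+] --> c.

Lemma rlim_cst c : rlim (fun=> c) c.
Proof. exact: cvg_cst. Qed.

Lemma rlim_id : rlim id 0.
Proof. by apply: cvg_at_right_filter; exact: cvg_id. Qed.

Lemma rlimD u w c d : rlim u c -> rlim w d -> rlim (fun s => u s + w s) (c + d).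
Proof. exact: cvgD. Qed.

Lemma rlimN u c : rlim u c -> rlim (fun s => - u s) (- c).
Proof. exact: cvgN. Qed.

Lemma rlimM u w c d : rlim u c -> rlim w d -> rlim (fun s => u s * w s) (c * d).
Proof. exact: cvgM. Qed.

Lemma rlimX u c m : rlim u c -> rlim (fun s => u s ^+ m) (c ^+ m).
Proof.
move=> uc; elim: m => [|m IH]; first exact: rlim_cst.
by under eq_fun do rewrite exprS; rewrite exprS; exact: rlimM.
Qed.

Lemma rlimV u c : c != 0 -> rlim u c -> rlim (fun s => (u s)^-1) c^-1.
Proof. exact: cvgV. Qed.

Lemma rlim_sqrt u c : rlim u c -> rlim (fun s => Num.sqrt (u s)) (Num.sqrt c).
Proof. by move=> uc; apply: (continuous_cvg _ _ uc); exact: sqrt_continuous. Qed.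

End RightLimits.

Section RightLimitsOfNumbers.
Variables (R : realType) (a b x y : R -> R) (a0 b0 x0 y0 : R).
Hypotheses (a0_neq0 : a0 != 0) (b0_neq0 : b0 != 0).
Hypotheses (ca : rlim a a0) (cb : rlim b b0) (cx : rlim x x0) (cy : rlim y y0).

Lemma rlim_dratio : rlim (fun s => dratio (a s) (b s) (x s) (y s)) (dratio a0 b0 x0 y0).
Proof.
have cab : rlim (fun s => (2 * (a s * b s))^-1) (2 * (a0 * b0))^-1.
  apply: rlimV; first by rewrite !mulf_neq0 ?pnatr_eq0.
  by apply: rlimM; [exact: rlim_cst|exact: rlimM].
have ca3 : rlim (fun s => (2 * a s ^+ 3)^-1) (2 * a0 ^+ 3)^-1.
  apply: rlimV; first by rewrite mulf_neq0 ?expf_neq0 ?pnatr_eq0.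
  by apply: rlimM; [exact: rlim_cst|exact: rlimX].
by apply: rlimD; [exact: rlimM|apply: rlimN; apply: rlimM => //; exact: rlimM].
Qed.

Lemma rlim_ratio : rlim (fun s => 1 + b s * (a s)^-1) (1 + b0 * a0^-1).
Proof.
apply: rlimD; first exact: rlim_cst.
by apply: rlimM => //; exact: rlimV.
Qed.

End RightLimitsOfNumbers.

Section TypeTwoLimit.
Variables (R : realType) (f g h ft gt ht t : R) (a b : R -> R) (a0 b0 : R).
Hypotheses (a0_gt0 : 0 < a0) (b0_gt0 : 0 < b0) (ca : rlim a a0) (cb : rlim b b0).

Let A s := 1 + b s * (a s)^-1.
Let B s := 1 + a s * (b s)^-1.
Let cA : rlim A (1 + b0 * a0^-1).
Proof. by apply: rlim_ratio; rewrite ?gt_eqF. Qed.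
Let cB : rlim B (1 + a0 * b0^-1).
Proof. by apply: rlim_ratio; rewrite ?gt_eqF. Qed.

Let affine (c d : R) : rlim (fun s => c + d * s) (c + d * 0).
Proof. by apply: rlimD; [exact: rlim_cst|apply: rlimM; [exact: rlim_cst|exact: rlim_id]]. Qed.

Let dA (x y : R -> R) x0 y0 : rlim x x0 -> rlim y y0 ->
  rlim (fun s => dratio (a s) (b s) (x s) (y s)) (dratio a0 b0 x0 y0).
Proof. by move=> cx cy; apply: rlim_dratio; rewrite ?gt_eqF. Qed.

Let dB (x y : R -> R) x0 y0 : rlim x x0 -> rlim y y0 ->
  rlim (fun s => dratio (b s) (a s) (x s) (y s)) (dratio b0 a0 x0 y0).
Proof. by move=> cx cy; apply: rlim_dratio; rewrite ?gt_eqF. Qed.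

Lemma rlim_typeII_slope :
  rlim (fun s => typeII_slope g h ft gt ht t s (a s) (b s) a0 b0)
    (typeII_slope g h ft gt ht t 0 a0 b0 a0 b0).
Proof.
have cx : rlim (fun s => ft + gt * s + g) (ft + gt * 0 + g).
  by apply: rlimD; [exact: affine|exact: rlim_cst].
have cy : rlim (fun s => ht * (t - s)) (ht * (t - 0)).
  apply: rlimM; first exact: rlim_cst.
  by apply: rlimD; [exact: rlim_cst|exact/rlimN/rlim_id].
have cb' (c : R) : rlim (fun s => c / (b s + b0)) (c / (b0 + b0)).
  apply: rlimM; first exact: rlim_cst.
  by apply: rlimV; [rewrite gt_eqF ?addr_gt0|apply: rlimD => //; exact: rlim_cst].
have ca' (c : R) : rlim (fun s => c / (a s + a0)) (c / (a0 + a0)).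
  apply: rlimM; first exact: rlim_cst.
  by apply: rlimV; [rewrite gt_eqF ?addr_gt0|apply: rlimD => //; exact: rlim_cst].
have va : rlim (fun s => (a s * a0)^-1) (a0 * a0)^-1.
  by apply: rlimV; [rewrite gt_eqF ?mulr_gt0|apply: rlimM => //; exact: rlim_cst].
have vb : rlim (fun s => (b s * b0)^-1) (b0 * b0)^-1.
  by apply: rlimV; [rewrite gt_eqF ?mulr_gt0|apply: rlimM => //; exact: rlim_cst].
apply: rlimD; [apply: rlimD; [apply: rlimD|]|apply: rlimN].
- by apply: rlimM; [exact: rlim_cst|exact: dA].
- by apply: rlimN; apply: rlimM; [exact: rlim_cst|exact: dB].
- apply: rlimM; first exact: rlim_cst.
  by apply: rlimM => //; apply: rlimD => //; exact: rlimN.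
- apply: rlimM; first exact: rlim_cst.
  by apply: rlimM => //; exact: rlimD.
Qed.

Variables (k l kt lt : R).

Lemma rlim_num_r : rlim (fun s => num_r f k (a s) (b s)) (num_r f k a0 b0).
Proof. by apply: rlimD; apply: rlimM => //; exact: rlim_cst. Qed.

Lemma rlim_num_q : rlim (fun s => num_q g l (a s) (b s)) (num_q g l a0 b0).
Proof. by apply: rlimD; apply: rlimM => //; exact: rlim_cst. Qed.

Lemma rlim_num_t : rlim (fun s => num_t ft gt kt lt 1 s (a s) (b s))
  (num_t ft gt kt lt 1 0 a0 b0).
Proof. by apply: rlimD; apply: rlimM => //; exact: affine. Qed.

Lemma rlim_num_qq : rlim (fun s => num_qq g l (a s) (b s)) (num_qq g l a0 b0).
Proof.
apply: rlimD; (apply: rlimM; first exact: rlim_cst).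
  by apply: dA; exact: rlim_cst.
by apply: dB; exact: rlim_cst.
Qed.

Lemma rlim_num_qt : rlim (fun s => num_qt g l ft gt kt lt 1 s (a s) (b s))
  (num_qt g l ft gt kt lt 1 0 a0 b0).
Proof.
apply: rlimD; [apply: rlimD; [apply: rlimD|]|].
- by apply: rlimM; [exact: rlim_cst|apply: dA; exact: affine].
- by apply: rlimM; [exact: rlim_cst|apply: dB; exact: affine].
- by apply: rlimM => //; exact: rlim_cst.
- by apply: rlimM => //; exact: rlim_cst.
Qed.

Let cab2 : rlim (fun s => (a s + b s) ^+ 2) ((a0 + b0) ^+ 2).
Proof. by apply: rlimX; exact: rlimD. Qed.

Lemma rlim_num_det : rlim (fun s => num_det f g k l t 1 s (a s) (b s))
  (num_det f g k l t 1 0 a0 b0).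
Proof.
have [[cr cq] cqq] := (rlim_num_r, rlim_num_q, rlim_num_qq).
apply: rlimD; first exact: rlimM.
apply: rlimM.
  apply: rlimD; first exact: rlim_cst.
  by apply: rlimN; apply: rlimM; [exact: rlim_id|exact: rlim_cst].
apply: rlimD; last by apply: rlimM => //; apply: rlimM => //; exact: rlim_id.
by apply: rlimM => //; apply: rlimM => //; exact: rlim_cst.
Qed.

Lemma rlim_num_spray : rlim (fun s => num_spray g l ft gt kt lt 1 s (a s) (b s))
  (num_spray g l ft gt kt lt 1 0 a0 b0).
Proof.
have [cq ct] := (rlim_num_q, rlim_num_t).
have [cqq cqt] := (rlim_num_qq, rlim_num_qt).
apply: rlimD.
  by apply: rlimM => //; apply: rlimD => //; apply: rlimM => //; exact: rlim_cst.
apply: rlimN; apply: rlimM => //; apply: rlimD => //.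
by apply: rlimM => //; exact: rlim_cst.
Qed.

End TypeTwoLimit.

(** At s = 0 the condition reads num_E = 0. The other term of the defect carries
    the factor q^2 = s^2, so num_E vanishes to second order at s = 0, against
    [typeII_slope0]. *)
Lemma typeII_absurd (R : realType) (f g h ft gt ht t e : R) :
  0 < t -> 0 < f -> 0 < h -> 0 < f + t * g -> 0 < e ->
  (forall s, 0 < f + g * s -> 0 < h * (t - s) -> 0 <= s -> s < e ->
    num_det f g (h * t) (- h) t 1 s (Num.sqrt (f + g * s)) (Num.sqrt (h * (t - s))) != 0 ->
    num_defect f g (h * t) (- h) ft gt (ht * t + h) (- ht) t 1 s
      (Num.sqrt (f + g * s)) (Num.sqrt (h * (t - s))) = 0) -> False.
Proof.
move=> t0 f0 h0 ftg e0 H.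
pose a s := Num.sqrt (f + g * s); pose b s := Num.sqrt (h * (t - s)).
have pos s : 0 <= s -> s < t -> 0 < f + g * s /\ 0 < h * (t - s).
  move=> s0 st; split; last by rewrite mulr_gt0// subr_gt0.
  have [g0|g0] := leP 0 g; first by apply: ltr_wpDr => //; rewrite mulr_ge0.
  by apply: lt_trans ftg _; rewrite ltrD2l mulrC ltr_nM2l.
have [Pa Pb] := pos 0 (lexx 0) t0.
have a0 : 0 < a 0 by rewrite sqrtr_gt0.
have b0 : 0 < b 0 by rewrite sqrtr_gt0.
have aE : a 0 ^+ 2 = f by rewrite sqr_sqrtr ?ltW// mulr0 addr0.
have bE : b 0 ^+ 2 = h * t by rewrite sqr_sqrtr ?ltW// subr0.
have det0 := typeII_det0 t0 f0 h0 ftg a0 b0 aE bE.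
have E0 : num_E g (- h) ft gt (ht * t + h) (- ht) 1 0 (a 0) (b 0) = 0.
  apply: (mulIf (lt0r_neq0 det0)); rewrite mul0r -[RHS](H 0 Pa Pb (lexx 0) e0) ?gt_eqF//.
  by rewrite /num_defect; ring.
(* The defect divided by s. *)
pose u s := typeII_slope g h ft gt ht t s (a s) (b s) (a 0) (b 0) *
    num_det f g (h * t) (- h) t 1 s (a s) (b s) -
  num_qq g (- h) (a s) (b s) * s * (t - s) *
    num_spray g (- h) ft gt (ht * t + h) (- ht) 1 s (a s) (b s).
have ca : rlim a (a 0).
  apply: rlim_sqrt; apply: rlimD; first exact: rlim_cst.
  by apply: rlimM; [exact: rlim_cst|exact: rlim_id].
have cb : rlim b (b 0).
  apply: rlim_sqrt; apply: rlimM; first exact: rlim_cst.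
  by apply: rlimD; [exact: rlim_cst|exact/rlimN/rlim_id].
have cu : rlim u (u 0).
  apply: rlimD.
    by apply: rlimM; [exact: rlim_typeII_slope|exact: rlim_num_det].
  apply: rlimN; apply: rlimM; last exact: rlim_num_spray.
  apply: rlimM; last by apply: rlimD; [exact: rlim_cst|exact/rlimN/rlim_id].
  by apply: rlimM; [exact: rlim_num_qq|exact: rlim_id].
have cdet : rlim (fun s => num_det f g (h * t) (- h) t 1 s (a s) (b s))
    (num_det f g (h * t) (- h) t 1 0 (a 0) (b 0)) by exact: rlim_num_det.
have [d d0 dP] : exists2 d, 0 < d & forall s, 0 < s -> s < d ->
    0 < num_det f g (h * t) (- h) t 1 s (a s) (b s).
  have /cvgrPdist_lt /(_ _ det0) := cdet; case/nbhs_ballP => d /= d0 dP.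
  exists d => // s s0 sd; have := dP s; rewrite /ball /= sub0r normrN gtr0_norm//.
  move=> /(_ sd s0); rewrite ltr_distlC subrr => /andP[].
  by [].
have u0 : u 0 = 0.
  apply: (zero_at_right (c := Num.min d (Num.min e t))) cu _.
    by rewrite !lt_min d0 e0 t0.
  move=> s s0; rewrite !lt_min => /and3P[sd se st].
  have [Ps Qs] := pos s (ltW s0) st.
  have as0 : 0 < a s by rewrite sqrtr_gt0.
  have bs0 : 0 < b s by rewrite sqrtr_gt0.
  have asE : a s ^+ 2 = f + g * s by rewrite sqr_sqrtr ?ltW.
  have bsE : b s ^+ 2 = h * (t - s) by rewrite sqr_sqrtr ?ltW.
  have := H s Ps Qs (ltW s0) se (lt0r_neq0 (dP s s0 sd)).
  rewrite /num_defect (typeII_E _ _ _ as0 bs0 a0 b0 asE bsE aE bE) E0 add0r => D.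
  by apply: (mulfI (lt0r_neq0 s0)); rewrite mulr0 -[RHS]D /u divr1; ring.
move: u0; rewrite /u mulr0 !mul0r subr0 => /eqP; rewrite mulf_eq0 (gt_eqF det0) orbF.
by rewrite (negPf (typeII_slope0 _ _ _ t0 h0 ftg a0 b0 aE bE)).
Qed.

(** * The condition at a point for the two types of metrics *)

Definition weakly_kahler_at (R : realType) (n : nat) (F : T10 R n -> R)
    (z v : 'cV[R[i]]_n) : Prop := forall b,
  \sum_(a < n) \sum_(c < n) G_v F a (z, v) * Gamma F a b c (z, v) * v c 0 =
  \sum_(a < n) \sum_(c < n) G_v F a (z, v) * Gamma F a c b (z, v) * v c 0.

Section Bridge.
Variables (R : realType) (n : nat) (F : T10 R n -> R) (I : set R).
Variables (z v : 'cV[R[i]]_n) (f g k l f' g' k' l' : R -> R).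
Local Notation t := (sqnorm z).
Local Notation r := (sqnorm v).
Local Notation q := (qfun (z, v)).
Let p : T10 R n := (z, v).
Hypothesis smoothF : smooth_at (fun q => F q ^+ 2) p.
Hypothesis v0 : v != 0.
Hypothesis Ip : \forall q \near p, I (sqnorm q.1).
Hypothesis dw_p : \forall q \near p,
  [/\ is_dw I f (sqnorm q.1) (f' (sqnorm q.1)),
      is_dw I g (sqnorm q.1) (g' (sqnorm q.1)),
      is_dw I k (sqnorm q.1) (k' (sqnorm q.1)) &
      is_dw I l (sqnorm q.1) (l' (sqnorm q.1))].
Hypothesis F_p : \forall q \near p,
  [/\ 0 < rform f g q, 0 < rform k l q &
      F q ^+ 2 = (Num.sqrt (rform f g q) + Num.sqrt (rform k l q)) ^+ 2].
Let a := Num.sqrt (f t * r + g t * q).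
Let b := Num.sqrt (k t * r + l t * q).

Lemma weakly_kahler_num :
  num_r (f t) (k t) a b != 0 -> num_det (f t) (g t) (k t) (l t) t r q a b != 0 ->
  weakly_kahler_at F z v <->
  (t = q / r \/ num_defect (f t) (g t) (k t) (l t) (f' t) (g' t) (k' t) (l' t) t r q a b = 0).
Proof.
have [_ _ FE] := nbhs_singleton F_p.
have detE : levi_det F z v (jetr f g k l) (jetq f g k l) (jetqq z v f g k l) =
    num_det (f t) (g t) (k t) (l t) t r q a b.
  by rewrite /levi_det FE.
have sprayE : spray_num F z v (jett f g k l f' g' k' l') (jetq f g k l)
     (jetqt z v f g k l f' g' k' l') (jetqq z v f g k l) =
    num_spray (g t) (l t) (f' t) (g' t) (k' t) (l' t) r q a b.
  by rewrite /spray_num FE.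
move=> Kr0 det0; rewrite -detE in det0.
apply: iff_trans (randers_scalar smoothF v0 Ip dw_p F_p Kr0 det0) _.
rewrite detE sprayE.
split; (case=> [|E]; [by left|right]).
  by apply/eqP; rewrite /num_defect subr_eq0; apply/eqP; exact: E.
by move/eqP: E; rewrite /num_defect subr_eq0 => /eqP E; exact: E.
Qed.

End Bridge.

Section TwoTypes.
Variables (R : realType) (n : nat) (F : T10 R n -> R) (I : set R).
Variables (z v : 'cV[R[i]]_n) (f g f' g' : R -> R).
Local Notation t := (sqnorm z).
Local Notation r := (sqnorm v).
Local Notation q := (qfun (z, v)).
Let p : T10 R n := (z, v).
Hypothesis smoothF : smooth_at (fun q => F q ^+ 2) p.
Hypothesis v0 : v != 0.
Hypothesis Ip : \forall q \near p, I (sqnorm q.1).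
Hypothesis dw_fg : \forall q \near p,
  is_dw I f (sqnorm q.1) (f' (sqnorm q.1)) /\ is_dw I g (sqnorm q.1) (g' (sqnorm q.1)).
Hypotheses (f0 : 0 < f t) (ftg : 0 < f t + t * g t).

(** The second derivative in q vanishes, and the scalar condition is (g - f') r
    = 0. *)
Lemma weakly_kahler_hermitian : (\forall q \near p, F q ^+ 2 = rform f g q) ->
  0 < rform f g p -> weakly_kahler_at F z v <-> (t = q / r \/ g t = f' t).
Proof.
move=> Fp K0; have r0 : 0 < r by rewrite sqnorm_gt0.
have dF : \forall q \near p, trq (fun q => F q ^+ 2) q (rform f' g' q)
    (f (sqnorm q.1)) (g (sqnorm q.1)).
  have Ip2 := near_join Ip; have Fp2 := near_join Fp.
  near=> q'.
  have Iq : \forall q \near q', I (sqnorm q.1) by near: q'.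
  have Fq : \forall q \near q', F q ^+ 2 = rform f g q by near: q'.
  have [df dg] : is_dw I f (sqnorm q'.1) (f' (sqnorm q'.1)) /\
    is_dw I g (sqnorm q'.1) (g' (sqnorm q'.1)) by near: q'.
  apply: trq_near (trq_rform Iq df dg) _.
  by apply: filterS Fq => q ->.
have [df dg] := nbhs_singleton dw_fg.
have dKr : trq (fun q : T10 R n => f (sqnorm q.1)) p (f' t) 0 0.
  by apply: trq_eq (trq_dw (trq_t p) df Ip) _ _ _; rewrite ?mulr1 ?mulr0.
have dKq : trq (fun q : T10 R n => g (sqnorm q.1)) p (g' t) 0 0.
  by apply: trq_eq (trq_dw (trq_t p) dg Ip) _ _ _; rewrite ?mulr1 ?mulr0.
have FE := nbhs_singleton Fp.
have detE : levi_det F z v (fun q : T10 R n => f (sqnorm q.1))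
    (fun q : T10 R n => g (sqnorm q.1)) 0 = f t * r * (f t + t * g t).
  by rewrite /levi_det FE /rform /=; field; rewrite gt_eqF.
have det0 : f t * r * (f t + t * g t) != 0 by rewrite gt_eqF// !mulr_gt0.
have H := weakly_kahler_scalar smoothF dF _ dKr dKq.
apply: iff_trans (H _ _ _ _ v0 _ _ _) _.
- by apply: filterS Fp => q' ->; rewrite /rform; ring.
- by rewrite !mulr0 addr0.
- by rewrite !mulr0 addr0.
- by rewrite /rform /=; ring.
- by rewrite FE gt_eqF.
- by rewrite gt_eqF.
- by rewrite detE.
rewrite detE /geodesic_defect !mul0r /rform /=.
set E1 := (X in X * _ = 0); have -> : E1 = (g t - f' t) * r by rewrite /E1; ring.
split; (case=> [|E]; [by left|right]); last by rewrite E subrr !mul0r.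
move/eqP: E; rewrite mulf_eq0 (negPf det0) orbF mulf_eq0 (gt_eqF r0) orbF subr_eq0.
by move/eqP.
Unshelve. all: by end_near. Qed.

Variables h h' : R -> R.
Hypothesis dw_h : \forall q \near p, is_dw I h (sqnorm q.1) (h' (sqnorm q.1)).

(** Here |beta|^2 = h q: the 1-form is a multiple of <v, z>. *)
Lemma weakly_kahler_typeI : (\forall q \near p, [/\ 0 < rform f g q, 0 < h (sqnorm q.1) * qfun q &
   F q ^+ 2 = (Num.sqrt (rform f g q) + Num.sqrt (h (sqnorm q.1) * qfun q)) ^+ 2]) ->
  weakly_kahler_at F z v <-> (t = q / r \/
    (g t + h t - f' t) * (f t + t * g t) +
    Num.sqrt (h t * q) / Num.sqrt (f t * r + g t * q) *
      (typeI_poly (f t) (g t) (h t) (f' t) (g' t) (h' t) t (q / r) / (q / r * h t)) = 0).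
Proof.
move=> Fp; have r0 : 0 < r by rewrite sqnorm_gt0.
have [P0 Q0 _] := nbhs_singleton Fp; rewrite /rform /= in P0 Q0.
have q0 : 0 < q.
  by rewrite lt_def qfun_ge0 andbT; move: Q0; apply: contraTneq => ->; rewrite mulr0 ltxx.
have h0 : 0 < h t by rewrite -(pmulr_lgt0 _ q0).
have t0 : 0 < t.
  rewrite lt_def sqnorm_ge0 andbT sqnorm_eq0; move: q0; apply: contraTneq => z0.
  have qt := qfun_le p; have t00 : t = 0 by rewrite z0; apply/eqP; rewrite sqnorm_eq0.
  by rewrite -leNgt; move: qt; rewrite /= t00 mul0r.
pose a := Num.sqrt (f t * r + g t * q); pose b := Num.sqrt (h t * q).
have a0 : 0 < a by rewrite sqrtr_gt0.
have b0 : 0 < b by rewrite sqrtr_gt0.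
have aE : a ^+ 2 = f t * r + g t * q by rewrite sqr_sqrtr// ltW.
have bE : b ^+ 2 = h t * q by rewrite sqr_sqrtr// ltW.
have s0 : 0 < q / r by rewrite divr_gt0.
have Ps : 0 < f t + g t * (q / r).
  rewrite -(pmulr_lgt0 _ r0) mulrDl [g t * _]mulrA divfK ?gt_eqF//.
have := @weakly_kahler_num R n F I z v f g (fun=> 0) h f' g' (fun=> 0) h' smoothF v0 Ip.
rewrite mul0r add0r -/a -/b => H; apply: iff_trans (H _ _ _ _) _.
- apply: filterS2 dw_fg dw_h => q' [? ?] ?; split => //.
  exact: is_derive_dw (is_derive_cst _ _ _).
- have rE q' : rform (fun=> 0) h q' = h (sqnorm q'.1) * qfun q' by rewrite /rform mul0r add0r.
  by apply: filterS Fp => q' [? ? E]; rewrite rE.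
- rewrite /num_r mulr0 addr0 gt_eqF// mulr_gt0// addr_gt0// divr_gt0//.
- rewrite (typeI_det t a0 b0 r0 q0 aE bE) gt_eqF//.
  apply: mulr_gt0; first by rewrite divr_gt0 ?exprn_gt0// mulr_gt0// mulr_gt0// exprn_gt0// addr_gt0.
  apply: addr_gt0 => //; rewrite divr_gt0 ?mulr_gt0// addr_gt0// mulr_gt0//.
rewrite (typeI_defect _ _ _ _ a0 b0 r0 q0 aE bE).
split; (case=> [|E]; [by left|right]); last by rewrite E mulr0.
move/eqP: E; rewrite mulf_eq0 gt_eqF/=; first by move/eqP.
by rewrite divr_gt0 ?exprn_gt0// mulr_gt0// mulr_gt0 ?exprn_gt0// addr_gt0.
Qed.

End TwoTypes.

(** * Hadamard's lemma and the substitution t = x^2 *)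

Section SmoothOneVariable.
Variable R : realType.
Implicit Types (J : set R) (k g m : R -> R) (x c e : R).

(** Smoothness witnessed by a sequence of successive derivatives, which can be
    written down where an iterated operator would have to be computed. *)
Definition smooth1 J k := exists2 K : nat -> R -> R, K 0%N = k &
  forall j x, J x -> is_derive x 1 (K j) (K j.+1 x).

Lemma derive_near_eq g m x c : is_derive x 1 g c -> (\forall y \near x, g y = m y) ->
  is_derive x 1 m c.
Proof. by move=> dg gm; exact: near_eq_is_derive gm dg. Qed.

(** The mean value inequality between 0 and x. *)
Lemma small_primitive (e eps : R) (j : nat) (u du : R -> R) x :
  (forall y : R, `|y| < e -> is_derive y 1 u (du y)) -> u 0 = 0 ->
  (forall y : R, `|y| < e -> `|du y| <= eps * `|y| ^+ j) -> `|x| < e ->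
  `|u x| <= eps * `|x| ^+ j.+1.
Proof.
move=> Du u0 Bu xe; have e0 : 0 < e by exact: le_lt_trans (normr_ge0 x) xe.
have cont y : `|y| < e -> {for y, continuous u}.
  move=> ye; apply: differentiable_continuous; apply/derivable1_diffP.
  by have [] := Du y ye.
have bound c : `|c| <= `|x| -> `|du c * x| <= eps * `|x| ^+ j.+1.
  move=> cx; rewrite normrM exprSr mulrA ler_wpM2r//.
  apply: le_trans (Bu c (le_lt_trans cx xe)) _.
  have eps0 : 0 <= eps * `|c| ^+ j by apply: le_trans (normr_ge0 _) (Bu c (le_lt_trans cx xe)).
  have [->|x0] := eqVneq j 0%N; first by rewrite !expr0.
  have [c0|c0] := eqVneq c 0.
    have := Bu x xe; have := normr_ge0 (du x); move=> h1 h2.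
    rewrite c0 normr0 expr0n (negPf x0) mulr0; exact: le_trans h1 h2.
  have epsp : 0 <= eps by move: eps0; rewrite pmulr_lge0// exprn_gt0// normr_gt0.
  by apply: ler_wpM2l => //; rewrite lerXn2r ?nnegrE.
have [xlt|xgt|->] := ltgtP x 0; last first.
- by rewrite u0 normr0 expr0n mulr0.
- have [||c] := @MVT R u du 0 x xgt.
  + move=> y; rewrite in_itv/= => /andP[y0 yx]; apply: Du.
    by rewrite gtr0_norm// (lt_trans yx)// -(gtr0_norm xgt).
  + apply: continuous_in_subspaceT => y; rewrite inE/= in_itv/= => /andP[y0 yx].
    by apply: cont; rewrite ger0_norm// (le_lt_trans yx)// -(gtr0_norm xgt).
  rewrite in_itv/= => /andP[c0 cx]; rewrite u0 !subr0 => ->.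
  by apply: bound; rewrite !gtr0_norm// ltW.
- have [||c] := @MVT R u du x 0 xlt.
  + move=> y; rewrite in_itv/= => /andP[yx y0]; apply: Du.
    by rewrite ltr0_norm// (le_lt_trans _ xe)// ltr0_norm// lerN2 ltW.
  + apply: continuous_in_subspaceT => y; rewrite inE/= in_itv/= => /andP[yx y0].
    by apply: cont; rewrite ler0_norm// (le_lt_trans _ xe)// ltr0_norm// lerN2.
  rewrite in_itv/= => /andP[xc c0]; rewrite u0 !sub0r => ux.
  have -> : u x = du c * x by rewrite -[u x]opprK ux mulrN opprK.
  by apply: bound; rewrite !ltr0_norm// lerN2 ltW.
Qed.

(** The mean value theorem: if the derivative off 0 has a limit at 0, that limit
    is the derivative at 0. *)
Lemma derive_extend (e : R) (u du : R -> R) : 0 < e ->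
  (forall y : R, `|y| < e -> y != 0 -> is_derive y 1 u (du y)) ->
  {for 0, continuous u} -> {for 0, continuous du} ->
  is_derive (0 : R) 1 u (du 0).
Proof.
move=> e0 Du cu cdu; apply/is_derive1_caratheodory.
exists (fun y => if y == 0 then du 0 else (u y - u 0) / y); split.
- move=> y; rewrite subr0; case: eqP => [->|/eqP y0]; first by rewrite subrr mulr0.
  by rewrite divfK.
- rewrite /prop_for /continuous_at eqxx; apply/cvgrPdist_le => eps eps0.
  have /cvgrPdist_le /(_ eps eps0) [d /= d0 dE] := cdu.
  have d'0 : 0 < Num.min d e by rewrite lt_min d0 e0.
  exists (Num.min d e) => // y; rewrite /= sub0r normrN lt_min => /andP[yd ye].
  case: eqP => [_|/eqP y0]; first by rewrite subrr normr0 ltW.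
  have cont x : `|x| < e -> {for x, continuous u}.
    have [->//|x0 xe] := eqVneq x 0.
    apply: differentiable_continuous; apply/derivable1_diffP.
    by have [] := Du x xe x0.
  suff [c cy ->] : exists2 c, `|c| < d & (u y - u 0) / y = du c.
    by apply: dE; rewrite /= sub0r normrN.
  have [ylt|ygt|yE] := ltgtP y 0; last by rewrite yE eqxx in y0.
  + have [||c] := @MVT R u du y 0 ylt.
    * move=> x; rewrite in_itv/= => /andP[xy x0]; apply: Du; last by rewrite lt_eqF.
      by rewrite ltr0_norm// (le_lt_trans _ ye)// ltr0_norm// lerN2 ltW.
    * apply: continuous_in_subspaceT => x; rewrite inE/= in_itv/= => /andP[yx x0].
      by apply: cont; rewrite ler0_norm// (le_lt_trans _ ye)// ltr0_norm// lerN2.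
    rewrite in_itv/= => /andP[yc c0] uE; exists c.
      by rewrite ltr0_norm// (le_lt_trans _ yd)// ltr0_norm// lerN2 ltW.
    by rewrite -[u y - u 0]opprB uE sub0r mulrN opprK mulfK.
  + have [||c] := @MVT R u du 0 y ygt.
    * move=> x; rewrite in_itv/= => /andP[x0 xy]; apply: Du; last by rewrite gt_eqF.
      by rewrite gtr0_norm// (lt_trans xy)// -(gtr0_norm ygt).
    * apply: continuous_in_subspaceT => x; rewrite inE/= in_itv/= => /andP[x0 xy].
      by apply: cont; rewrite ger0_norm// (le_lt_trans xy)// -(gtr0_norm ygt).
    rewrite in_itv/= => /andP[c0 cy] uE; exists c.
      by rewrite gtr0_norm// (lt_trans cy)// -(gtr0_norm ygt).
    by rewrite uE subr0 mulfK.
- by rewrite eqxx.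
Qed.

Section Hadamard.
Variables (c e : R) (G : nat -> R -> R).
Let J : set R := [set x | `|x - c| < e].
Hypothesis DG : forall j x, J x -> is_derive x 1 (G j) (G j.+1 x).
Hypothesis avoid0 : (forall x, J x -> x != 0) \/ (c = 0 /\ G 0 0 = 0).

(** The j-th derivative of G 0 x / x, multiplied by x ^ j.+1. *)
Fixpoint hadamard_num (j : nat) (x : R) : R :=
  if j is i.+1 then x ^+ i.+1 * G i.+1 x - i.+1%:R * hadamard_num i x else G 0 x.

(** The j-th derivative of G 0 x / x, with the value at 0 prescribed by the
    Taylor expansion of G 0. *)
Definition hadamard_quot (j : nat) (x : R) : R :=
  if x == 0 then G j.+1 0 / j.+1%:R else hadamard_num j x / x ^+ j.+1.

Lemma hadamard_num_derive j x : J x ->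
  is_derive x 1 (hadamard_num j) (x ^+ j * G j.+1 x).
Proof.
move=> Jx; elim: j => [|j IH] /=; first by rewrite expr0 mul1r; exact: DG.
have X : is_derive x 1 (fun y : R => y ^+ j.+1) (j.+1%:R * x ^+ j).
  have := @is_deriveX _ _ id j.+1 x 1 1 (is_derive_id x 1).
  by rewrite /GRing.scale /= mulr1; congr is_derive; apply/funext => y; rewrite fctE.
have H := is_deriveB (is_deriveM X (DG j.+1 Jx)) (is_deriveZ j.+1%:R IH).
have -> : x ^+ j.+1 * G j.+2 x = x ^+ j.+1 *: G j.+2 x + G j.+1 x *: (j.+1%:R * x ^+ j) -
  j.+1%:R *: (x ^+ j * G j.+1 x) by rewrite /GRing.scale /=; ring.
exact: H.
Qed.

Lemma hadamard_num0 j : G 0 0 = 0 -> hadamard_num j 0 = 0.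
Proof.
move=> G0; elim: j => [|j IH] //=.
by rewrite IH mulr0 exprS !mul0r subr0.
Qed.

Lemma J_near x : J x -> \forall y \near x, J y.
Proof.
move=> Jx; apply/nbhs_ballP; exists (e - `|x - c|) => /=; first by rewrite subr_gt0.
move=> y; rewrite /ball /= => xy; rewrite /J /=.
rewrite -[y - c](subrKA x); apply: le_lt_trans (ler_normD _ _) _.
by rewrite -ltrBrDr distrC.
Qed.

Lemma hadamard_quot_derive j x : J x -> x != 0 ->
  is_derive x 1 (hadamard_quot j) (hadamard_quot j.+1 x).
Proof.
move=> Jx x0; have X : is_derive x 1 (fun y : R => y ^+ j.+1) (j.+1%:R * x ^+ j).
  have := @is_deriveX _ _ id j.+1 x 1 1 (is_derive_id x 1).
  by rewrite /GRing.scale /= mulr1; congr is_derive; apply/funext => y; rewrite fctE.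
have V := @is_deriveV _ (fun y : R => y ^+ j.+1) x _ 1 (expf_neq0 j.+1 x0) X.
have H := is_deriveM (hadamard_num_derive j Jx) V.
apply: (@derive_near_eq (hadamard_num j * (fun y : R => (y ^+ j.+1)^-1))).
  move: H; congr is_derive; rewrite /hadamard_quot (negPf x0) /= /GRing.scale /=.
  by rewrite !exprS; field; rewrite expf_neq0// x0.
near=> y; rewrite /hadamard_quot ifN//; near: y.
exact: (open_nbhs_nbhs (conj (@open_neq _ 0) x0)).
Unshelve. all: by end_near. Qed.

Lemma G_cont j x : J x -> {for x, continuous (G j)}.
Proof.
move=> Jx; apply: differentiable_continuous; apply/derivable1_diffP.
by have [] := DG j Jx.
Qed.

Lemma hadamard_quot_cont j : J 0 -> {for 0, continuous (hadamard_quot j)}.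
Proof.
move=> J0; have [/(_ 0 J0)/eqP//|[c0 G0]] := avoid0.
have e0 : 0 < e by move: J0; rewrite /J /= c0 subrr normr0.
rewrite /prop_for /continuous_at {2}/hadamard_quot eqxx.
apply/cvgrPdist_le => eps eps0.
have /cvgrPdist_le /(_ eps eps0) [d /= d0 dE] := @G_cont j.+1 0 J0.
exists (Num.min d e); first by rewrite /= lt_min d0.
move=> x; rewrite /= sub0r normrN lt_min => /andP[xd xe].
rewrite /hadamard_quot; case: eqP => [_|/eqP x0]; first by rewrite subrr normr0 ltW.
pose u y := hadamard_num j y - G j.+1 0 / j.+1%:R * y ^+ j.+1.
pose du y := y ^+ j * (G j.+1 y - G j.+1 0).
have j0 : j.+1%:R != 0 :> R by rewrite pnatr_eq0.
have bound : `|u x| <= eps * `|x| ^+ j.+1.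
  apply: (@small_primitive (Num.min d e) eps j u du); last by rewrite lt_min xd xe.
  - move=> y; rewrite lt_min => /andP[yd ye].
    have Jy : J y by rewrite /J /= c0 subr0.
    have X : is_derive y 1 (fun y : R => y ^+ j.+1) (j.+1%:R * y ^+ j).
      have := @is_deriveX _ _ id j.+1 y 1 1 (is_derive_id y 1).
      by rewrite /GRing.scale /= mulr1; congr is_derive; apply/funext => z; rewrite fctE.
    have := is_deriveB (hadamard_num_derive j Jy) (is_deriveZ (G j.+1 0 / j.+1%:R) X).
    by congr is_derive; rewrite /du /GRing.scale /=; field.
  - by rewrite /u hadamard_num0// exprS mul0r mulr0 subr0.
  - move=> y; rewrite lt_min => /andP[yd ye]; rewrite /du normrM mulrC normrX.
    by apply: ler_wpM2r; rewrite ?exprn_ge0// distrC dE//= sub0r normrN.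
have -> : G j.+1 0 / j.+1%:R - hadamard_num j x / x ^+ j.+1 = - (u x / x ^+ j.+1).
  by rewrite /u mulrBl mulfK ?expf_neq0// opprB.
by rewrite normrN normrM normfV ler_pdivrMr ?normr_gt0 ?expf_neq0// normrX.
Qed.

(** Hadamard's lemma: division by x preserves smoothness when the function
    vanishes at 0, and trivially on an interval that avoids 0. *)
Lemma hadamard : smooth1 J (hadamard_quot 0) /\ forall x, J x -> G 0 x = x * hadamard_quot 0 x.
Proof.
split.
  exists hadamard_quot => // j x Jx.
  have [x0|x0] := eqVneq x 0; last exact: hadamard_quot_derive.
  have J0 : J 0 by rewrite -x0.
  have [/(_ 0 J0)/eqP//|[c0 _]] := avoid0.
  have e0 : 0 < e by move: J0; rewrite /J /= c0 subrr normr0.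
  rewrite x0; apply: (derive_extend e0); try exact: hadamard_quot_cont.
  by move=> y ye y0; apply: hadamard_quot_derive => //; rewrite /J /= c0 subr0.
move=> x Jx; rewrite /hadamard_quot; case: eqP => [x0|/eqP x0].
  have [/(_ x Jx)/eqP//|[c0 G0]] := avoid0.
  by rewrite x0 G0 mul0r.
by rewrite /= mulrC divfK.
Qed.

End Hadamard.

End SmoothOneVariable.

Section SquareSubstitution.
Variables (R : realType) (I : set R) (c e : R).
Implicit Types (f k : R -> R).
Let J : set R := [set x | `|x - c| < e].
Hypothesis I_ge0 : forall t, I t -> 0 <= t.
Hypothesis J_I : forall x, J x -> I (x ^+ 2).
Hypothesis avoid0 : (forall x, J x -> x != 0) \/ c = 0.

Lemma signed_sqrt (x : R) : x != 0 ->
  is_derive (x ^+ 2) 1 (fun y : R => Num.sg x * Num.sqrt y) (2 * x)^-1.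
Proof.
move=> x0; have x2 : 0 < x ^+ 2 by rewrite exprn_even_gt0.
have := is_deriveZ (Num.sg x) (is_derive1_sqrt x2).
congr is_derive; rewrite /GRing.scale /= sqrtr_sqr.
have [xn|xp|xE] := ltgtP x 0; last by rewrite xE eqxx in x0.
  by rewrite ltr0_sg// ltr0_norm//; field.
by rewrite gtr0_sg// gtr0_norm// mul1r.
Qed.

(** If f (x^2) = k x then 2 x f' (x^2) = k' x. On an interval around 0 the
    function k is even, so k' vanishes at 0 and k' x / (2 x) is smooth by
    [hadamard]. *)
Lemma square_step f k : smooth1 J k -> (forall x, J x -> f (x ^+ 2) = k x) ->
  exists2 m, smooth1 J m & forall x, J x -> is_dw I f (x ^+ 2) (m x).
Proof.
move=> [K <- DK] fk.
(* The derivative at 0 of an even function vanishes. *)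
have K10 : c = 0 -> 0 < e -> K 1%N 0 = 0.
  move=> c0 e0; have J0 : J 0 by rewrite /J /= c0 subrr normr0.
  have d1 := DK 0%N 0 J0.
  have d2 : is_derive (0 : R) 1 (K 0%N) (K 1%N 0 * - 1).
    apply: (@derive_near_eq _ (K 0%N \o -%R)).
      by apply: is_derive1_comp; rewrite oppr0.
    near=> y; have Jy : J y by near: y; exact: J_near.
    have JNy : J (- y) by move: Jy; rewrite /J /= c0 !subr0 normrN.
    by rewrite /= -!fk// sqrrN.
  have := @derive_val _ _ _ _ _ _ _ d1; rewrite (@derive_val _ _ _ _ _ _ _ d2); lra.
have av : (forall x, J x -> x != 0) \/ (c = 0 /\ K 1%N 0 = 0).
  have [|c0] := avoid0; first by left.
  have [e0|e0] := ltP 0 e; first by right; split => //; exact: K10.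
  left => x; rewrite /J /= => /(le_lt_trans (normr_ge0 _)) /lt_le_trans /(_ e0).
  by rewrite ltxx.
have [[M M0 DM] KM] := @hadamard _ c e (fun j => K j.+1) (fun j => DK j.+1) av.
pose m x := M 0%N x / 2; rewrite -M0 in KM.
exists m.
  exists (fun j x => M j x / 2) => // j x Jx.
  have := is_deriveZ 2^-1 (DM j x Jx); rewrite /GRing.scale /= mulrC.
  by congr is_derive; apply/funext => y; exact: mulrC.
move=> x Jx; have [x0|x0] := eqVneq x 0; last first.
  have ds := signed_sqrt x0.
  have sx : Num.sg x * Num.sqrt (x ^+ 2) = x by rewrite sqrtr_sqr -numEsg.
  have dk : is_derive (Num.sg x * Num.sqrt (x ^+ 2)) 1 (K 0%N) (K 1%N x).
    by rewrite sx; exact: DK.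
  have /(is_derive_dw I) := @is_derive1_comp _ (K 0%N)
    (fun y => Num.sg x * Num.sqrt y) (x ^+ 2) _ _ dk ds.
  have -> : K 1%N x / (2 * x) = m x by rewrite KM// /m; field.
  move=> /is_dw_near; apply; first exact: J_I.
  have cs : {for x ^+ 2, continuous (fun y : R => Num.sg x * Num.sqrt y)}.
    by apply: differentiable_continuous; apply/derivable1_diffP; have [] := ds.
  have nJ : \forall y \near x ^+ 2, J (Num.sg x * Num.sqrt y).
    by apply: cs; rewrite sx; exact: J_near.
  apply: filterS nJ => y Jy Iy /=; rewrite -fk// exprMn sqr_sqrtr ?I_ge0//.
  by rewrite sqr_sg x0 mul1r.
have J0 : J 0 by rewrite -x0.
have [/(_ 0 J0)/eqP//|[c0 _]] := av.
have e0 : 0 < e by move: J0; rewrite /J /= c0 subrr normr0.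
have f0 : f 0 = K 0%N 0 by rewrite -fk// expr0n.
rewrite x0 expr0n /=; apply/is_dwP => eps eps0.
have cM : {for 0, continuous (M 0%N)}.
  apply: differentiable_continuous; apply/derivable1_diffP.
  by have [] := DM 0%N 0 J0.
have /cvgrPdist_le /(_ (eps / 2)) [|d /= d0 dE] := cM; first by rewrite divr_gt0.
pose d' := Num.min d e; have d'0 : 0 < d' by rewrite lt_min d0.
exists (d' ^+ 2) => [/=|]; first by rewrite exprn_gt0.
move=> y /=; rewrite sub0r normrN => yd y0 Iy.
have yp : 0 < y by rewrite lt_def I_ge0// andbT; move: y0.
have sd : `|Num.sqrt y| < d'.
  rewrite ger0_norm ?sqrtr_ge0// -(@ltr_pXn2r _ 2)// ?nnegrE ?sqrtr_ge0 ?ltW//.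
  by rewrite sqr_sqrtr ?ltW// -(gtr0_norm yp).
pose u x := K 0%N x - K 0%N 0 - m 0 * x ^+ 2.
pose du x := x * (M 0%N x - M 0%N 0).
have inJ z : `|z| < d' -> J z.
  by rewrite lt_min => /andP[_ ze]; rewrite /J /= c0 subr0.
have bound : `|u (Num.sqrt y)| <= (eps / 2) * `|Num.sqrt y| ^+ 2.
  apply: (@small_primitive _ d' (eps / 2) 1 u du) => //.
  - move=> z zd; have X : is_derive z 1 (fun y : R => y ^+ 2) (2 * z).
      have := @is_deriveX _ _ id 2 z 1 1 (is_derive_id z 1).
      by rewrite /GRing.scale /= mulr1; congr is_derive; apply/funext => w; rewrite fctE.
    have := is_deriveB (is_deriveB (DK 0%N z (inJ z zd)) (is_derive_cst (K 0%N 0) z 1))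
      (is_deriveZ (m 0) X).
    congr is_derive; rewrite KM; last exact: inJ.
    by rewrite /du /m /GRing.scale /=; field.
  - by rewrite /u expr0n mulr0 !subr0 subrr.
  - move=> z; rewrite lt_min => /andP[zd ze]; rewrite /du normrM mulrC.
    by apply: ler_wpM2r => //; rewrite distrC dE//= sub0r normrN.
have -> : quotient_at f 0 y = u (Num.sqrt y) / y + m 0.
  have yE : Num.sqrt y ^+ 2 = y by rewrite sqr_sqrtr// ltW.
  have fy : f y = K 0%N (Num.sqrt y) by rewrite -{1}yE fk//; exact: inJ.
  by rewrite /quotient_at fy f0 /u yE subr0; field; rewrite gt_eqF.
rewrite opprD addrCA subrr addr0 normrN normrM normfV (gtr0_norm yp) ltr_pdivrMr//.
apply: le_lt_trans bound _; rewrite real_normK ?num_real// sqr_sqrtr ?ltW//.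
by rewrite ltr_pM2r// ltr_pdivrMr// ltr_pMr// ltr1n.
Unshelve. all: by end_near. Qed.

(** By [square_step] each iterated derivative of f, composed with the square, is
    again a smooth function of x. *)
Lemma square_iter f k : (forall x, J x -> ProperFilter (within I (x ^+ 2)^')) ->
  smooth1 J k -> (forall x, J x -> f (x ^+ 2) = k x) ->
  forall (j : nat) x, J x -> cvg (quotient_at (iter j (derive_within I) f) (x ^+ 2) y
    @[y --> within I (x ^+ 2)^']).
Proof.
move=> PF sk fk j x Jx.
have [m sm fm] : exists2 m, smooth1 J m &
    forall x, J x -> iter j (derive_within I) f (x ^+ 2) = m x.
  elim: j => [|j [m sm fm]]; first by exists k.
  have [m' sm' dm'] := square_step sm fm; exists m' => // y Jy /=.
  exact: (@dw_val _ _ _ _ _ (PF y Jy) (dm' y Jy)).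
have [m' _ dm'] := square_step sm fm.
by apply: cvgP; exact: dm'.
Qed.

End SquareSubstitution.

(** * Frames and phases *)

Lemma sqrt_midpoint (R : realType) (x y : R) : 0 <= x -> 0 <= y ->
  Num.sqrt x + Num.sqrt y <= 2 * Num.sqrt ((x + y) / 2).
Proof.
move=> x0 y0; have m0 : 0 <= (x + y) / 2 by rewrite divr_ge0// addr_ge0.
have sx := sqr_sqrtr x0; have sy := sqr_sqrtr y0; have sm := sqr_sqrtr m0.
rewrite -(@ler_pXn2r _ 2)// ?nnegrE ?addr_ge0 ?mulr_ge0 ?sqrtr_ge0// exprMn sm.
have := sqr_ge0 (Num.sqrt x - Num.sqrt y); nra.
Qed.

Lemma sqrt_midpoint_eq (R : realType) (x y : R) : 0 <= x -> 0 <= y ->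
  Num.sqrt x + Num.sqrt y = 2 * Num.sqrt ((x + y) / 2) -> x = y.
Proof.
move=> x0 y0 E; have m0 : 0 <= (x + y) / 2 by rewrite divr_ge0// addr_ge0.
have sx := sqr_sqrtr x0; have sy := sqr_sqrtr y0; have sm := sqr_sqrtr m0.
have : (Num.sqrt x - Num.sqrt y) ^+ 2 = 0.
  have : (Num.sqrt x + Num.sqrt y) ^+ 2 = 2 * (x + y).
    by rewrite E exprMn sm; field.
  by nra.
move/eqP; rewrite sqrf_eq0 subr_eq0 => /eqP E2.
by rewrite -sx -sy E2.
Qed.

(** Let x' be the conjugate of x. Replacing x by - x changes the sign of both
    real parts; by strict concavity of the square root the constant value then
    forbids any oscillation, first of the term in c and next of the term in d. *)
Lemma phase_constant (R : realType) (A B kappa : R) (c d : R[i]) :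
  (forall x : R[i], Normc.normc x = 1 ->
    [/\ 0 < A + 2 * complex.Re (x^*%C * c), 0 <= B + 2 * complex.Re (x^*%C * d) &
      Num.sqrt (A + 2 * complex.Re (x^*%C * c)) +
      Num.sqrt (B + 2 * complex.Re (x^*%C * d)) = kappa]) -> c = 0 /\ d = 0.
Proof.
move=> H; have opp x (y : R[i]) : complex.Re ((- x)^*%C * y) = - complex.Re (x^*%C * y).
  by case: x y => [? ?] [? ?] /=; ring.
have normN (x : R[i]) : Normc.normc x = 1 -> Normc.normc (- x) = 1.
  by case: x => ? ? /=; rewrite !sqrrN.
have n1 : Normc.normc (1 : R[i]) = 1 by rewrite /= expr1n expr0n addr0 sqrtr1.
have ni : Normc.normc ('i : R[i]) = 1 by rewrite /= expr1n expr0n add0r sqrtr1.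
(* Where the first term does not oscillate, neither does the second. *)
have flat x : Normc.normc x = 1 -> complex.Re (x^*%C * c) = 0 -> complex.Re (x^*%C * d) = 0.
  move=> x1 c0; have [_ p1 e1] := H _ x1; have [_ p2 e2] := H _ (normN _ x1).
  rewrite !opp c0 in e1 e2 p1 p2; move: e2; rewrite oppr0 -e1 => /addrI/eqP.
  rewrite eqr_sqrt// => /eqP; lra.
have c0 : c = 0.
  have [//|cn0] := eqVneq c 0.
  have nc : 0 < Normc.normc c.
    rewrite lt_def; apply/andP; split; last by case: (c) => ? ?; exact: sqrtr_ge0.
    by apply: contra cn0 => /eqP/Normc.eq0_normc ->.
  (* The phases at which Re (x' c) is maximal and zero. *)
  pose x := c / (Normc.normc c)%:C; pose y := 'i * x.
  have nV : Normc.normc ((Normc.normc c)%:C^-1) = (Normc.normc c)^-1.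
    by rewrite Normc.normcV /= expr0n addr0 sqrtr_sqr gtr0_norm.
  have x1 : Normc.normc x = 1 by rewrite Normc.normcM nV mulfV// gt_eqF.
  have y1 : Normc.normc y = 1 by rewrite Normc.normcM ni mul1r.
  have xc : x^*%C * c = (Normc.normc c)%:C.
    rewrite /x cJM mulrAC [c^*%C * c]mulrC mulJ_normc -rcV conjc_real -rcM.
    by congr (_%:C); field; rewrite gt_eqF.
  have yc : complex.Re (y^*%C * c) = 0.
    by rewrite /y cJM -mulrA xc /=; ring.
  have yd := flat y y1 yc.
  have [A0 B0 k0] := H y y1; rewrite yc yd !mulr0 !addr0 in A0 B0 k0.
  have [p1 q1 e1] := H x x1; have [p2 q2 e2] := H _ (normN _ x1).
  rewrite !opp in p2 q2 e2; rewrite xc /= in p1 e1 p2 e2.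
  have := sqrt_midpoint (ltW p1) (ltW p2); have := sqrt_midpoint q1 q2.
  set C := Normc.normc c in nc p1 e1 p2 e2 *.
  rewrite (_ : (_ + _ + (_ + _)) / 2 = B); last by field.
  rewrite (_ : (_ + _ + (_ + _)) / 2 = A); last by field.
  move=> l1 l2; exfalso; have : A + 2 * C = A + 2 * - C; last by clear -nc; lra.
  apply: sqrt_midpoint_eq (ltW p1) (ltW p2) _.
  rewrite (_ : (_ + _ + (_ + _)) / 2 = A); last by field.
  lra.
split=> //; have zero x : Normc.normc x = 1 -> complex.Re (x^*%C * d) = 0.
  by move=> x1; apply: flat => //; rewrite c0 mulr0.
have := zero _ n1; have := zero _ ni; case: d {H flat zero} => x y /=.
by move=> h1 h2; congr (_ +i* _); lra.
Qed.

Section Orthogonal.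
Variables (R : realType) (n : nat).
Implicit Types x y e u : 'cV[R[i]]_n.

Lemma normalize x : x != 0 -> sqnorm (((Num.sqrt (sqnorm x))^-1)%:C *: x) = 1.
Proof.
move=> x0; have t0 : 0 < sqnorm x by rewrite sqnorm_gt0.
rewrite sqnormZ /= expr0n addr0 sqrtr_sqr real_normK ?num_real// exprVn.
by rewrite sqr_sqrtr ?ltW// mulVf// gt_eqF.
Qed.

Lemma exists_orthogonal e : (2 <= n)%N -> exists2 u, sqnorm u = 1 & hdot u e = 0.
Proof.
move=> n2; pose M : 'M[R[i]]_(n, 1) := \matrix_(i, j) (e i 0)^*%C.
have : kermx M != 0.
  rewrite kermx_eq0 /row_free neq_ltn; apply/orP; left.
  by apply: leq_ltn_trans (rank_leq_col _) _.
case/rowV0Pn => w /sub_kermxP wM w0.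
pose x : 'cV[R[i]]_n := w^T.
have x0 : x != 0.
  by apply: contra w0 => /eqP x0; rewrite -[w]trmxK -/x x0 trmx0.
have xe : hdot x e = 0.
  move/rowP/(_ 0): wM; rewrite !mxE => wM; rewrite hdotE -[RHS]wM.
  by apply: eq_bigr => i _; rewrite !mxE.
exists (((Num.sqrt (sqnorm x))^-1)%:C *: x); first exact: normalize.
by rewrite hdotZl xe mulr0.
Qed.

End Orthogonal.

(** * Unitary invariant Randers metrics along a ray *)

Section HermitianForms.
Variables (R : realType) (n : nat).
Implicit Types (A : 'M[R[i]]_n) (x y : 'cV[R[i]]_n) (l : 'rV[R[i]]_n).

Definition sesq A x y : R[i] := \sum_(i < n) \sum_(j < n) A i j * x i 0 * (y j 0)^*%C.
Definition lform l x : R[i] := \sum_(i < n) l 0 i * x i 0.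

Lemma herm_formE A x : herm_form A x = sesq A x x.
Proof. by []. Qed.

Lemma sesqDl A x x' y : sesq A (x + x') y = sesq A x y + sesq A x' y.
Proof.
rewrite /sesq -big_split; apply: eq_bigr => i _; rewrite -big_split.
by apply: eq_bigr => j _ /=; rewrite mxE; ring.
Qed.

Lemma sesqZl A c x y : sesq A (c *: x) y = c * sesq A x y.
Proof.
rewrite /sesq mulr_sumr; apply: eq_bigr => i _; rewrite mulr_sumr.
by apply: eq_bigr => j _ /=; rewrite mxE; ring.
Qed.

Lemma sesqDr A x y y' : sesq A x (y + y') = sesq A x y + sesq A x y'.
Proof.
rewrite /sesq -big_split; apply: eq_bigr => i _; rewrite -big_split.
by apply: eq_bigr => j _ /=; rewrite mxE cJD; ring.
Qed.

Lemma sesqZr A c x y : sesq A x (c *: y) = c^*%C * sesq A x y.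
Proof.
rewrite /sesq mulr_sumr; apply: eq_bigr => i _; rewrite mulr_sumr.
by apply: eq_bigr => j _ /=; rewrite mxE cJM; ring.
Qed.

Lemma cJ_sum m (f : 'I_m -> R[i]) : (\sum_(i < m) f i)^*%C = \sum_(i < m) (f i)^*%C.
Proof. exact: rmorph_sum. Qed.

Lemma sesqC A x y : (forall i j, A j i = (A i j)^*%C) -> sesq A y x = (sesq A x y)^*%C.
Proof.
move=> hA; rewrite /sesq exchange_big cJ_sum; apply: eq_bigr => i _.
rewrite cJ_sum; apply: eq_bigr => j _.
by rewrite hA !cJM conjcK mulrAC.
Qed.

Lemma sesq_real A x : (forall i j, A j i = (A i j)^*%C) ->
  sesq A x x = (complex.Re (sesq A x x))%:C.
Proof.
move=> hA; have /(congr1 (@complex.Im _)) := sesqC x x hA; rewrite cImJ.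
case: (sesq A x x) => p q /= pq; congr (_ +i* _); lra.
Qed.

Lemma herm_form_comb A x y (c d : R[i]) : (forall i j, A j i = (A i j)^*%C) ->
  complex.Re (herm_form A (c *: x + d *: y)) =
  Normc.normc c ^+ 2 * complex.Re (herm_form A x) +
  Normc.normc d ^+ 2 * complex.Re (herm_form A y) +
  2 * complex.Re (c * d^*%C * sesq A x y).
Proof.
move=> hA; rewrite !herm_formE !(sesqDl, sesqDr, sesqZl, sesqZr) (sesqC x y hA).
rewrite (sesq_real x hA) (sesq_real y hA).
have normE (w : R[i]) : Normc.normc w ^+ 2 = complex.Re (w * w^*%C).
  by rewrite mulJ_normc.
rewrite !normE; move: (complex.Re (sesq A x x)) (complex.Re (sesq A y y)) (sesq A x y).
by move=> p q [? ?]; case: c d => [? ?] [? ?] /=; ring.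
Qed.

Lemma lform_comb l x y (c d : R[i]) : lform l (c *: x + d *: y) = c * lform l x + d * lform l y.
Proof.
rewrite /lform !mulr_sumr -big_split; apply: eq_bigr => i _ /=.
by rewrite !mxE; ring.
Qed.

Lemma normc_ge0 (c : R[i]) : 0 <= Normc.normc c.
Proof. by case: c => ? ?; exact: sqrtr_ge0. Qed.

Lemma normc_real (c : R) : Normc.normc c%:C = `|c|.
Proof. by rewrite /= expr0n addr0 sqrtr_sqr. Qed.

Lemma normc_eq0 (c : R[i]) : (Normc.normc c == 0) = (c == 0).
Proof.
apply/eqP/eqP => [/Normc.eq0_normc//|->]; by rewrite /= expr0n addr0 sqrtr0.
Qed.

Lemma normcD2 (c d : R[i]) : Normc.normc (c + d) ^+ 2 =
  Normc.normc c ^+ 2 + Normc.normc d ^+ 2 + 2 * complex.Re (c * d^*%C).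
Proof.
apply: complexI; rewrite -mulJ_normc !rcD -!mulJ_normc.
case: c d => [? ?] [? ?]; apply/eqP; rewrite eq_complex /=.
by apply/andP; split; apply/eqP; ring.
Qed.

End HermitianForms.

Section RandersRay.
Variables (R : realType) (n : nat) (D : set 'cV[R[i]]_n) (F : T10 R n -> R).
Variables (phi : R -> R -> R) (a : 'cV[R[i]]_n -> 'M[R[i]]_n) (b : 'cV[R[i]]_n -> 'rV[R[i]]_n).
Hypothesis aH : forall z i j, D z -> a z j i = (a z i j)^*%C.
Hypothesis a_pos : forall z v, D z -> v != 0 -> 0 < herm_form (a z) v.
Hypothesis F_ab : forall z v, D z ->
  F (z, v) = Num.sqrt (complex.Re (herm_form (a z) v)) + Normc.normc (lform (b z) v).
Hypothesis F_phi : forall z v, D z ->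
  F (z, v) = Num.sqrt (sqnorm v * phi (sqnorm z) (svar z v)).

(** The Randers metric is F = alpha + |beta|; [ha] is alpha^2 and [hb] is
    |beta|. *)
Definition ha z v : R := complex.Re (herm_form (a z) v).
Definition hb z v : R := Normc.normc (lform (b z) v).

Lemma ha_gt0 z v : D z -> v != 0 -> 0 < ha z v.
Proof. by move=> Dz v0; have := a_pos Dz v0; rewrite ltcE => /andP[]. Qed.

Lemma F_gt0 z v : D z -> v != 0 -> 0 < F (z, v).
Proof.
by move=> Dz v0; rewrite F_ab// ltr_wpDr ?normc_ge0// sqrtr_gt0; exact: ha_gt0.
Qed.

Lemma F2_phi z v : D z -> v != 0 -> F (z, v) ^+ 2 = sqnorm v * phi (sqnorm z) (svar z v).
Proof.
move=> Dz v0; have := F_gt0 Dz v0; rewrite F_phi// sqrtr_gt0 => /ltW.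
exact: sqr_sqrtr.
Qed.

Lemma F_inv z v z' v' : D z -> D z' -> sqnorm z = sqnorm z' -> sqnorm v = sqnorm v' ->
  qfun (z, v) = qfun (z', v') -> F (z, v) = F (z', v').
Proof.
move=> Dz Dz' zE vE qE; rewrite !F_phi// zE vE; congr (Num.sqrt (_ * phi _ _)).
by rewrite -[svar z v]/(qfun (z, v) / sqnorm v) qE vE.
Qed.

Variables (e u : 'cV[R[i]]_n).
Hypotheses (e1 : sqnorm e = 1) (u1 : sqnorm u = 1) (ue : hdot u e = 0).

Lemma sqnorm_comb (c d : R[i]) :
  sqnorm (c *: e + d *: u) = Normc.normc c ^+ 2 + Normc.normc d ^+ 2.
Proof.
have eu : hdot e u = 0 by rewrite hdotC ue conjc0.
apply: complexI; rewrite -hdot_sqnorm !(hdotDl, hdotDr, hdotZl, hdotZr) ue eu.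
by rewrite !hdot_sqnorm e1 u1 rcD -!mulJ_normc; ring.
Qed.

Lemma qfun_comb (x : R) (c d : R[i]) :
  qfun (x%:C *: e, c *: e + d *: u) = x ^+ 2 * Normc.normc c ^+ 2.
Proof.
apply: complexI; rewrite qfunE /= rcM -mulJ_normc hdotDl !hdotZl !hdotZr ue.
rewrite hdot_sqnorm e1 !mulr0 addr0 !cJM !conjc_real rcM.
by ring.
Qed.

Section AtPoint.
Variable x : R.
Let z := x%:C *: e.
Hypotheses (x0 : x != 0) (Dz : D z).

(** Rotating the component along [u] does not change t, r and q, hence F, and
    [phase_constant] applies. *)
Lemma ray_diagonal : sesq (a z) e u = 0 /\ (hb z e = 0 \/ hb z u = 0).
Proof.
have [] := @phase_constant R (ha z e + ha z u) (hb z e ^+ 2 + hb z u ^+ 2) (F (z, e + u))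
  (sesq (a z) e u) (lform (b z) e * (lform (b z) u)^*%C).
  move=> y y1; pose w := 1 *: e + y *: u.
  have n1 : Normc.normc (1 : R[i]) = 1 by rewrite normc_real normr1.
  have eu : e + u = 1 *: e + 1 *: u by rewrite !scale1r.
  have w0 : w != 0.
    by rewrite -sqnorm_eq0 sqnorm_comb n1 y1 !expr1n -mulr2n pnatr_eq0.
  have haE : ha z w = ha z e + ha z u + 2 * complex.Re (y^*%C * sesq (a z) e u).
    rewrite /ha herm_form_comb; last by move=> i j; exact: aH.
    by rewrite n1 y1 !expr1n !mul1r.
  have hbE : hb z w ^+ 2 = hb z e ^+ 2 + hb z u ^+ 2 +
      2 * complex.Re (y^*%C * (lform (b z) e * (lform (b z) u)^*%C)).
    rewrite /hb lform_comb normcD2 !Normc.normcM n1 y1 !mul1r cJM.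
    by congr (_ + 2 * complex.Re _); ring.
  rewrite -haE -hbE; split; [exact: ha_gt0|exact: sqr_ge0|].
  rewrite sqrtr_sqr ger0_norm ?normc_ge0// -F_ab//; apply: F_inv => //.
    by rewrite eu !sqnorm_comb y1 n1.
  by rewrite eu !qfun_comb.
move=> s0 b0; split => //; move/eqP: b0; rewrite mulf_eq0 conjc_eq0 -!normc_eq0.
by case/orP => /eqP ?; [left|right].
Qed.

Lemma F_ray0 (y1 y2 : R) : 0 <= y1 -> 0 <= y2 ->
  F (z, y1%:C *: e + y2%:C *: u) =
  Num.sqrt (y1 ^+ 2 * ha z e + y2 ^+ 2 * ha z u) + (y1 * hb z e + y2 * hb z u).
Proof.
move=> p1 p2; have [s0 b0] := ray_diagonal; rewrite F_ab//; congr (Num.sqrt _ + _).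
  rewrite herm_form_comb; last by move=> i j; exact: aH.
  by rewrite !normc_real s0 mulr0 /= mulr0 addr0 !real_normK ?num_real.
rewrite lform_comb.
by case: b0 => b0; have /eqP := b0; rewrite normc_eq0 => /eqP ->;
  rewrite b0 !mulr0 ?add0r ?addr0 Normc.normcM normc_real ger0_norm.
Qed.

(** F depends on t, r and q only, and any (z', v) with |z'| = x has the same
    invariants as a vector y1 e + y2 u at x e with y1 and y2 nonnegative. *)
Lemma F_ray z' v : D z' -> sqnorm z' = x ^+ 2 ->
  F (z', v) = Num.sqrt (qfun (z', v) / x ^+ 2 * ha z e +
                        (sqnorm v - qfun (z', v) / x ^+ 2) * ha z u) +
   (Num.sqrt (qfun (z', v) / x ^+ 2) * hb z e +
    Num.sqrt (sqnorm v - qfun (z', v) / x ^+ 2) * hb z u).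
Proof.
move=> Dz' zE; have x2 : 0 < x ^+ 2 by rewrite exprn_even_gt0.
have h1 : 0 <= qfun (z', v) / x ^+ 2 by rewrite divr_ge0 ?qfun_ge0// ltW.
have h2 : 0 <= sqnorm v - qfun (z', v) / x ^+ 2.
  by rewrite subr_ge0 ler_pdivrMr// mulrC -zE; exact: (qfun_le (z', v)).
rewrite -{1}(sqr_sqrtr h1) -{1}(sqr_sqrtr h2) -F_ray0 ?sqrtr_ge0//.
apply: F_inv => //.
- by rewrite zE /z sqnormZ e1 mulr1 normc_real real_normK ?num_real.
- by rewrite sqnorm_comb !normc_real !real_normK ?num_real// !sqr_sqrtr// addrC subrK.
- by rewrite qfun_comb normc_real real_normK ?num_real// sqr_sqrtr// mulrC divfK ?gt_eqF.
Qed.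

End AtPoint.
End RandersRay.

(** * Topology of the domain and smoothness of F^2 *)

Section DomainRays.
Variables (R : realType) (n : nat) (D : set 'cV[R[i]]_n).
Hypothesis oD : open D.
Implicit Types (e z : 'cV[R[i]]_n) (x : R).

Lemma ray_near e x : D (x%:C *: e) ->
  exists2 d : R, 0 < d & forall y, `|y - x| < d -> D (y%:C *: e).
Proof.
move=> Dx; have /(near_line e) := open_nbhs_nbhs (conj oD Dx).
case/nbhs_ballP => d /= d0 dD; exists d => // y yx.
have := dD (y - x); rewrite /ball /= sub0r normrN => /(_ yx).
by rewrite -scalerDl -rcD addrC subrK.
Qed.

Lemma polar z : (2 <= n)%N ->
  exists e x, [/\ sqnorm e = 1, 0 <= x & z = x%:C *: e].
Proof.
move=> n2; have [->|z0] := eqVneq z 0.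
  have [u u1 _] := exists_orthogonal (0 : 'cV[R[i]]_n) n2.
  by exists u, 0; split => //; rewrite scale0r.
exists (((Num.sqrt (sqnorm z))^-1)%:C *: z), (Num.sqrt (sqnorm z)).
split; [exact: normalize|exact: sqrtr_ge0|].
have s0 : Num.sqrt (sqnorm z) != 0 by rewrite gt_eqF// sqrtr_gt0 sqnorm_gt0.
by rewrite scalerA -rcM mulfV// scale1r.
Qed.

Lemma sqnorm_ray e x : sqnorm e = 1 -> sqnorm (x%:C *: e) = x ^+ 2.
Proof. by move=> e1; rewrite sqnormZ e1 mulr1 normc_real real_normK ?num_real. Qed.

Lemma trange_ray e x : sqnorm e = 1 -> D (x%:C *: e) -> trange D (x ^+ 2).
Proof. by move=> e1 Dx; exists (x%:C *: e) => //; exact: sqnorm_ray. Qed.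

Lemma trange_ge0 t : trange D t -> 0 <= t.
Proof. by case=> z _ <-; exact: sqnorm_ge0. Qed.

(** No value of t is isolated: |z|^2 increases along the rays, and D is open. *)
Lemma trange_proper t : (2 <= n)%N -> trange D t -> ProperFilter (within (trange D) t^').
Proof.
move=> n2 [z Dz zt]; have [e [x [e1 x0 zx]]] := polar z n2.
apply: Build_ProperFilter_ex; rewrite zx in Dz zt; rewrite sqnorm_ray// in zt.
have [d d0 dD] := ray_near Dz => P PF.
have nP : \forall y \near x ^+ 2, y != t -> trange D y -> P y by rewrite zt; exact: PF.
have cont : y ^+ 2 @[y --> x] --> x ^+ 2 by exact: exprn_continuous.
have nx : \forall y \near x^'+, y ^+ 2 != t -> trange D (y ^+ 2) -> P (y ^+ 2).
  by apply: cvg_at_right_filter cont _ nP.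
near x^'+ => y.
have xy : x < y by near: y; exact: nbhs_right_gt.
exists (y ^+ 2); have : y ^+ 2 != t -> trange D (y ^+ 2) -> P (y ^+ 2) by near: y.
apply.
- by rewrite -zt gt_eqF// ltr_pXn2r// nnegrE// ltW// (le_lt_trans x0).
- apply: (trange_ray e1); apply: dD; rewrite gtr0_norm ?subr_gt0// ltrBlDl.
  near: y; apply: nbhs_right_lt; by rewrite ltrDl.
Unshelve. all: by end_near. Qed.

Lemma smooth1_ray (f : 'cV[R[i]]_n -> R) e (J : set R) : smooth_on D f ->
  (forall x, J x -> D (x%:C *: e)) -> smooth1 J (fun x => f (x%:C *: e)).
Proof.
move=> sf JD; exists (fun j x => iter_dir_derive f (nseq j e) (x%:C *: e)) => // j x Jx.
have [_ /(_ e) d] := sf (nseq j e) _ (JD x Jx).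
have dd := derivable_dir d.
have sh : is_derive x 1 (fun y : R => y - x) 1.
  have := is_deriveB (is_derive_id x (1 : R)) (is_derive_cst x x (1 : R)).
  by rewrite subr0.
have H : is_derive (x - x) 1 (real_line (iter_dir_derive f (nseq j e)) (x%:C *: e) e)
    (dir_derive (iter_dir_derive f (nseq j e)) (x%:C *: e) e).
  by rewrite subrr.
have := @is_derive1_comp _ _ (fun y : R => y - x) x _ _ H sh; rewrite mulr1; congr is_derive.
by apply/funext => y; rewrite /= /real_line -scalerDl -rcD addrC subrK.
Qed.

End DomainRays.

Section RandersSmooth.
Variables (R : realType) (n : nat) (D : set 'cV[R[i]]_n) (F : T10 R n -> R).
Variables (a : 'cV[R[i]]_n -> 'M[R[i]]_n) (b : 'cV[R[i]]_n -> 'rV[R[i]]_n).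
Hypothesis oD : open D.
Hypothesis aS : forall i j, Csmooth_on D (fun z => a z i j).
Hypothesis bS : forall i, Csmooth_on D (fun z => b z 0 i).
Hypothesis a_pos : forall z v, D z -> v != 0 -> 0 < herm_form (a z) v.
Hypothesis F_ab : forall z v, D z ->
  F (z, v) = Num.sqrt (complex.Re (herm_form (a z) v)) + Normc.normc (lform (b z) v).

Lemma smooth_on_sub (V : normedModType R[i]) (U W : set V) (f : V -> R) :
  U `<=` W -> smooth_on W f -> smooth_on U f.
Proof. by move=> UW sf ws p /UW; exact: sf. Qed.

Section Sub.
Variable U : set (T10 R n).
Hypothesis UD : U `<=` D `*` setT.

Lemma Calg_fst (f : 'cV[R[i]]_n -> R[i]) : Csmooth_on D f -> Calg U (fun q => f q.1).
Proof.
move=> [fr fi]; split; apply: smooth_alg_gen.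
  exact: (smooth_on_sub UD (smooth_on_fst fr)).
exact: (smooth_on_sub UD (smooth_on_fst fi)).
Qed.

Lemma herm_alg : smooth_alg U (fun q => complex.Re (herm_form (a q.1) q.2)).
Proof.
have [] // : Calg U (fun q : T10 R n => \sum_(i < n) \sum_(j < n)
   a q.1 i j * q.2 i 0 * (q.2 j 0)^*%C).
apply: Calg_sum => i; apply: Calg_sum => j; apply: Calg_mul; last first.
  exact/Calg_conj/Calg_smooth/Csmooth_coord_v.
apply: Calg_mul; last exact/Calg_smooth/Csmooth_coord_v.
exact: (Calg_fst (aS i j)).
Qed.

Lemma lform_alg : smooth_alg U (fun q => Normc.normc (lform (b q.1) q.2) ^+ 2).
Proof.
apply: smooth_alg_normc; apply: Calg_sum => i.
by apply: Calg_mul; [exact: (Calg_fst (bS i))|exact/Calg_smooth/Csmooth_coord_v].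
Qed.

End Sub.

Lemma open_over : open (D `*` [set: 'cV[R[i]]_n]).
Proof.
rewrite openE => p [Dp _]; apply: (@filterS _ _ _ (fst @^-1` D)).
  by move=> q Dq; split.
have : nbhs p.1 D by exact: open_nbhs_nbhs.
exact: cvg_fst.
Qed.

(** Off the kernel of the 1-form, |beta| is the square root of a positive smooth
    function. *)
Lemma randers_smooth_at z v : D z -> lform (b z) v != 0 ->
  smooth_at (fun q => F q ^+ 2) (z, v).
Proof.
move=> Dz bv.
pose U : set (T10 R n) := [set q | D q.1 /\ 0 < Normc.normc (lform (b q.1) q.2) ^+ 2].
have UD : U `<=` D `*` setT by move=> q [].
have oU : open U.
  rewrite openE => q [Dq bq]; have Dq' : (D `*` [set: 'cV[R[i]]_n]) q by [].
  have := smooth_alg_cont (lform_alg (@subset_refl _ _)) Dq'.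
  move=> /(_ [set x : R | 0 < x]); rewrite /= => H.
  have nb : nbhs q [set q' : T10 R n | 0 < Normc.normc (lform (b q'.1) q'.2) ^+ 2].
    by apply: H; exact: (open_nbhs_nbhs (conj (@open_gt _ 0) bq)).
  have nD := open_nbhs_nbhs (conj open_over Dq').
  by apply: filterS2 nb nD => q' b' [D' _].
have Uv q : U q -> q.2 != 0.
  case=> _; apply: contraTneq => ->; rewrite /lform big1 => [|i _]; last by rewrite mxE mulr0.
  by rewrite -leNgt /= expr0n addr0 sqrtr0 expr0n.
exists U; first by split => //; split => //=; rewrite exprn_gt0// lt_def normc_ge0 normc_eq0 bv.
have s1 := herm_alg UD; have s2 := lform_alg UD.
have P1 q : U q -> 0 < complex.Re (herm_form (a q.1) q.2).
  by move=> Uq; have := a_pos (UD q Uq).1 (Uv q Uq); rewrite ltcE => /andP[].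
have s := smooth_alg_add (smooth_alg_sqrt s1 P1) (smooth_alg_sqrt s2 (fun q Uq => Uq.2)).
apply: smooth_on_eq (smooth_alg_smooth oU (smooth_alg_mul s s)) _ => // q Uq.
rewrite sqrtr_sqr ger0_norm ?normc_ge0//.
by case: q Uq => q1 q2 [/= Dq _]; rewrite F_ab.
Qed.

Lemma hermitian_smooth_at z v : D z -> (forall z v, D z -> lform (b z) v = 0) ->
  smooth_at (fun q => F q ^+ 2) (z, v).
Proof.
move=> Dz b0; exists (D `*` setT); first by split => //; exact: open_over.
have s1 := herm_alg (@subset_refl _ (D `*` [set: 'cV[R[i]]_n])).
apply: smooth_on_eq (smooth_alg_smooth open_over s1) _; first exact: open_over.
case=> [q1 q2] [/= Dq _]; rewrite F_ab// b0// (_ : Normc.normc 0 = 0) ?addr0; last first.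
  by apply/eqP; rewrite normc_eq0.
rewrite sqr_sqrtr//; have [->|v0] := eqVneq q2 0.
  rewrite herm_formE /sesq big1 => [|i _]; first exact: lexx.
  by apply: big1 => j _; rewrite mxE mulr0 mul0r.
by have := a_pos Dq v0; rewrite ltcE => /andP[_ /ltW].
Qed.

End RandersSmooth.

Lemma derivable_dw (R : realType) (I : set R) (f : R -> R) t : derivable f t 1 ->
  is_dw I f t (derive_within I f t).
Proof.
move=> /derivableP d; apply: is_dw_of_cvg; apply: cvgP.
exact: is_derive_dw d.
Qed.

Lemma near_gt0 (R : realType) (T : topologicalType) (f : T -> R) (p : T) :
  {for p, continuous f} -> 0 < f p -> \forall q \near p, 0 < f q.
Proof.
move=> cf fp; apply: (cf [set x | 0 < x]).
exact: (open_nbhs_nbhs (conj (@open_gt _ 0) fp)).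
Qed.

Lemma derivable_over_id (R : realType) (f : R -> R) (t : R) : 0 < t ->
  derivable f t 1 -> derivable (fun y => f y / y) t 1.
Proof.
move=> t0 df; have tn : t != 0 by rewrite gt_eqF.
exact: (derivableM df (derivableV tn (@derivable_id _ _ t 1))).
Qed.

Lemma near_sqrt (R : realType) (P : set R) (x : R) : 0 <= x -> (\forall y \near x, P y) ->
  \forall t \near x ^+ 2, P (Num.sqrt t).
Proof.
move=> x0 Px; have cs : {for x ^+ 2, continuous (@Num.sqrt R)} by exact: sqrt_continuous.
by apply: (cs P); rewrite sqrtr_sqr ger0_norm.
Qed.

(** The left-hand side is affine in q and positive for q = 0 and q = t r. *)
Lemma rform_gt0 (R : realType) (f g t r q : R) : 0 < f -> 0 < f + t * g -> 0 < r ->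
  0 <= q -> q <= t * r -> 0 < f * r + g * q.
Proof.
move=> f0 fg r0 q0 qt; have [g0|g0] := leP 0 g.
  by rewrite ltr_wpDr ?mulr_gt0// mulr_ge0.
apply: lt_le_trans (mulr_gt0 fg r0) _.
by rewrite mulrDl lerD2l -mulrA [t * _]mulrC -mulrA ler_nM2l// mulrC.
Qed.

Lemma sqnorm_cont (R : realType) (n : nat) : continuous (@sqnorm R n).
Proof.
move=> z A /(@sqnorm_z_cont R n (z, 0)) [[U V] [/= Uz V0] UV].
apply: filterS Uz => z' Uz'; apply: (UV (z', 0)); split => //; exact: nbhs_singleton.
Qed.

(** * Preparations on rays *)

Section Within.
Variable R : realType.
Implicit Types (I : set R) (f u w : R -> R).

Lemma is_dw_comb I u w (x l m c d : R) : is_dw I u x l -> is_dw I w x m ->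
  is_dw I (fun y => c * u y + d * w y) x (c * l + d * m).
Proof.
move=> du dw; have FF : Filter (within I x^') by exact: within_filter.
rewrite /is_dw (_ : quotient_at _ x =
  (fun y => c * quotient_at u x y + d * quotient_at w x y)); last first.
  by apply/funext => y; rewrite /quotient_at; ring.
exact: (cvgD (cvgM (cvg_cst c) du) (cvgM (cvg_cst d) dw)).
Qed.

Lemma is_dw_over_id I f (x l : R) : x != 0 -> I x -> is_dw I f x l ->
  is_dw I (fun y => f y / y) x (l * x^-1 + f x * - x ^- 2).
Proof.
move=> x0 Ix df; have FF : Filter (within I x^') by exact: within_filter.
have dV : is_dw I (fun y : R => y^-1) x (- x ^- 2).
  have := @is_deriveV _ id x 1 1 x0 (is_derive_id x 1).
  by rewrite /GRing.scale /= mulr1 => /is_derive_dw; exact.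
have cf : f y @[y --> within I x^'] --> f x.
  apply/(@cvgrPdist_lt _ _ _ _ FF) => eps eps0.
  by apply: filterS (dw_cont df Ix eps0) => y H _; exact: H.
rewrite /is_dw (_ : quotient_at _ x = (fun y => quotient_at f x y * x^-1 +
    f y * quotient_at (fun y => y^-1) x y)); last first.
  by apply/funext => y; rewrite /quotient_at; ring.
exact: (cvgD (cvgM df (cvg_cst x^-1)) (cvgM cf dV)).
Qed.

(** The difference quotients at 0 are at least c on the right and at most - c on
    the left. *)
Lemma cusp_not_derivable (u : R -> R) (c : R) : 0 < c ->
  (forall x, c * `|x| <= u x - u 0) -> ~ derivable u 0 1.
Proof.
move=> c0 H /derivableP /is_derive1_caratheodory[k [kE ck _]].
have /cvgrPdist_lt /(_ c c0) /nbhs_ballP[d /= d0 dk] := ck.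
have d2 : 0 < d / 2 by rewrite divr_gt0.
have b1 : `|k 0 - k (d / 2)| < c.
  by apply: dk; rewrite /ball /= sub0r normrN gtr0_norm//; lra.
have b2 : `|k 0 - k (- (d / 2))| < c.
  by apply: dk; rewrite /ball /= sub0r normrN normrN gtr0_norm//; lra.
have h1 := H (d / 2); have h2 := H (- (d / 2)).
rewrite kE subr0 gtr0_norm// ler_pM2r// in h1.
rewrite kE subr0 normrN gtr0_norm// mulrN -mulNr ler_pM2r// in h2.
move: b1 b2; rewrite !ltr_norml => /andP[b1 b1'] /andP[b2 b2']; lra.
Qed.

End Within.

Section UnitaryRanders.
Variables (R : realType) (n : nat) (D : set 'cV[R[i]]_n) (F : T10 R n -> R).
Variables (phi : R -> R -> R) (a : 'cV[R[i]]_n -> 'M[R[i]]_n) (b : 'cV[R[i]]_n -> 'rV[R[i]]_n).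
Hypothesis n2 : (2 <= n)%N.
Hypothesis oD : open D.
Hypothesis aS : forall i j, Csmooth_on D (fun z => a z i j).
Hypothesis bS : forall i, Csmooth_on D (fun z => b z 0 i).
Hypothesis aH : forall z i j, D z -> a z j i = (a z i j)^*%C.
Hypothesis a_pos : forall z v, D z -> v != 0 -> 0 < herm_form (a z) v.
Hypothesis F_ab : forall z v, D z ->
  F (z, v) = Num.sqrt (complex.Re (herm_form (a z) v)) + Normc.normc (lform (b z) v).
Hypothesis F_phi : forall z v, D z ->
  F (z, v) = Num.sqrt (sqnorm v * phi (sqnorm z) (svar z v)).

Local Notation I := (trange D).
Local Notation hA := (ha a).
Local Notation hB := (hb b).

Lemma ha_smooth w : smooth_on D (fun z => hA z w).
Proof.
apply: smooth_alg_smooth => //.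
have cst (c : R[i]) : Calg D (fun=> c) by split; exact: smooth_alg_cst.
have [] // : Calg D (fun z => \sum_(i < n) \sum_(j < n)
   a z i j * w i 0 * (w j 0)^*%C).
apply: Calg_sum => i; apply: Calg_sum => j.
by apply: Calg_mul => //; apply: Calg_mul => //; exact: Calg_smooth.
Qed.

Lemma hb_smooth w : smooth_on D (fun z => hB z w ^+ 2).
Proof.
apply: smooth_alg_smooth => //; apply: smooth_alg_normc; apply: Calg_sum => i.
apply: Calg_mul; first exact: Calg_smooth (bS i).
by split; exact: smooth_alg_cst.
Qed.

Lemma ray_derivable (f : 'cV[R[i]]_n -> R) e x : smooth_on D f -> 0 < x -> D (x%:C *: e) ->
  derivable (fun t => f ((Num.sqrt t)%:C *: e)) (x ^+ 2) 1.
Proof.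
move=> sf x0 Dx; have [d d0 dD] := ray_near oD Dx.
have [K K0 DK] := smooth1_ray (J := [set y | `|y - x| < d]) sf dD.
have sx : Num.sqrt (x ^+ 2) = x by rewrite sqrtr_sqr gtr0_norm.
have dK : is_derive (Num.sqrt (x ^+ 2)) 1 (K 0%N) (K 1%N x).
  by rewrite sx; apply: DK; rewrite /= subrr normr0.
have x2 : 0 < x ^+ 2 by rewrite exprn_gt0.
have [+ _] := is_derive1_comp dK (is_derive1_sqrt x2).
by rewrite K0.
Qed.

Lemma ray_continuous (f : 'cV[R[i]]_n -> R) e (x : R) : smooth_on D f -> D (x%:C *: e) ->
  {for x, continuous (fun y : R => f (y%:C *: e))}.
Proof.
move=> sf Dx; have [d d0 dD] := ray_near oD Dx.
have [K K0 DK] := smooth1_ray (J := [set y | `|y - x| < d]) sf dD.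
rewrite -K0; apply: differentiable_continuous; apply/derivable1_diffP.
have Jx : [set y | `|y - x| < d] x by rewrite /= subrr normr0.
by have [] := DK 0%N x Jx.
Qed.

Lemma near_over (z v : 'cV[R[i]]_n) : D z -> \forall q \near ((z, v) : T10 R n), D q.1.
Proof.
move=> Dz; have Dq : (D `*` [set: 'cV[R[i]]_n]) (z, v) by [].
by have := open_nbhs_nbhs (conj (open_over oD) Dq); apply: filterS => q [].
Qed.

Lemma near_t (z v : 'cV[R[i]]_n) (P : set R) : (\forall t \near sqnorm z, P t) ->
  \forall q \near ((z, v) : T10 R n), P (sqnorm q.1).
Proof. exact: (@sqnorm_z_cont R n (z, v)). Qed.

(** * Necessity *)

Section Necessity.
Hypothesis wk : weakly_kahler D F.

Lemma wk_at z v : D z -> v != 0 -> lform (b z) v != 0 -> weakly_kahler_at F z v.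
Proof.
move=> Dz v0 bv; apply: wk => //.
exact: (randers_smooth_at oD aS bS a_pos F_ab).
Qed.

Section Frame.
Variables (e u : 'cV[R[i]]_n).
Hypotheses (e1 : sqnorm e = 1) (u1 : sqnorm u = 1) (ue : hdot u e = 0).

(** A unit vector v with |<z, v>|^2 = s at the points z = x e with x^2 = t. *)
Definition frame_vec (s t : R) := (Num.sqrt (s / t))%:C *: e + (Num.sqrt (1 - s / t))%:C *: u.

Lemma frame_vec_r s t : 0 <= s -> s <= t -> 0 < t -> sqnorm (frame_vec s t) = 1.
Proof.
move=> s0 st t0; rewrite sqnorm_comb// !normc_real !real_normK ?num_real//.
have h1 : 0 <= s / t by rewrite divr_ge0// ltW.
have h2 : 0 <= 1 - s / t by rewrite subr_ge0 ler_pdivrMr// mul1r.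
by rewrite !sqr_sqrtr// addrC subrK.
Qed.

Lemma frame_vec_q x s t : 0 <= s -> 0 < t -> t = x ^+ 2 -> qfun (x%:C *: e, frame_vec s t) = s.
Proof.
move=> s0 t0 tx; rewrite qfun_comb// normc_real real_normK ?num_real//.
rewrite sqr_sqrtr; last by rewrite divr_ge0 // ltW.
by rewrite -tx mulrC divfK// gt_eqF.
Qed.

Lemma frame_vec_neq0 s t : 0 <= s -> s <= t -> 0 < t -> frame_vec s t != 0.
Proof. by move=> s0 st t0; rewrite -sqnorm_eq0 frame_vec_r// oner_eq0. Qed.

(** If the 1-form does not kill u, it kills e by [ray_diagonal], and |beta|^2 =
    h (t r - q) near x e: this is the case excluded by [typeII_absurd]. *)
Lemma no_typeII x : 0 < x -> D (x%:C *: e) -> hB (x%:C *: e) u = 0.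
Proof.
move=> x0 Dx; have [//|bu0] := eqVneq (hB (x%:C *: e) u) 0; exfalso.
pose t0 := x ^+ 2; have t0p : 0 < t0 by rewrite exprn_gt0.
pose z t := (Num.sqrt t)%:C *: e.
have zt0 : z t0 = x%:C *: e by rewrite /z sqrtr_sqr gtr0_norm.
pose f t := hA (z t) u; pose g t := (hA (z t) e - hA (z t) u) / t.
(* |beta|^2 = h (t r - q) = k r + l q. *)
pose h t := hB (z t) u ^+ 2 / t; pose k t := h t * t; pose l t := - h t.
have [d0 d0p d0D] := ray_near oD Dx.
have bnear : \forall y \near x, 0 < hB (y%:C *: e) u ^+ 2.
  apply: (near_gt0 (ray_continuous (hb_smooth u) Dx)).
  by rewrite exprn_gt0// lt_def bu0 normc_ge0.
have good : \forall t \near t0, [/\ 0 < t, D (z t) & 0 < hB (z t) u ^+ 2].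
  have n1 : \forall t \near t0, 0 < hB (z t) u ^+ 2.
    exact: (near_sqrt (P := fun y => 0 < hB (y%:C *: e) u ^+ 2) (ltW x0) bnear).
  have n3 : \forall t \near t0, D (z t).
    apply: (near_sqrt (P := fun y => D (y%:C *: e)) (ltW x0)).
    by apply/nbhs_ballP; exists d0 => // y; rewrite /ball /= distrC => /d0D.
  have n4 : \forall t \near t0, 0 < t by exact: (open_nbhs_nbhs (conj (@open_gt _ 0) t0p)).
  by apply: filterS3 n1 n3 n4 => t ? ? ?.
have derf w t : 0 < t -> D (z t) -> derivable (fun t => hA (z t) w) t 1.
  move=> tp Dz; have := ray_derivable (ha_smooth w) (x := Num.sqrt t).
  by rewrite sqrtr_gt0 sqr_sqrtr ?ltW//; apply.
have derb w t : 0 < t -> D (z t) -> derivable (fun t => hB (z t) w ^+ 2) t 1.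
  move=> tp Dz; have := ray_derivable (hb_smooth w) (x := Num.sqrt t).
  by rewrite sqrtr_gt0 sqr_sqrtr ?ltW//; apply.
have derh t : 0 < t -> D (z t) -> derivable h t 1.
  by move=> tp Dz; apply: (derivable_over_id (f := fun t => hB (z t) u ^+ 2) tp); exact: derb.
have dw t : 0 < t -> D (z t) ->
  [/\ is_dw I f t (derive_within I f t), is_dw I g t (derive_within I g t),
      is_dw I k t ('D_1 h t * t + h t) & is_dw I l t (- 'D_1 h t)].
  move=> tp Dz; split.
  - exact/derivable_dw/derf.
  - apply: derivable_dw; apply: (derivable_over_id (f := fun t => hA (z t) e - hA (z t) u) tp).
    by apply: (derivableB (derf e t tp Dz) (derf u t tp Dz)).
  - apply: is_derive_dw; have dh := derivableP (derh t tp Dz).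
    have := is_deriveM dh (is_derive_id t (1 : R)).
    by congr is_derive; rewrite /GRing.scale /=; ring.
  - apply: is_derive_dw; have dh := derivableP (derh t tp Dz).
    exact: is_deriveN dh.
have f0 t : D (z t) -> 0 < f t.
  by move=> Dz; apply: (ha_gt0 a_pos Dz); rewrite -sqnorm_eq0 u1 oner_eq0.
have fg t : 0 < t -> f t + t * g t = hA (z t) e.
  by move=> tp; rewrite /f /g; field; rewrite gt_eqF.
have fg0 t : 0 < t -> D (z t) -> 0 < f t + t * g t.
  by move=> tp Dz; rewrite fg//; apply: (ha_gt0 a_pos Dz); rewrite -sqnorm_eq0 e1 oner_eq0.
apply: (@typeII_absurd R (f t0) (g t0) (h t0) (derive_within I f t0) (derive_within I g t0)
  ('D_1 h t0) t0 t0) => //.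
- by rewrite f0// zt0.
- by rewrite divr_gt0// zt0 exprn_gt0// lt_def bu0 normc_ge0.
- by rewrite fg0// zt0.
move=> s Ps Qs s0 st det0.
pose v := frame_vec s t0; pose p : T10 R n := (x%:C *: e, v).
have v0 : v != 0 by rewrite frame_vec_neq0// ltW.
have zE : sqnorm (x%:C *: e) = t0 by exact: sqnorm_ray.
have vE : sqnorm v = 1 by rewrite frame_vec_r// ltW.
have qE : qfun p = s by exact: frame_vec_q.
have [_ be0] := ray_diagonal aH a_pos F_ab F_phi e1 u1 ue Dx.
have bv : lform (b (x%:C *: e)) v != 0.
  have be : lform (b (x%:C *: e)) e = 0.
    by case: be0 => [/eqP|E]; [rewrite normc_eq0 => /eqP|rewrite E eqxx in bu0].
  rewrite /v /frame_vec lform_comb be mulr0 add0r mulf_neq0//.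
    by rewrite (inj_eq (@complexI R)) gt_eqF// sqrtr_gt0 subr_gt0 ltr_pdivrMr// mul1r.
  by rewrite -normc_eq0.
have W := wk_at Dx v0 bv.
have goodp : \forall q \near p, [/\ 0 < sqnorm q.1, D (z (sqnorm q.1)) &
    0 < hB (z (sqnorm q.1)) u ^+ 2].
  apply: (@near_t _ _ (fun t => [/\ 0 < t, D (z t) & 0 < hB (z t) u ^+ 2])).
  by rewrite zE.
have nD : \forall q \near p, D q.1 by exact: near_over.
have Ip : \forall q \near p, I (sqnorm q.1) by apply: filterS nD => q Dq; exists q.1.
have dwp : \forall q \near p,
  [/\ is_dw I f (sqnorm q.1) (derive_within I f (sqnorm q.1)),
      is_dw I g (sqnorm q.1) (derive_within I g (sqnorm q.1)),
      is_dw I k (sqnorm q.1) ((fun t => 'D_1 h t * t + h t) (sqnorm q.1)) &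
      is_dw I l (sqnorm q.1) ((fun t => - 'D_1 h t) (sqnorm q.1))].
  by apply: filterS goodp => q [tp Dz _]; exact: dw.
have nv : \forall q \near p, 0 < sqnorm q.2.
  by apply: (near_gt0 (@sqnorm_v_cont R n p)); rewrite /= vE.
have nq : \forall q \near p, 0 < sqnorm q.1 * sqnorm q.2 - qfun q.
  have c : {for p, continuous (fun q => sqnorm q.1 * sqnorm q.2 - qfun q)}.
    apply: cvgB; last exact: qfun_cont.
    by apply: cvgM; [exact: sqnorm_z_cont|exact: sqnorm_v_cont].
  by apply: (near_gt0 c); rewrite /= zE vE qE mulr1 subr_gt0.
have Fp : \forall q \near p,
  [/\ 0 < rform f g q, 0 < rform k l q &
      F q ^+ 2 = (Num.sqrt (rform f g q) + Num.sqrt (rform k l q)) ^+ 2].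
  near=> q.
  have [tp Dz bz] : [/\ 0 < sqnorm q.1, D (z (sqnorm q.1)) &
    0 < hB (z (sqnorm q.1)) u ^+ 2] by near: q.
  have Dq : D q.1 by near: q.
  have rp : 0 < sqnorm q.2 by near: q.
  have qp : 0 < sqnorm q.1 * sqnorm q.2 - qfun q by near: q.
  set t := sqnorm q.1 in tp Dz bz qp *; set r := sqnorm q.2 in rp qp *.
  have st0 : Num.sqrt t != 0 by rewrite gt_eqF// sqrtr_gt0.
  have tE : sqnorm q.1 = Num.sqrt t ^+ 2 by rewrite sqr_sqrtr ?ltW.
  have bz0 : hB (z t) e = 0.
    have [_ [//|E]] := ray_diagonal aH a_pos F_ab F_phi e1 u1 ue Dz.
    by rewrite E expr0n ltxx in bz.
  have r1 : rform f g q = qfun q / t * hA (z t) e + (r - qfun q / t) * hA (z t) u.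
    by rewrite /rform -/t -/r /f /g; field; rewrite gt_eqF.
  have r2 : rform k l q = (r - qfun q / t) * hB (z t) u ^+ 2.
    by rewrite /rform -/t -/r /k /l /h; field; rewrite gt_eqF.
  have rq : 0 < r - qfun q / t by rewrite subr_gt0 ltr_pdivrMr// mulrC -subr_gt0.
  have he : 0 < hA (z t) e by apply: (ha_gt0 a_pos Dz); rewrite -sqnorm_eq0 e1 oner_eq0.
  split.
  - rewrite r1 ltr_wpDl ?mulr_gt0 ?f0//.
    by rewrite mulr_ge0 ?divr_ge0 ?qfun_ge0// ltW.
  - by rewrite r2 mulr_gt0.
  - congr (_ ^+ 2); have := F_ray aH a_pos F_ab F_phi e1 u1 ue st0 Dz q.2 Dq tE.
    rewrite -!tE -/t -/r -r1 bz0 mulr0 add0r => E.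
    have <- : F (q.1, q.2) = F q by case: (q).
    rewrite E; congr (_ + _); rewrite r2 sqrtrM ?ltW// sqrtr_sqr ger0_norm ?normc_ge0//.
have := @weakly_kahler_num R n F I (x%:C *: e) v f g k l (derive_within I f)
  (derive_within I g) (fun t => 'D_1 h t * t + h t) (fun t => - 'D_1 h t)
  (randers_smooth_at oD aS bS a_pos F_ab Dx bv) v0 Ip dwp Fp.
rewrite zE vE qE !mulr1 divr1 => H.
have lE : k t0 + l t0 * s = h t0 * (t0 - s) by rewrite /k /l; ring.
rewrite lE in H.
have a0 : 0 < Num.sqrt (f t0 + g t0 * s) by rewrite sqrtr_gt0.
have b0 : 0 < Num.sqrt (h t0 * (t0 - s)) by rewrite sqrtr_gt0.
have ft0 : 0 < f t0 by rewrite f0// zt0.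
have kt0 : 0 < k t0.
  by rewrite mulr_gt0// divr_gt0// zt0 exprn_gt0// lt_def bu0 normc_ge0.
have nr : num_r (f t0) (k t0) (Num.sqrt (f t0 + g t0 * s))
    (Num.sqrt (h t0 * (t0 - s))) != 0.
  rewrite /num_r gt_eqF//; apply: addr_gt0; apply: mulr_gt0 => //;
  by rewrite addr_gt0// divr_gt0.
have [/(_ W)[E|//] _] := H nr det0.
by rewrite E ltxx in st.
Unshelve. all: by end_near. Qed.

End Frame.

Section FrameValues.
Variables (e u : 'cV[R[i]]_n).
Hypotheses (e1 : sqnorm e = 1) (u1 : sqnorm u = 1) (ue : hdot u e = 0).

(** This extends [no_typeII] to x < 0 by changing the sign of e, and to x = 0 by
    continuity. *)
Lemma one_form_radial x : D (x%:C *: e) -> hB (x%:C *: e) u = 0.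
Proof.
move=> Dx; have [xn|xp|x0] := ltgtP x 0; last 2 first.
- exact: no_typeII.
- have [d d0 dD] := ray_near oD Dx.
  have c : (fun y => hB (y%:C *: e) u ^+ 2) y @[y --> 0^'+] --> hB ((0 : R)%:C *: e) u ^+ 2.
    apply: cvg_at_right_filter; apply: (ray_continuous (x := 0) (hb_smooth u)).
    by rewrite -x0.
  have H : hB ((0 : R)%:C *: e) u ^+ 2 = 0.
    apply: (zero_at_right d0 c) => y y0 yd; rewrite no_typeII ?expr0n//.
    by apply: dD; rewrite x0 subr0 gtr0_norm.
  by move/eqP: H; rewrite x0 sqrf_eq0 => /eqP.
- have E : x%:C *: e = (- x)%:C *: (- e).
    by rewrite scalerN -scaleNr (_ : (- x)%:C = - x%:C) ?opprK//; exact: rmorphN.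
  have oppE (y : 'cV[R[i]]_n) : - y = (-1) *: y by rewrite scaleN1r.
  rewrite E; apply: no_typeII; rewrite ?oppr_gt0 -?E//.
    by rewrite oppE sqnormZ e1 mulr1 /= sqrrN expr1n oppr0 expr0n addr0 sqrtr1 expr1n.
  by rewrite oppE hdotZr ue mulr0.
Qed.

Lemma F_radial x z v : x != 0 -> D (x%:C *: e) -> D z -> sqnorm z = x ^+ 2 ->
  F (z, v) = Num.sqrt (qfun (z, v) / x ^+ 2 * hA (x%:C *: e) e +
                       (sqnorm v - qfun (z, v) / x ^+ 2) * hA (x%:C *: e) u) +
             Num.sqrt (qfun (z, v) / x ^+ 2) * hB (x%:C *: e) e.
Proof.
move=> x0 Dx Dz zx.
have := F_ray aH a_pos F_ab F_phi e1 u1 ue x0 Dx v Dz zx.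
by rewrite one_form_radial// mulr0 addr0.
Qed.

Lemma phi_radial x s : x != 0 -> D (x%:C *: e) -> 0 <= s -> s <= x ^+ 2 ->
  phi (x ^+ 2) s = (Num.sqrt (s / x ^+ 2 * hA (x%:C *: e) e +
                       (1 - s / x ^+ 2) * hA (x%:C *: e) u) +
             Num.sqrt (s / x ^+ 2) * hB (x%:C *: e) e) ^+ 2.
Proof.
move=> x0 Dx s0 st; have t0 : 0 < x ^+ 2 by rewrite exprn_even_gt0.
pose v := frame_vec e u s (x ^+ 2).
have v1 : sqnorm v = 1 by exact: frame_vec_r.
have vq : qfun (x%:C *: e, v) = s by exact: frame_vec_q.
have v0 : v != 0 by rewrite -sqnorm_eq0 v1 oner_eq0.
have := F2_phi a_pos F_ab F_phi Dx v0; rewrite (F_radial _ x0 Dx Dx (sqnorm_ray x e1)).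
rewrite -[svar (x%:C *: e) v]/(qfun (x%:C *: e, v) / sqnorm v).
by rewrite sqnorm_ray// v1 vq mul1r divr1 => ->.
Qed.

(** The right-hand side is smooth in x, with no exception at x = 0. *)
Lemma phi_at0 x : D (x%:C *: e) -> phi (x ^+ 2) 0 = hA (x%:C *: e) u.
Proof.
move=> Dx; have u0 : u != 0 by rewrite -sqnorm_eq0 u1 oner_eq0.
have := F2_phi a_pos F_ab F_phi Dx u0.
have -> : svar (x%:C *: e) u = 0.
  rewrite -[svar _ _]/(qfun (x%:C *: e, u) / sqnorm u).
  have -> : qfun (x%:C *: e, u) = 0.
    by apply: complexI; rewrite qfunE /= hdotZr ue mulr0 mul0r.
  by rewrite mul0r.
rewrite sqnorm_ray// u1 mul1r => <-.
rewrite F_ab// -/(hB _ _) one_form_radial// addr0 sqr_sqrtr//.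
exact: ltW (ha_gt0 a_pos Dx u0).
Qed.

End FrameValues.

(** The coefficients of phi = (sqrt (f + g s) + sqrt (h s))^2, recovered from
    phi. At s = t and s = t/4 the terms in h cancel from 2 sqrt phi (t, t/4) -
    sqrt phi (t, t) = sqrt (3 f + X^2) - X, where X^2 = f + t g; this determines
    [coef_x] = X rationally. *)
Definition coef_f t := phi t 0.
Definition coef_x t := let d := 2 * Num.sqrt (phi t (t / 4)) - Num.sqrt (phi t t) in
  (3 * coef_f t - d ^+ 2) / (2 * d).
Definition coef_g t := (coef_x t ^+ 2 - coef_f t) / t.
Definition coef_h t := (Num.sqrt (phi t t) - coef_x t) ^+ 2 / t.

Lemma coef_values e u x : sqnorm e = 1 -> sqnorm u = 1 -> hdot u e = 0 ->
  x != 0 -> D (x%:C *: e) -> let t := x ^+ 2 in let z := x%:C *: e in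
  [/\ coef_f t = hA z u, coef_g t = (hA z e - hA z u) / t & coef_h t = hB z e ^+ 2 / t].
Proof.
move=> e1 u1 ue x0 Dx t z; have t0 : 0 < t by rewrite /t exprn_even_gt0.
have fE : coef_f t = hA z u by exact: phi_at0.
have e0 : e != 0 by rewrite -sqnorm_eq0 e1 oner_eq0.
have u0 : u != 0 by rewrite -sqnorm_eq0 u1 oner_eq0.
have pe := ha_gt0 a_pos Dx e0; have pu := ha_gt0 a_pos Dx u0.
have b0 : 0 <= hB z e by exact: normc_ge0.
have s1 : Num.sqrt (phi t t) = Num.sqrt (hA z e) + hB z e.
  rewrite /t (phi_radial e1 u1 ue)//; last exact: ltW.
  rewrite mulfV ?gt_eqF// subrr mul0r addr0 mul1r sqrtr1 mul1r sqrtr_sqr.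
  by rewrite ger0_norm// addr_ge0// sqrtr_ge0.
have s2 : 2 * Num.sqrt (phi t (t / 4)) = Num.sqrt (hA z e + 3 * hA z u) + hB z e.
  have t4 : 0 <= t / 4 by rewrite divr_ge0// ltW.
  rewrite /t (phi_radial e1 u1 ue)//; last by rewrite ler_pdivrMr// ler_peMr ?ltW// ltr1n.
  have q4 : x ^+ 2 / 4 / x ^+ 2 = (2^-1) ^+ 2 by field; rewrite x0.
  have -> : x ^+ 2 / 4 / x ^+ 2 * hA (x%:C *: e) e +
      (1 - x ^+ 2 / 4 / x ^+ 2) * hA (x%:C *: e) u =
      (hA z e + 3 * hA z u) * (2^-1) ^+ 2 by rewrite -/z; field; rewrite x0.
  have h4 : Num.sqrt ((2^-1) ^+ 2 : R) = 2^-1 by rewrite sqrtr_sqr ger0_norm// invr_ge0.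
  rewrite q4 sqrtr_sqr ger0_norm; last first.
    by rewrite addr_ge0 ?mulr_ge0 ?sqrtr_ge0.
  rewrite (@sqrtrM _ (hA z e + 3 * hA z u)); last by rewrite addr_ge0 ?mulr_ge0// ltW.
  rewrite h4.
  by rewrite -/z; field.
set P := hA z e + 3 * hA z u in s2.
have PA : hA z e < P by rewrite /P ltrDl mulr_gt0.
have P0 : 0 < P by exact: lt_trans PA.
have sPA : Num.sqrt (hA z e) < Num.sqrt P by rewrite ltr_sqrt.
have xE : coef_x t = Num.sqrt (hA z e).
  rewrite /coef_x s1 s2 fE.
  have -> : Num.sqrt P + hB z e - (Num.sqrt (hA z e) + hB z e) =
    Num.sqrt P - Num.sqrt (hA z e) by ring.
  have -> : 3 * hA z u = Num.sqrt P ^+ 2 - Num.sqrt (hA z e) ^+ 2.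
    by rewrite !sqr_sqrtr ?ltW// /P; ring.
  by field; rewrite subr_eq0 gt_eqF.
split=> //; first by rewrite /coef_g xE fE sqr_sqrtr// ltW.
by rewrite /coef_h xE s1 addrAC subrr add0r.
Qed.

Lemma exists_frame z : D z -> exists e u x, [/\ sqnorm e = 1, sqnorm u = 1, hdot u e = 0,
  0 <= x & z = x%:C *: e].
Proof.
move=> Dz; have [e [x [e1 x0 zE]]] := polar z n2.
by have [u u1 ue] := exists_orthogonal e n2; exists e, u, x.
Qed.

Lemma frame_of_t t : I t -> exists e u x, [/\ sqnorm e = 1, sqnorm u = 1, hdot u e = 0,
  0 <= x & t = x ^+ 2 /\ D (x%:C *: e)].
Proof.
move=> [z Dz zt]; have [e [u [x [e1 u1 ue x0 zE]]]] := exists_frame Dz.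
exists e, u, x; split=> //; split; last by rewrite -zE.
by rewrite -zt zE sqnorm_ray.
Qed.

Lemma coef_f_gt0 t : I t -> 0 < coef_f t.
Proof.
move=> /frame_of_t[e [u [x [e1 u1 ue x0 [-> Dx]]]]].
rewrite /coef_f (phi_at0 e1 u1 ue)//; apply: (ha_gt0 a_pos Dx).
by rewrite -sqnorm_eq0 u1 oner_eq0.
Qed.

Lemma coef_fg_gt0 t : I t -> 0 < t -> 0 < coef_f t + t * coef_g t.
Proof.
move=> /frame_of_t[e [u [x [e1 u1 ue x0 [-> Dx]]]]] t0.
have xn0 : x != 0 by move: t0; apply: contraTneq => ->; rewrite expr0n ltxx.
have [-> -> _] := coef_values e1 u1 ue xn0 Dx.
rewrite mulrC divfK ?gt_eqF// addrC subrK; apply: (ha_gt0 a_pos Dx).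
by rewrite -sqnorm_eq0 e1 oner_eq0.
Qed.

Lemma coef_h_ge0 t : 0 <= t -> 0 <= coef_h t.
Proof. by move=> t0; rewrite divr_ge0// sqr_ge0. Qed.

Lemma F_coef z v : D z -> z != 0 -> let t := sqnorm z in
  F (z, v) = Num.sqrt (rform coef_f coef_g (z, v)) + Num.sqrt (coef_h t * qfun (z, v)).
Proof.
move=> Dz z0 t; have [e [u [x [e1 u1 ue x0 zE]]]] := exists_frame Dz.
have xn0 : x != 0 by apply: contra z0 => /eqP x00; rewrite zE x00 scale0r.
have zx : t = x ^+ 2 by rewrite /t zE sqnorm_ray.
have Dx : D (x%:C *: e) by rewrite -zE.
have x2 : 0 < x ^+ 2 by rewrite exprn_even_gt0.
rewrite (F_radial e1 u1 ue v xn0 Dx Dz zx) /rform /= -/t zx.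
have [-> -> ->] := coef_values e1 u1 ue xn0 Dx.
congr (Num.sqrt _ + _); first by field; rewrite xn0.
rewrite (_ : hB (x%:C *: e) e ^+ 2 / x ^+ 2 * qfun (z, v) =
  qfun (z, v) / x ^+ 2 * hB (x%:C *: e) e ^+ 2); last by ring.
rewrite (@sqrtrM _ (qfun (z, v) / x ^+ 2)); last by rewrite divr_ge0 ?qfun_ge0// ltW.
by rewrite sqrtr_sqr ger0_norm// normc_ge0.
Qed.

Lemma coef_dw t : I t -> 0 < t ->
  [/\ is_dw I coef_f t (derive_within I coef_f t),
      is_dw I coef_g t (derive_within I coef_g t) &
      is_dw I coef_h t (derive_within I coef_h t)].
Proof.
move=> It; have [e [u [x [e1 u1 ue x0 [tE Dx]]]]] := frame_of_t It; move=> t0.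
have xp : 0 < x.
  by rewrite lt_def x0 andbT; move: t0; rewrite tE; apply: contraTneq => ->; rewrite expr0n ltxx.
pose z y := (Num.sqrt y)%:C *: e.
have [d d0 dD] := ray_near oD Dx.
have near_val : \forall y \near t, I y -> [/\ coef_f y = hA (z y) u,
    coef_g y = (hA (z y) e - hA (z y) u) / y & coef_h y = hB (z y) e ^+ 2 / y].
  have n3 : \forall y \near t, D (z y).
    rewrite tE; apply: (near_sqrt (P := fun y => D (y%:C *: e)) x0).
    by apply/nbhs_ballP; exists d => // y; rewrite /ball /= distrC => /dD.
  have n4 : \forall y \near t, 0 < y by exact: (open_nbhs_nbhs (conj (@open_gt _ 0) t0)).
  apply: filterS2 n3 n4 => y Dy y0 Iy.
  have sy : Num.sqrt y != 0 by rewrite gt_eqF// sqrtr_gt0.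
  have := coef_values e1 u1 ue sy Dy.
  by rewrite sqr_sqrtr// ltW.
have Dt : D (z t) by rewrite /z tE sqrtr_sqr gtr0_norm.
have derf w : derivable (fun y => hA (z y) w) t 1.
  have := ray_derivable (ha_smooth w) (x := Num.sqrt t) (e := e).
  by rewrite sqrtr_gt0 sqr_sqrtr ?ltW//; apply.
have derb w : derivable (fun y => hB (z y) w ^+ 2) t 1.
  have := ray_derivable (hb_smooth w) (x := Num.sqrt t) (e := e).
  by rewrite sqrtr_gt0 sqr_sqrtr ?ltW//; apply.
have tr (c c' : R -> R) : derivable c t 1 -> (\forall y \near t, I y -> c y = c' y) ->
    is_dw I c' t (derive_within I c' t).
  move=> dc cc'; apply: is_dw_of_cvg; apply: cvgP.
  exact: (is_dw_near (derivable_dw (I := I) dc) It cc').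
split.
- apply: (tr (fun y => hA (z y) u)) => //.
  by apply: filterS near_val => y H Iy; case: (H Iy).
- apply: (tr (fun y => (hA (z y) e - hA (z y) u) / y)).
    exact: (derivable_over_id t0 (derivableB (derf e) (derf u))).
  by apply: filterS near_val => y H Iy; case: (H Iy).
- apply: (tr (fun y => hB (z y) e ^+ 2 / y)).
    exact: (derivable_over_id t0 (derb e)).
  by apply: filterS near_val => y H Iy; case: (H Iy).
Qed.

Lemma coef_near z v : D z -> z != 0 -> v != 0 -> \forall q \near ((z, v) : T10 R n),
  [/\ D q.1, 0 < sqnorm q.1 & 0 < rform coef_f coef_g q].
Proof.
move=> Dz z0 v0; have nD := @near_over z v Dz.
have nz : \forall q \near ((z, v) : T10 R n), 0 < sqnorm q.1.
  by apply: (near_gt0 (@sqnorm_z_cont R n (z, v))); rewrite /= sqnorm_gt0.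
have nv : \forall q \near ((z, v) : T10 R n), 0 < sqnorm q.2.
  by apply: (near_gt0 (@sqnorm_v_cont R n (z, v))); rewrite /= sqnorm_gt0.
apply: filterS3 nD nz nv => q Dq tp rp; have It : I (sqnorm q.1) by exists q.1.
split=> //.
exact: (rform_gt0 (coef_f_gt0 It) (coef_fg_gt0 It tp) rp (qfun_ge0 q) (qfun_le q)).
Qed.

Lemma coef_dw_near z v : D z -> z != 0 -> v != 0 -> \forall q \near ((z, v) : T10 R n),
  [/\ is_dw I coef_f (sqnorm q.1) (derive_within I coef_f (sqnorm q.1)),
      is_dw I coef_g (sqnorm q.1) (derive_within I coef_g (sqnorm q.1)) &
      is_dw I coef_h (sqnorm q.1) (derive_within I coef_h (sqnorm q.1))].
Proof.
move=> Dz z0 v0; apply: filterS (coef_near Dz z0 v0) => q [Dq tp _].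
by apply: coef_dw => //; exists q.1.
Qed.

(** The weak Kaehler condition at the vectors [frame_vec] with 0 < s < t is the
    hypothesis of [typeI_limit]. *)
Lemma coef_pde t : I t -> 0 < t -> 0 < coef_h t -> let f' := derive_within I coef_f t in
  coef_g t = (t * f' - coef_f t) / (2 * t) /\ coef_h t = (t * f' + coef_f t) / (2 * t).
Proof.
move=> It t0 h0 f'; have [e [u [x [e1 u1 ue x0 [tE Dx]]]]] := frame_of_t It.
have xn0 : x != 0 by move: t0; rewrite tE; apply: contraTneq => ->; rewrite expr0n ltxx.
have f0 := coef_f_gt0 It; have ftg := coef_fg_gt0 It t0.
apply: (@typeI_limit _ _ _ _ _ (derive_within I coef_g t) (derive_within I coef_h t)) => //.
move=> s s0 st; pose z := x%:C *: e; pose v := frame_vec e u s t.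
have zt : sqnorm z = t by rewrite tE; exact: sqnorm_ray.
have vr : sqnorm v = 1 by apply: frame_vec_r => //; exact: ltW.
have qE : qfun (z, v) = s by apply: frame_vec_q => //; exact: ltW.
have v0 : v != 0 by rewrite -sqnorm_eq0 vr oner_eq0.
have z0 : z != 0 by rewrite -sqnorm_eq0 zt gt_eqF.
have [_ _ hE] := coef_values e1 u1 ue xn0 Dx; rewrite -tE -/z in hE.
have bv : lform (b z) v != 0.
  have bu : lform (b z) u = 0.
    by have /eqP := one_form_radial e1 u1 ue Dx; rewrite normc_eq0 => /eqP.
  rewrite /v /frame_vec lform_comb bu mulr0 addr0 mulf_neq0//.
    by rewrite (inj_eq (@complexI R)) gt_eqF// sqrtr_gt0 divr_gt0.
  by move: h0; rewrite hE; apply: contraTneq => be; rewrite /hb be normc_real normr0 expr0n mul0r ltxx.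
have W := wk_at Dx v0 bv.
have h_near : \forall y \near t, I y -> 0 < coef_h y.
  have [_ _ dh] := coef_dw It t0.
  apply: filterS (dw_cont dh It h0) => y H Iy; move: (H Iy).
  by rewrite ltr_norml ltrBlDr => /andP[_]; rewrite ltrDl.
rewrite -zt in h_near; have h_nearp := near_t v h_near.
have q_near : \forall q \near ((z, v) : T10 R n), 0 < qfun q.
  by apply: (near_gt0 (@qfun_cont R n (z, v))); rewrite qE.
have dw := coef_dw_near Dx z0 v0; have cn := coef_near Dx z0 v0.
have := @weakly_kahler_typeI R n F I z v coef_f coef_g (derive_within I coef_f)
  (derive_within I coef_g) (randers_smooth_at oD aS bS a_pos F_ab Dx bv) v0.
rewrite zt vr qE mulr1 divr1 => H.
have [] := (H _ _ f0 ftg coef_h (derive_within I coef_h) _ _).1 W.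
- by apply: filterS (near_over v Dx) => q Dq; exists q.1.
- by apply: filterS dw => q [].
- by apply: filterS dw => q [].
- apply: filterS3 h_nearp q_near cn => q hq qq [Dq tp rf].
  have It' : I (sqnorm q.1) by exists q.1.
  split=> //; first by rewrite mulr_gt0// hq.
  have <- : F (q.1, q.2) = F q by case: (q).
  have q0 : q.1 != 0 by rewrite -sqnorm_gt0.
  by rewrite (F_coef q.2 Dq q0); case: (q).
- by move=> E; rewrite E ltxx in st.
- by rewrite [s * coef_h t]mulrC.
Qed.

Lemma trange_connected : connected D -> is_interval I.
Proof.
move=> cD; apply/connected_intervalP; apply: connected_continuous_connected => //.
apply: continuous_subspaceT; exact: sqnorm_cont.
Qed.

Lemma coef_cont (c : R -> R) (J : set R) t l : J `<=` I -> I t -> is_dw I c t l ->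
  c y @[y --> within J (nbhs t)] --> c t.
Proof.
move=> JI It dc; have FF : Filter (within J (nbhs t)) by exact: within_filter.
apply/(@cvgrPdist_lt _ _ _ _ FF) => eps eps0.
by have := dw_cont dc It eps0; apply: filterS => y H /JI; exact: H.
Qed.

(** Where h > 0, [coef_pde] gives f + t g = t h, so the continuous function t h
    / (f + t g) has its values in {0, 1} and is constant on the interval of
    positive values of t. *)
Lemma coef_h_dichotomy : connected D ->
  (forall t, I t -> 0 < t -> coef_h t = 0) \/ (forall t, I t -> 0 < t -> 0 < coef_h t).
Proof.
move=> /trange_connected cI; apply: contrapT => /not_orP[/existsNP[t1 H1] /existsNP[t2 H2]].
have [It1 [tp1 h1]] : I t1 /\ 0 < t1 /\ coef_h t1 <> 0.
  by move/not_implyP: H1 => [? /not_implyP[]].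
have [It2 [tp2 h2]] : I t2 /\ 0 < t2 /\ ~ 0 < coef_h t2.
  by move/not_implyP: H2 => [? /not_implyP[]].
pose psi t := t * coef_h t / (coef_f t + t * coef_g t).
have psi01 t : I t -> 0 < t -> coef_h t = 0 /\ psi t = 0 \/ 0 < coef_h t /\ psi t = 1.
  move=> It t0; have [h0|h0] := eqVneq (coef_h t) 0.
    by left; rewrite /psi h0 mulr0 mul0r.
  have hp : 0 < coef_h t by rewrite lt_def h0 coef_h_ge0// ltW.
  right; split => //; have [gE hE] := coef_pde It t0 hp.
  rewrite /psi; have -> : coef_f t + t * coef_g t = t * coef_h t.
    by rewrite gE hE; field; rewrite gt_eqF.
  by rewrite mulfV// mulf_neq0// gt_eqF.
have p1 : psi t1 = 1 by have [[]|[]] := psi01 t1 It1 tp1.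
have p2 : psi t2 = 0 by have [[]|[]] := psi01 t2 It2 tp2.
pose l := Num.min t1 t2; pose m := Num.max t1 t2.
have lm : l <= m by rewrite ge_min le_max lexx.
have l0 : 0 < l by rewrite lt_min tp1 tp2.
have Il : I l by rewrite /l; case: ltP.
have Im : I m by rewrite /m; case: ltP.
have JI : `[l, m] `<=` I.
  by move=> y /=; rewrite in_itv /= => ?; exact: cI Il Im _ _.
have J0 y : `[l, m]%classic y -> 0 < y.
  by rewrite /= in_itv /= => /andP[+ _]; exact: lt_le_trans.
have cont : {within `[l, m], continuous psi}.
  apply/subspace_continuousP => y Jy; have Iy := JI y Jy.
  have [df dg dh] := coef_dw Iy (J0 y Jy).
  have FF : Filter (within `[l, m]%classic (nbhs y)) by exact: within_filter.
  have ci : t @[t --> within `[l, m]%classic (nbhs y)] --> y by exact: cvg_within.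
  apply: cvgM; first exact: (cvgM ci (coef_cont JI Iy dh)).
  apply: cvgV; first by rewrite gt_eqF// coef_fg_gt0// J0.
  exact: (cvgD (coef_cont JI Iy df) (cvgM ci (coef_cont JI Iy dg))).
have half : Num.min (psi l) (psi m) <= 2^-1 <= Num.max (psi l) (psi m).
  have [ha' hb'] : (0 : R) <= 2^-1 /\ (2^-1 : R) <= 1 by split; lra.
  by rewrite /l /m; case: (ltP t1 t2) => _; rewrite p1 p2 ge_min le_max ha' hb' ?orbT.
have [y Jy yE] := IVT lm cont half.
have h2' : (2^-1 : R) != 0 by rewrite invr_eq0 pnatr_eq0.
have [[_ E]|[_ E]] := psi01 y (JI y Jy) (J0 y Jy).
  by move: h2'; rewrite -yE E eqxx.
have : (2^-1 : R) < 1 by lra.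
by rewrite -yE E ltxx.
Qed.

Section HermitianCase.
Hypothesis h0 : forall t, I t -> 0 < t -> coef_h t = 0.

(** The 1-form kills e because h = 0, and the orthogonal complement of e by
    [one_form_radial]. *)
Lemma lform_eq0 z v : D z -> z != 0 -> lform (b z) v = 0.
Proof.
move=> Dz z0; have [e [u [x [e1 u1 ue x0 zE]]]] := exists_frame Dz.
have xn0 : x != 0 by apply: contra z0 => /eqP x00; rewrite zE x00 scale0r.
have Dx : D (x%:C *: e) by rewrite -zE.
have t0 : 0 < x ^+ 2 by rewrite exprn_even_gt0.
have be : lform (b z) e = 0.
  have [_ _] := coef_values e1 u1 ue xn0 Dx; rewrite h0//; last exact: (trange_ray e1).
  move=> /esym/eqP; rewrite mulf_eq0 invr_eq0 (gt_eqF t0) orbF sqrf_eq0 normc_eq0 -zE.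
  by move/eqP.
pose w := v - hdot v e *: e.
have we : hdot w e = 0.
  by rewrite /w -scaleN1r hdotDl !hdotZl hdot_sqnorm e1 mulr1 mulN1r subrr.
have bw : lform (b z) w = 0.
  have [->|w0] := eqVneq w 0.
    by rewrite /lform big1 // => i _; rewrite mxE mulr0.
  have := one_form_radial e1 (normalize w0) _ Dx.
  rewrite hdotZl we mulr0 => /(_ erefl)/eqP; rewrite normc_eq0 -zE.
  rewrite -[X in lform _ X]addr0 -(scale0r (0 : 'cV[R[i]]_n)) lform_comb mul0r addr0.
  rewrite mulf_eq0 (inj_eq (@complexI R)) invr_eq0 gt_eqF ?sqrtr_gt0 ?sqnorm_gt0//=.
  by move/eqP.
have -> : v = hdot v e *: e + 1 *: w by rewrite scale1r /w addrC subrK.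
by rewrite lform_comb be bw !mulr0 addr0.
Qed.

Lemma F2_coef z v : D z -> z != 0 -> 0 < rform coef_f coef_g (z, v) ->
  F (z, v) ^+ 2 = rform coef_f coef_g (z, v).
Proof.
move=> Dz z0 P0; rewrite (F_coef v Dz z0) h0 ?sqnorm_gt0//; last by exists z.
by rewrite mul0r sqrtr0 addr0 sqr_sqrtr// ltW.
Qed.

(** The condition is evaluated at s = t / 2 over the open set D minus the
    origin, where the 1-form is 0 and F^2 is smooth. *)
Lemma coef_hermitian t : I t -> 0 < t -> coef_g t = derive_within I coef_f t.
Proof.
move=> It t0; have [e [u [x [e1 u1 ue x0 [tE Dx]]]]] := frame_of_t It.
pose s := t / 2; have s0 : 0 < s by rewrite divr_gt0.
have st : s < t by rewrite /s; lra.
pose z := x%:C *: e; pose v := frame_vec e u s t.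
have zt : sqnorm z = t by rewrite tE; exact: sqnorm_ray.
have vr : sqnorm v = 1 by apply: frame_vec_r => //; exact: ltW.
have qE : qfun (z, v) = s by apply: frame_vec_q => //; exact: ltW.
have v0 : v != 0 by rewrite -sqnorm_eq0 vr oner_eq0.
have z0 : z != 0 by rewrite -sqnorm_eq0 zt gt_eqF.
pose D' := D `&` [set z | z != 0].
have D'D : D' `<=` D by move=> y [].
have oD' : open D'.
  rewrite openE => y [Dy y0]; have n1 := open_nbhs_nbhs (conj oD Dy).
  have n2' : \forall y' \near y, y' != 0.
    have yp : 0 < sqnorm y by rewrite sqnorm_gt0.
    by apply: filterS (near_gt0 (@sqnorm_cont R n y) yp) => y'; rewrite sqnorm_gt0.
  by apply: filterS2 n1 n2' => y' ? ?.
have sm : smooth_at (fun q => F q ^+ 2) (z, v).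
  apply: (@hermitian_smooth_at _ _ D' F a b oD') => //.
  - by move=> i j; have [? ?] := aS i j; split; exact: (smooth_on_sub D'D).
  - by move=> y w [Dy _]; exact: a_pos.
  - by move=> y w [Dy _]; exact: F_ab.
  - by move=> y w [Dy y0]; exact: lform_eq0.
have W : weakly_kahler_at F z v by exact: wk.
have dw := coef_dw_near Dx z0 v0; have cn := coef_near Dx z0 v0.
have := @weakly_kahler_hermitian R n F I z v coef_f coef_g (derive_within I coef_f)
  (derive_within I coef_g) sm v0.
rewrite zt vr qE divr1 => H.
have [] := (H _ _ (coef_f_gt0 It) (coef_fg_gt0 It t0) _ _).1 W => //.
- by apply: filterS (near_over v Dx) => q Dq; exists q.1.
- by apply: filterS dw => q [].
- apply: filterS cn => q [Dq tp rf].
  have q0 : q.1 != 0 by rewrite -sqnorm_gt0.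
  by have := @F2_coef q.1 q.2 Dq q0; case: (q) rf => q1 q2 rf; exact.
- by have [] := nbhs_singleton cn.
- by move=> E; rewrite E ltxx in st.
Qed.

End HermitianCase.

(** By [phi_at0], f (x^2) is a smooth function of x. *)
Lemma coef_f_smooth : smooth_within I coef_f.
Proof.
move=> k t It; have [e [u [x [e1 u1 ue x0 [-> Dx]]]]] := frame_of_t It.
have [d d0 dD] := ray_near oD Dx.
(* The interval around x either avoids 0 or is centered at 0. *)
pose eps := if x == 0 then d else Num.min d x.
have e0 : 0 < eps by rewrite /eps; case: eqVneq => // xn; rewrite lt_min d0 lt_def xn.
have JD y : `|y - x| < eps -> D (y%:C *: e).
  move=> H; apply: dD; apply: lt_le_trans H _; rewrite /eps; case: eqP => // _.
  by rewrite ge_min lexx.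
have avoid : (forall y, `|y - x| < eps -> y != 0) \/ x = 0.
  rewrite /eps; case: eqVneq => [|xn]; [by right|left => y].
  apply: contraTneq => ->; rewrite sub0r normrN ger0_norm// -leNgt ge_min lexx orbT//.
apply: (@square_iter R I x eps (@trange_ge0 _ _ _) _ avoid _ (fun y => hA (y%:C *: e) u)).
- by move=> y /JD; exact: trange_ray.
- by move=> y /JD /(trange_ray e1); exact: trange_proper.
- exact: (smooth1_ray (ha_smooth u)).
- by move=> y /JD; exact: phi_at0.
- by rewrite /= subrr normr0.
Qed.

Lemma randers_kahler_form : connected D -> exists f : R -> R,
    [/\ smooth_within I f,
        forall t, I t -> 0 < f t &
        let f' := derive_within I f in
        (forall z v, D z -> v != 0 ->
           let t := sqnorm z in
           let s := svar z v in
           let A := f t + (t * f' t - f t) / (2 * t) * s in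
           let B := (t * f' t + f t) / (2 * t) * s in
           [/\ 0 <= A, 0 <= B & phi t s = (Num.sqrt A + Num.sqrt B) ^+ 2])
        \/
        (forall z v, D z -> v != 0 ->
           let t := sqnorm z in
           let s := svar z v in
           phi t s = f t + f' t * s)].
Proof.
move=> cD; exists coef_f; split; [exact: coef_f_smooth|exact: coef_f_gt0|].
have [h0|h0] := coef_h_dichotomy cD; [right|left] => z v Dz v0 /=.
- have [->|z0] := eqVneq z 0; first by rewrite sqnorm0 svar0 mulr0 addr0.
  have r0 : 0 < sqnorm v by rewrite sqnorm_gt0.
  have t0 : 0 < sqnorm z by rewrite sqnorm_gt0.
  have It : I (sqnorm z) by exists z.
  have [_ _ P0] := nbhs_singleton (coef_near Dz z0 v0).
  apply: (mulfI (lt0r_neq0 r0)).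
  rewrite -(F2_phi a_pos F_ab F_phi Dz v0) (F2_coef h0 Dz z0 P0) /rform /=.
  rewrite (coef_hermitian h0 It t0) -[svar z v]/(qfun (z, v) / sqnorm v).
  by field; rewrite gt_eqF.
- have [z0|z0] := eqVneq z 0.
    have It : I (sqnorm z) by exists z.
    have := coef_f_gt0 It; rewrite z0 sqnorm0 svar0.
    by rewrite !mulr0 addr0 sqrtr0 addr0 => ?; rewrite sqr_sqrtr ltW.
  have r0 : 0 < sqnorm v by rewrite sqnorm_gt0.
  have t0 : 0 < sqnorm z by rewrite sqnorm_gt0.
  have It : I (sqnorm z) by exists z.
  have [_ _ P0] := nbhs_singleton (coef_near Dz z0 v0).
  have [<- <-] := coef_pde It t0 (h0 _ It t0).
  have sE : svar z v = qfun (z, v) / sqnorm v by [].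
  have AE : rform coef_f coef_g (z, v) = sqnorm v * (coef_f (sqnorm z) + coef_g (sqnorm z) * svar z v).
    by rewrite /rform /= sE; field; rewrite gt_eqF.
  have BE : coef_h (sqnorm z) * qfun (z, v) = sqnorm v * (coef_h (sqnorm z) * svar z v).
    by rewrite sE; field; rewrite gt_eqF.
  split.
  + by rewrite AE pmulr_rgt0// in P0; exact: ltW.
  + rewrite sE; apply: mulr_ge0; first exact: ltW (h0 _ It t0).
    by rewrite divr_ge0 ?qfun_ge0// ltW.
  apply: (mulfI (lt0r_neq0 r0)).
  rewrite -(F2_phi a_pos F_ab F_phi Dz v0) (F_coef v Dz z0) AE BE.
  rewrite !(@sqrtrM _ (sqnorm v)) ?ltW// -mulrDr exprMn sqr_sqrtr ?ltW//.
Qed.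

End Necessity.

(** * Sufficiency *)

Section Sufficiency.
Variable f : R -> R.
Hypothesis sf : smooth_within I f.
Hypothesis f_gt0 : forall t, I t -> 0 < f t.
Local Notation f1 := (derive_within I f).
Local Notation f2 := (derive_within I f1).

Lemma dw_f t : I t -> is_dw I f t (f1 t).
Proof. by move=> It; apply: is_dw_of_cvg; exact: (@sf 0%N t It). Qed.

Lemma dw_f1 t : I t -> is_dw I f1 t (f2 t).
Proof. by move=> It; apply: is_dw_of_cvg; exact: (@sf 1%N t It). Qed.

Lemma F2_svar z v (A : R) : D z -> v != 0 -> phi (sqnorm z) (svar z v) = A ->
  F (z, v) ^+ 2 = sqnorm v * A.
Proof. by move=> Dz v0 <-; exact: (F2_phi a_pos F_ab F_phi Dz v0). Qed.

Lemma svar_self (z : 'cV[R[i]]_n) : z != 0 -> svar z z = sqnorm z.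
Proof.
move=> z0; have t0 : sqnorm z != 0 by rewrite sqnorm_eq0.
rewrite -[svar z z]/(qfun (z, z) / sqnorm z).
have -> : qfun (z, z) = sqnorm z ^+ 2.
  by apply: complexI; rewrite qfunE /= hdot_sqnorm conjc_real expr2 rcM.
by rewrite expr2 mulfK.
Qed.

Lemma near_v_neq0 (z v : 'cV[R[i]]_n) : v != 0 -> \forall q \near ((z, v) : T10 R n), q.2 != 0.
Proof.
rewrite -sqnorm_gt0 => vp.
by apply: filterS (near_gt0 (@sqnorm_v_cont R n (z, v)) vp) => q; rewrite sqnorm_gt0.
Qed.

Lemma kaehler_form_weakly_kahler :
  (forall z v, D z -> v != 0 ->
     phi (sqnorm z) (svar z v) = f (sqnorm z) + f1 (sqnorm z) * svar z v) ->
  weakly_kahler D F.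
Proof.
move=> form z v Dz v0 sm.
have F2 z' v' : D z' -> v' != 0 -> F (z', v') ^+ 2 = rform f f1 (z', v').
  move=> Dz' v0'; rewrite (F2_svar Dz' v0' (form _ _ Dz' v0')) /rform /=.
  rewrite -[svar z' v']/(qfun (z', v') / sqnorm v').
  by field; rewrite sqnorm_eq0.
have F2p z' v' : D z' -> v' != 0 -> 0 < rform f f1 (z', v').
  by move=> Dz' v0'; rewrite -F2// exprn_gt0// (F_gt0 a_pos F_ab Dz' v0').
have It : I (sqnorm z) by exists z.
have ftg : 0 < f (sqnorm z) + sqnorm z * f1 (sqnorm z).
  have [z0|z0] := eqVneq z 0.
    by have := f_gt0 It; rewrite z0 sqnorm0 mul0r addr0.

  have := exprn_gt0 2 (F_gt0 a_pos F_ab Dz z0).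
  rewrite (F2_svar Dz z0 (form _ _ Dz z0)) svar_self// pmulr_rgt0 ?sqnorm_gt0//.
  by rewrite [_ * f1 _]mulrC.
have nD := near_over v Dz.
apply: (@weakly_kahler_hermitian R n F I z v f f1 f1 f2 sm v0 _ _ (f_gt0 It) ftg _ _).2.
- by apply: filterS nD => q Dq; exists q.1.
- by apply: filterS nD => q Dq; split; [apply: dw_f|apply: dw_f1]; exists q.1.
- by apply: filterS2 nD (near_v_neq0 z v0) => q Dq q0; have := F2 q.1 q.2 Dq q0; case: (q).
- exact: F2p.
- by right.
Qed.

Section FormOne.
Hypothesis form : forall z v, D z -> v != 0 ->
  let t := sqnorm z in
  let s := svar z v in
  let A := f t + (t * f1 t - f t) / (2 * t) * s in
  let B := (t * f1 t + f t) / (2 * t) * s in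
  [/\ 0 <= A, 0 <= B & phi t s = (Num.sqrt A + Num.sqrt B) ^+ 2].

Let g t := 2^-1 * f1 t + - 2^-1 * (f t / t).
Let h t := 2^-1 * f1 t + 2^-1 * (f t / t).

Let gE t : t != 0 -> g t = (t * f1 t - f t) / (2 * t).
Proof. by move=> t0; rewrite /g; field. Qed.

Let hE t : t != 0 -> h t = (t * f1 t + f t) / (2 * t).
Proof. by move=> t0; rewrite /h; field. Qed.

Let fgE t : t != 0 -> f t + t * g t = t * h t.
Proof. by move=> t0; rewrite /g /h; field. Qed.

Lemma form_one_F z v : D z -> z != 0 -> v != 0 -> [/\ 0 <= rform f g (z, v),
  0 <= h (sqnorm z) * qfun (z, v) & F (z, v) ^+ 2 =
    (Num.sqrt (rform f g (z, v)) + Num.sqrt (h (sqnorm z) * qfun (z, v))) ^+ 2].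
Proof.
move=> Dz z0 v0; have t0 : sqnorm z != 0 by rewrite sqnorm_eq0.
have r0 : 0 < sqnorm v by rewrite sqnorm_gt0.
have [] := form Dz v0; rewrite -gE// -hE// => A0 B0 E.
have sE : svar z v = qfun (z, v) / sqnorm v by [].
have AE : rform f g (z, v) = sqnorm v * (f (sqnorm z) + g (sqnorm z) * svar z v).
  by rewrite /rform /= sE; field; rewrite gt_eqF.
have BE : h (sqnorm z) * qfun (z, v) = sqnorm v * (h (sqnorm z) * svar z v).
  by rewrite sE; field; rewrite gt_eqF.
rewrite AE BE; split; [exact: mulr_ge0 (ltW r0) A0|exact: mulr_ge0 (ltW r0) B0|].
rewrite (F2_svar Dz v0 E) !(@sqrtrM _ (sqnorm v)) ?ltW//.
by rewrite -mulrDr exprMn sqr_sqrtr ?ltW.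
Qed.

Lemma qfun_self (z : 'cV[R[i]]_n) : qfun (z, z) = sqnorm z ^+ 2.
Proof. by apply: complexI; rewrite qfunE /= hdot_sqnorm conjc_real expr2 rcM. Qed.

(** Otherwise F (z, z) = 0, because f + t g = t h. *)
Lemma form_one_h z : D z -> z != 0 -> 0 < h (sqnorm z).
Proof.
move=> Dz z0; have t0 : 0 < sqnorm z by rewrite sqnorm_gt0.
have [P0 Q0 E] := form_one_F Dz z0 z0.
have := exprn_gt0 2 (F_gt0 a_pos F_ab Dz z0); rewrite E.
have -> : rform f g (z, z) = h (sqnorm z) * qfun (z, z).
  rewrite /rform /= qfun_self; transitivity (sqnorm z * (f (sqnorm z) + sqnorm z * g (sqnorm z))).
    by ring.
  by rewrite fgE ?gt_eqF//; ring.
rewrite qfun_self in Q0 *; apply: contraTT; rewrite -leNgt => h0.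
have -> : h (sqnorm z) * sqnorm z ^+ 2 = 0.
  by apply/eqP; rewrite eq_le Q0 andbT pmulr_lle0// exprn_gt0.
by rewrite sqrtr0 addr0 expr0n ltxx.
Qed.

Lemma form_one_P z v : D z -> z != 0 -> v != 0 -> 0 < rform f g (z, v).
Proof.
move=> Dz z0 v0; have t0 : 0 < sqnorm z by rewrite sqnorm_gt0.
have It : I (sqnorm z) by exists z.
apply: rform_gt0; [exact: f_gt0| |by rewrite sqnorm_gt0|exact: qfun_ge0|exact: qfun_le].
by rewrite fgE ?gt_eqF// mulr_gt0// form_one_h.
Qed.

(** At (z, v) with |v| = 1 and z = x v the formula gives F^2 = 2 (t f' + f),
    which tends to 2 f (0) as x tends to 0, whereas F^2 = f (0) at (0, v). *)
Lemma form_one_zero : ~ D 0.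
Proof.
move=> D0; have [u u1 _] := exists_orthogonal (0 : 'cV[R[i]]_n) n2.
have u0 : u != 0 by rewrite -sqnorm_eq0 u1 oner_eq0.
have I0 : I 0 by exists 0; rewrite ?sqnorm0.
have D0u : D ((0 : R)%:C *: u) by rewrite scale0r.
have [d d0 dD] := ray_near oD D0u.
pose N x := Num.sqrt (hA (x%:C *: u) u) + Num.sqrt (hB (x%:C *: u) u ^+ 2).
pose psi x := N x * N x.
have psiE x : D (x%:C *: u) -> psi x = F (x%:C *: u, u) ^+ 2.
  by move=> Dx; rewrite F_ab// /psi -expr2 /N sqrtr_sqr ger0_norm ?normc_ge0.
have cpsi : {for 0, continuous psi}.
  have cA := ray_continuous (ha_smooth u) D0u; have cB := ray_continuous (hb_smooth u) D0u.
  have cs (w : R -> R) : {for 0, continuous w} -> {for 0, continuous (fun x => Num.sqrt (w x))}.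
    by move=> cw; apply: (continuous_cvg _ _ cw); exact: sqrt_continuous.
  have cN : {for 0, continuous N} := cvgD (cs _ cA) (cs _ cB); by apply: (@cvgM _ _ _ _ N N (N 0) (N 0)); exact: cN.
have dsq : is_derive (0 : R) 1 (fun x : R => x ^+ 2) (2 * 0).
  have := @is_deriveX _ _ id 2 0 1 1 (is_derive_id (0 : R) 1).
  by rewrite /GRing.scale /= mulr1; congr is_derive; apply/funext => w; rewrite fctE.
have sq0 : (0 : R) ^+ 2 = 0 by rewrite expr0n.
have Isq : \forall x \near (0 : R), I (x ^+ 2).
  apply/nbhs_ballP; exists d => //= x; rewrite /ball /= => xd.
  by apply: (trange_ray u1); apply: dD; rewrite distrC.
have ccont (c c' : R -> R) : is_dw I c 0 (c' 0) -> {for (0 : R), continuous (fun x : R => c (x ^+ 2))}.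
  move=> dc; apply: differentiable_continuous; apply/derivable1_diffP.
  by have [] := dw_comp (g := fun x : R => x ^+ 2) dc sq0 Isq dsq.
have cf := ccont _ _ (dw_f I0); have cf1 := ccont _ _ (dw_f1 I0).
pose w x := psi x - 2 * (x ^+ 2 * f1 (x ^+ 2) + f (x ^+ 2)).
have cw : {for 0, continuous w}.
  have csq : {for 0, continuous (fun x : R => x ^+ 2)} by exact: exprn_continuous.
  apply: cvgB => //; apply: cvgM; first exact: cvg_cst.
  by apply: cvgD => //; exact: (cvgM csq cf1).
have w0 : w 0 = 0.
  apply: (@zero_at_right _ d w d0); first by apply: cvg_at_right_filter; exact: cw.
  move=> x x0 xd; have Dx : D (x%:C *: u) by apply: dD; rewrite subr0 gtr0_norm.
  have zt : sqnorm (x%:C *: u) = x ^+ 2 by exact: sqnorm_ray.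
  have z0 : x%:C *: u != 0 by rewrite -sqnorm_eq0 zt expf_neq0// gt_eqF.
  have [P0 Q0] := form_one_F Dx z0 u0; rewrite /w psiE// => ->.
  have qE : qfun (x%:C *: u, u) = x ^+ 2.
    by apply: complexI; rewrite qfunE /= hdotZr hdot_sqnorm u1 mulr1 conjcK conjc_real expr2 rcM.
  have x2 : x ^+ 2 != 0 by rewrite expf_neq0// gt_eqF.
  have rE : rform f g (x%:C *: u, u) = h (x ^+ 2) * x ^+ 2.
    by rewrite /rform /= zt u1 qE mulr1 [g _ * _]mulrC fgE// mulrC.
  rewrite rE zt qE in P0 *.
  rewrite -mulr2n exprMn_n sqr_sqrtr// hE//.
  by field; rewrite gt_eqF.
move/eqP: w0; rewrite /w psiE// (_ : (0 : R)%:C *: u = 0) ?scale0r//.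
have [_ _] := form D0 u0; rewrite sqnorm0.
have f00 := f_gt0 I0.
rewrite svar0 !mulr0 addr0 sqrtr0 addr0 sqr_sqrtr ?ltW// => E.
have := F2_svar D0 u0 (A := f 0); rewrite sqnorm0 svar0 u1 => /(_ E) ->.
by rewrite sq0 mul0r add0r mul1r subr_eq0 -subr_eq0 => /eqP H; move: f00; lra.
Qed.

(** Along v + y z with y real one has |beta| = |y| t sqrt h, so F^2 has a corner
    at y = 0. *)
Lemma form_one_cusp z v : D z -> z != 0 -> v != 0 -> qfun (z, v) = 0 ->
  ~ smooth_at (fun q => F q ^+ 2) (z, v).
Proof.
move=> Dz z0 v0 qv [U [oU Uzv] sm].
have [_ /(_ (0, z)) /=] := sm [::] (z, v) Uzv.
have t0 : 0 < sqnorm z by rewrite sqnorm_gt0.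
have r0 : 0 < sqnorm v by rewrite sqnorm_gt0.
have vz : hdot v z = 0.
  have /eqP := qfunE (z, v); rewrite qv /= eq_sym mulf_eq0 conjc_eq0 orbb.
  by move/eqP.
have h0 := form_one_h Dz z0; have It : I (sqnorm z) by exists z.
have f0 := f_gt0 It.
pose t := sqnorm z; pose r := sqnorm v.
(* The coefficient of |y| in the cross term of the square, at y = 0. *)
pose c := 2 * (t * Num.sqrt (h t) * Num.sqrt (f t * r)).
have c0 : 0 < c by rewrite /c !mulr_gt0 ?sqrtr_gt0 ?mulr_gt0.
apply: (@cusp_not_derivable _ _ c c0) => x.
have lineE y : real_line (fun q => F q ^+ 2) (z, v) (0, z) y =
  (Num.sqrt (f t * r + t * (t * h t) * y ^+ 2) + `|y| * (t * Num.sqrt (h t))) ^+ 2.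
  have -> : real_line (fun q => F q ^+ 2) (z, v) (0, z) y = F (z, v + y%:C *: z) ^+ 2.
    rewrite /real_line; congr (F _ ^+ 2).
    by congr (_, _); rewrite /= scaler0 addr0.
  have rE : sqnorm (v + y%:C *: z) = r + y ^+ 2 * t.
    have zv : hdot z v = 0 by rewrite hdotC vz conjc0.
    apply: complexI; rewrite -hdot_sqnorm !(hdotDl, hdotDr, hdotZl, hdotZr) vz zv.
    by rewrite !hdot_sqnorm conjc_real rcD expr2 !rcM; ring.
  have qE : qfun (z, v + y%:C *: z) = (y * t) ^+ 2.
    apply: complexI; rewrite qfunE /= hdotDl hdotZl vz hdot_sqnorm add0r cJM !conjc_real.
    by rewrite -!rcM -expr2.
  have w0 : v + y%:C *: z != 0.
    by rewrite -sqnorm_gt0 rE ltr_wpDr// mulr_ge0 ?sqr_ge0 ?ltW.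
  have [_ _ ->] := form_one_F Dz z0 w0; rewrite /rform /= rE qE -/t.
  congr ((_ + _) ^+ 2).
    congr Num.sqrt; rewrite -(fgE (t := t)) ?gt_eqF//; ring.
  by rewrite mulrC sqrtrM ?sqr_ge0// sqrtr_sqr normrM (gtr0_norm t0) mulrA.
have [t1 r1 f1' h1] := And4 (ltW t0) (ltW r0) (ltW f0) (ltW h0).
have fr : 0 <= f t * r by exact: mulr_ge0.
have th : 0 <= t * (t * h t) * x ^+ 2.
  by apply: mulr_ge0; [do 2!apply: mulr_ge0 => //|exact: sqr_ge0].
rewrite !lineE normr0 mul0r addr0 expr0n mulr0 addr0 (sqr_sqrtr fr).
rewrite sqrrD sqr_sqrtr; last by rewrite addr_ge0.
have m1 : Num.sqrt (f t * r) <= Num.sqrt (f t * r + t * (t * h t) * x ^+ 2).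
  by rewrite ler_wsqrtr// lerDl.
have m2 : 0 <= `|x| * (t * Num.sqrt (h t)) by rewrite !mulr_ge0 ?sqrtr_ge0.
have := ler_wpM2r m2 m1; have := sqr_ge0 (`|x| * (t * Num.sqrt (h t))).
have -> : c * `|x| = 2 * (Num.sqrt (f t * r) * (`|x| * (t * Num.sqrt (h t)))) by rewrite /c; ring.
rewrite -[_ *+ 2]mulr_natl; move: th.
set p1 := t * _ * _; set p2 := Num.sqrt _ * _; set p3 := Num.sqrt _ * _; set p4 := _ ^+ 2.
move: (f t * r) p1 p2 p3 p4 => y1 y2 y3 y4 y5 {m1 m2 fr t1 r1 f1' h1 t0 r0 h0 f0 c0 lineE} ? ? ?; lra.
Qed.

Lemma form_one_weakly_kahler : weakly_kahler D F.
Proof.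
move=> z v Dz v0 sm.
have z0 : z != 0 by apply: contraPneq Dz => ->; exact: form_one_zero.
have t0 : 0 < sqnorm z by rewrite sqnorm_gt0.
have It : I (sqnorm z) by exists z.
have q0 : 0 < qfun (z, v).
  rewrite lt_def qfun_ge0 andbT; apply/eqP => q0.
  exact: (form_one_cusp Dz z0 v0 q0 sm).
have nD := near_over v Dz.
have nz : \forall q \near ((z, v) : T10 R n), 0 < sqnorm q.1.
  by apply: (near_gt0 (@sqnorm_z_cont R n (z, v))).
have nq : \forall q \near ((z, v) : T10 R n), 0 < qfun q.
  exact: (near_gt0 (@qfun_cont R n (z, v)) q0).
pose g1 t := 2^-1 * f2 t + - 2^-1 * (f1 t * t^-1 + f t * - t ^- 2).
pose h1 t := 2^-1 * f2 t + 2^-1 * (f1 t * t^-1 + f t * - t ^- 2).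
have dgh t : I t -> 0 < t -> is_dw I g t (g1 t) /\ is_dw I h t (h1 t).
  move=> It' t0'; have df := dw_f It'; have df1 := dw_f1 It'.
  have dfi := is_dw_over_id (lt0r_neq0 t0') It' df.
  by split; exact: is_dw_comb.
have ftg : 0 < f (sqnorm z) + sqnorm z * g (sqnorm z).
  by rewrite fgE ?gt_eqF// mulr_gt0// form_one_h.
apply: (@weakly_kahler_typeI R n F I z v f g f1 g1 sm v0 _ _ (f_gt0 It) ftg h h1 _ _).2.
- by apply: filterS nD => q Dq; exists q.1.
- apply: filterS2 nD nz => q Dq tq; have Iq : I (sqnorm q.1) by exists q.1.
  by split; [exact: dw_f|have [] := dgh _ Iq tq].
- apply: filterS2 nD nz => q Dq tq; have Iq : I (sqnorm q.1) by exists q.1.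
  by have [] := dgh _ Iq tq.
- have nv := near_v_neq0 z v0; near=> q.
  have Dq : D q.1 by near: q.
  have qz : q.1 != 0 by rewrite -sqnorm_gt0; near: q.
  have qv : q.2 != 0 by near: q.
  have qq : 0 < qfun q by near: q.
  have [_ _ E] := form_one_F Dq qz qv; have P := form_one_P Dq qz qv.
  split.
  + by case: (q) P.
  + by rewrite mulr_gt0// form_one_h.
  + by case: (q) E.
right; set s := qfun _ / _; set t := sqnorm z.
have e1 : g t + h t - f1 t = 0 by rewrite /g /h; field; rewrite gt_eqF.
have gE' : g t = (t * f1 t - f t) / (2 * t) by rewrite gE ?gt_eqF.
have hE' : h t = (t * f1 t + f t) / (2 * t) by rewrite hE ?gt_eqF.
have g1E : g1 t = (f2 t - f1 t / t + f t / t ^+ 2) / 2 by rewrite /g1; field; rewrite gt_eqF.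
have h1E : h1 t = (f2 t + f1 t / t - f t / t ^+ 2) / 2 by rewrite /h1; field; rewrite gt_eqF.
rewrite e1 mul0r add0r gE' hE' g1E h1E typeI_solution//.
by rewrite mul0r mulr0.
Unshelve. all: by end_near. Qed.

End FormOne.
End Sufficiency.

End UnitaryRanders.

Local Close Scope complex_scope.

Theorem theorem1p1 (R : realType) (n : nat) (n_ge2 : (2 <= n)%N)
    (D : set 'cV[R[i]]_n) (F : T10 R n -> R) (phi : R -> R -> R)
    (domD : domain D)
    (randersF : is_complex_randers D F)
    (unitF : unitary_invariant D F)
    (F_phi : forall z v, D z ->
       F (z, v) = Num.sqrt (sqnorm v * phi (sqnorm z) (svar z v))) :
  weakly_kahler D F <->
  exists f : R -> R,
    [/\ smooth_within (trange D) f,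
        forall t, trange D t -> 0 < f t &
        let f' := derive_within (trange D) f in
        (forall z v, D z -> v != 0 ->
           let t := sqnorm z in
           let s := svar z v in
           let A := f t + (t * f' t - f t) / (2 * t) * s in
           let B := (t * f' t + f t) / (2 * t) * s in
           [/\ 0 <= A, 0 <= B & phi t s = (Num.sqrt A + Num.sqrt B) ^+ 2])
        \/
        (forall z v, D z -> v != 0 ->
           let t := sqnorm z in
           let s := svar z v in
           phi t s = f t + f' t * s)].
Proof.
have [oD cD _] := domD.
have [_ [a [b [[aS aH a_pos] bS F_ab]]]] := randersF.
split=> [wk|[f [sf f0 [form|form]]]].
- exact: (randers_kahler_form n_ge2 oD aS bS aH a_pos F_ab F_phi wk cD).
- exact: (form_one_weakly_kahler n_ge2 oD aS bS a_pos F_ab F_phi sf f0 form).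
- exact: (kaehler_form_weakly_kahler oD a_pos F_ab F_phi sf f0 form).
Qed.
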